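(* Let $(\mathscr{S},d)$ be a complete metric space, let $f\colon \mathscr{S}\to(-\infty,+\infty]$ be proper and lower semicontinuous, and let $u_0\in D(f)$. Suppose that $f$ is $(p_0,\lambda)$-convex with $\lambda=0$ and some $p_0\in(1,+\infty)$. Then for all $p,p'\in(1,+\infty)$ the map $$\Lambda\colon \mathrm{CMS}_p([0,+\infty);u_0)\to\mathrm{CMS}_{p'}([0,+\infty);u_0),\qquad \Lambda(u):=u\circ\bm{t}_{p\to p',u},$$ is a (well-defined) bijection. In particular, if $\#\mathrm{CMS}_p([0,+\infty);u_0)=1$ for an exponent $p\in(1,+\infty)$, then $\#\mathrm{CMS}_{p'}([0,+\infty);u_0)=1$ for all $p'\in(1,+\infty)$.
   Context: $D(f):=\{v\in\mathscr{S}: f(v)<+\infty\}$; proper means $D(f)\neq\emptyset$. $\mathscr{L}$ is Lebesgue measure. The local slope is $|\partial^- f|(v):=\limsup_{w\to v}\frac{(f(v)-f(w))^+}{d(v,w)}$ if $v\in D(f)$ and $+\infty$ otherwise, where $r^+=\max\{r,0\}$. For $a\in(0,+\infty]$, $AC_{loc}([0,a);\mathscr{S})$ is the set of curves $u\colon[0,a)\to\mathscr{S}$ for which there is $m\in L^1_{loc}([0,a))$ (integrable on compact subsets of $[0,a)$) with $d(u(s),u(t))\le\int_s^t m(r)\,dr$ for all $s\le t$ in $[0,a)$; for such $u$ the metric derivative $|u'|(t):=\lim_{s\to t}\frac{d(u(t),u(s))}{|t-s|}$ exists for $\mathscr{L}$-a.e. $t$. Let $p\in(1,+\infty)$ with conjugate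 exponent $q$ ($1/p+1/q=1$). A curve $u\in AC_{loc}([0,a);\mathscr{S})$ is a $p$-curve of maximal slope for $f$ starting from $u_0\in D(f)$ if $u(0)=u_0$, $f\circ u$ is non-increasing, and $(f\circ u)'(t)\le-\frac1p|u'|^p(t)-\frac1q|\partial^- f|^q(u(t))$ for $\mathscr{L}$-a.e. $t\in[0,a)$. $\mathrm{CMS}_p([0,a);u_0)$ denotes the set of all such curves defined on $[0,a)$. $f$ is $(p,\lambda)$-convex ($p\in(1,+\infty)$, $\lambda\in\mathbb{R}$) if there is $\psi\colon[0,1]\to[0,1]$ with $\lim_{t\downarrow0}\psi(t)=0$ and $\psi(t)<1$ for some $t\in(0,1)$, such that for any $v_0,v_1\in\mathscr{S}$ there is a curve (continuous map) $\gamma\colon[0,1]\to\mathscr{S}$ from $v_0$ to $v_1$ with $d(\gamma_t,\gamma_0)\le t\,d(\gamma_1,\gamma_0)$ and $f(\gamma_t)\le(1-t)f(\gamma_0)+tf(\gamma_1)-\lambda t(1-\psi(t))d^p(\gamma_0,\gamma_1)$ for every $t\in[0,1]$. For $u\in\mathrm{CMS}_p([0,a);u_0)$, $T^\ast_u:=\sup\{t\in[0,a): |\partial^- f|(u(t))>0\}\in[0,+\infty]$ (with $\sup\emptyset=0$). For exponents $p,p'$ with conjugates $q,q'$ put $\alpha:=1-\frac pq\cdot\frac{q'}{p'}$, $S^\ast_{p\to p'}:=\int_0^{T^\ast_u}|u'|^\alpha(r)\,dr\in[0,+\infty]$, and let $\tilde{\bm{t}}_{p\to p'}\colon[0,S^\ast_{p\to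 p'})\to[0,T^\ast_u)$ be the inverse of the strictly increasing map $\tilde{\bm{s}}_{p\to p'}\colon[0,T^\ast_u)\to[0,S^\ast_{p\to p'})$, $t\mapsto\int_0^t|u'|^\alpha(r)\,dr$. For $u\in\mathrm{CMS}_p([0,+\infty);u_0)$, $\bm{t}_{p\to p',u}\colon[0,+\infty)\to[0,T^\ast_u]$ equals $\tilde{\bm{t}}_{p\to p'}$ on $[0,S^\ast_{p\to p'})$ and equals $T^\ast_u$ on $[S^\ast_{p\to p'},+\infty)$. When the value $+\infty$ is attained, $u(+\infty):=\lim_{t\to+\infty}u(t)$ (existence of this limit in that case is part of the well-definedness of $\Lambda$). *)

(* Defs.v *)
From HB Require Import structures.
From mathcomp Require Import all_boot all_order all_algebra.
From mathcomp Require Import all_classical all_reals all_analysis.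

Set Implicit Arguments.
Unset Strict Implicit.
Unset Printing Implicit Defensive.

Import Order.TTheory GRing.Theory Num.Theory.
Import numFieldNormedType.Exports.

Local Open Scope classical_set_scope.
Local Open Scope ring_scope.

#[short(type="completeMetricType")]
HB.structure Definition CompleteMetric (K : numDomainType) :=
  {M of CompletePseudoMetric K M & Metric K M}.

Section functionals.
Context {R : realType} {S : metricType R}.
Implicit Types (f : S -> \bar R) (v : S).

Definition effective_domain f : set S := [set v | (f v < +oo)%E].

Definition proper_function f : Prop := effective_domain f !=set0.

(* The lim sup is over w -> v with w <> v. The outer maximum only matters at an
   isolated point v, where the lim sup over the empty punctured neighbourhood is
   -oo in the library and 0 by the usual convention for slopes. *)
Definition local_slope f v : \bar R :=
  if (f v < +oo)%E then
    maxe 0%E (limf_esup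
      (fun w => maxe (f v - f w) 0 * ((mdist v w)^-1)%R%:E)%E (v^'))
  else +oo%E.

Definition pl_convex f (p lam : R) : Prop :=
  exists psi : R -> R,
    [/\ (forall t, t \in `[0, 1] -> psi t \in `[0, 1]),
        psi t @[t --> 0^'+] --> 0,
        (exists2 t, t \in `]0, 1[ & psi t < 1) &
        forall v0 v1 : S, exists gam : R -> S,
          [/\ {within `[0, 1], continuous gam}, gam 0 = v0, gam 1 = v1 &
              forall t, t \in `[0, 1] ->
                mdist (gam t) (gam 0) <= t * mdist (gam 1) (gam 0) /\
                (f (gam t) <= (1 - t)%R%:E * f (gam 0%R) + t%:E * f (gam 1%R)
                  - (lam * t * (1 - psi t)
                     * mdist (gam 0) (gam 1) `^ p)%R%:E)%E]].

End functionals.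

Section exponents.
Context {R : realType}.
Implicit Types p : R.

Definition conj_exponent p : R := (1 - p^-1)^-1.

Lemma conj_exponentE p : p^-1 + (conj_exponent p)^-1 = 1.
Proof. by rewrite /conj_exponent invrK addrC subrK. Qed.

Definition alpha p p' : R :=
  1 - p / conj_exponent p * (conj_exponent p' / p').

End exponents.

Section curves.
Context {R : realType} {S : metricType R}.
Implicit Types (f : S -> \bar R) (a : \bar R) (u : R -> S) (p : R).

Local Notation mu := (@lebesgue_measure R).

Definition interval0 a : set R := [set t | 0 <= t /\ (t%:E < a)%E].

(* A curve on [0, a) is represented in this section by a map on R of which only
   the values on [0, a) are ever used. *)

Definition AC_loc a u : Prop :=
  exists2 m : R -> R,
    (forall K, K `<=` interval0 a -> compact K ->
       mu.-integrable K (EFin \o m)) &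
    (forall s t, interval0 a s -> interval0 a t -> s <= t ->
       mdist (u s) (u t) <= \int[mu]_(r in `[s, t]) m r).

Definition metric_derivative a u (t : R) : R :=
  lim (mdist (u t) (u s) / `|t - s| @[s --> within (interval0 a) t^']).

(* f \o u is finite along such curves as soon as f > -oo and f u0 < +oo, hence
   the use of fine to differentiate it. *)
Definition max_slope_curve f p a (u0 : S) u : Prop :=
  [/\ AC_loc a u,
      u 0 = u0,
      (forall s t, interval0 a s -> interval0 a t -> s <= t ->
         (f (u t) <= f (u s))%E) &
      {ae mu, forall t, interval0 a t ->
         derivable (fine \o f \o u) t 1 /\
         ((derive1 (fine \o f \o u) t)%:E
          <= - (p^-1 * metric_derivative a u t `^ p)%R%:E
             - ((conj_exponent p)^-1)%R%:E
               * local_slope f (u t) `^ conj_exponent p)%E}].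

Definition stop_time f a u : \bar R :=
  maxe 0%E (ereal_sup
    [set t%:E | t in [set t | interval0 a t /\ (0 < local_slope f (u t))%E]]).

(* powR sends 0 to 0 for a negative exponent; for the curves at hand the metric
   derivative vanishes only on a null subset of [0, stop_time f a u). *)
Definition speed_power p p' a u (r : R) : R :=
  metric_derivative a u r `^ alpha p p'.

Definition s_tilde p p' a u (t : R) : \bar R :=
  (\int[mu]_(r in `[0%R, t]) (speed_power p p' a u r)%:E)%E.

Definition S_star f p p' a u : \bar R :=
  (\int[mu]_(r in interval0 (stop_time f a u)) (speed_power p p' a u r)%:E)%E.

Definition t_tilde f p p' a u (s : R) : R :=
  'pinv_(fun=> 0) (interval0 (stop_time f a u)) (s_tilde p p' a u) s%:E.

Definition time_change f p p' u (s : R) : \bar R :=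
  if (s%:E < S_star f p p' +oo u)%E then (t_tilde f p p' +oo u s)%:E
  else stop_time f +oo u.

End curves.

Section Lambda.
Context {R : realType} {S : completeMetricType R}.
Implicit Types (f : S -> \bar R) (u : {nonneg R} -> S) (p : R).

(* Curves on [0, +oo) are maps on {nonneg R}; extend u is one of the extensions
   of u to R. *)
Definition extend u (t : R) : S := u (`|t|%:nng).

Definition CMS f p (u0 : S) : set ({nonneg R} -> S) :=
  [set u | max_slope_curve f p +oo u0 (extend u)].

Definition eval_at u (t : \bar R) : S :=
  match t with
  | r%:E => extend u r
  | +oo%E => lim (extend u r @[r --> +oo])
  | -oo%E => point
  end.

Definition Lambda f p p' u : {nonneg R} -> S :=
  fun s => eval_at u (time_change f p p' (extend u) s%:num).

(* The implicit claims behind the definition of Lambda f p p' u: s_tilde is a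
   strictly increasing bijection from [0, stop_time) onto [0, S_star), and u has
   a limit at +oo whenever the time change takes the value +oo. *)
Definition Lambda_well_defined f p p' u : Prop :=
  let U := extend u in
  [/\ (forall s t, interval0 (stop_time f +oo U) s ->
         interval0 (stop_time f +oo U) t -> s < t ->
         (s_tilde p p' +oo U s < s_tilde p p' +oo U t)%E),
      set_bij (interval0 (stop_time f +oo U))
        [set s%:E | s in interval0 (S_star f p p' +oo U)]
        (s_tilde p p' +oo U) &
      (exists2 s : R, 0 <= s & time_change f p p' U s = +oo%E) ->
      cvg (U r @[r --> +oo])].

End Lambda.

(* Main.v *)
Require Import Defs.
From HB Require Import structures.
From mathcomp Require Import all_boot all_order all_algebra.
From mathcomp Require Import all_classical all_reals all_analysis.
From mathcomp Require Import measurable_realfun.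
From mathcomp Require Import ring lra.

(** Let q and q' be the exponents conjugate to p and p', and let g(t) be the
    slope of f at U t.

    Convexity with lambda = 0 makes the local slope a global one: f v - f w is at
    most the slope at v times d(v, w) ([local_slope_global]). In particular the
    slope is lower semicontinuous, and f decreases along an absolutely continuous
    curve at most at the rate g |U'|. For a p-curve of maximal slope this is the
    equality case of Young's inequality, so that |U'| = g^(q-1) and
    (f o U)' = - g^q at almost every time. Integrating these relations shows that
    g is nonincreasing, and then, for all 0 < s <= t,

      (t - s) g(t)^q <= f (U s) - f (U t),   d(U s, U t) <= (t - s) g(s)^(q-1).

    Curves with these properties are called slope flows with exponent q below;
    [curve_slope_flow] shows that p-curves of maximal slope are slope flows, and
    [flow_max_slope_curve] is the converse. Both inequalities being about
    increments, no derivative of a composite curve is ever taken afterwards.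

    Since (q - 1) alpha = q - q', the time change of the statement has density
    g^(q-q'). It turns the speed g^(q-1) into g^(q'-1) and the dissipation g^q into
    g^q', whatever the exponents, hence slope flows with exponent q into slope
    flows with exponent q' ([time_change_flow]). Up to the stopping time T the
    slope is positive and the new time strictly increasing; from T on the slope is
    0 and the curve is constant. If T is infinite and the total new time S* finite,
    the speed bound in the new time makes the curve Cauchy, and the dissipation
    bound forces the slope of its limit to be 0 ([eval_flow_endpoint]): the new
    curve may stay at this limit forever. The time change from p' to p has density
    g^(q'-q), inverse to the first one; so it undoes it ([clock_inverse],
    [time_change_round_trip]), and Lambda is a bijection.

    The monotonicity of g replaces the differentiation of compositions throughout:
    two increments that agree to first order, with an error controlled by a
    monotone function, are equal ([subadditive_le0]). *)

Set Implicit Arguments.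
Unset Strict Implicit.
Unset Printing Implicit Defensive.

Import Order.TTheory GRing.Theory Num.Theory.
Import numFieldNormedType.Exports.

Local Open Scope classical_set_scope.
Local Open Scope ring_scope.

(** * Densities of dominated functions on the line *)

Section real_line.
Context {R : realType}.
Local Notation mu := (@lebesgue_measure R).

Lemma Rintegral_oc_split (h : R -> R) (a b c : R) : a <= b -> b <= c ->
  mu.-integrable `]a, c] (EFin \o h) ->
  \int[mu]_(r in `]a, c]) h r =
  \int[mu]_(r in `]a, b]) h r + \int[mu]_(r in `]b, c]) h r.
Proof.
move=> ab bc ih.
by rewrite -(Rintegral_itvB ih (x := b)) ?bnd_simp// addrC subrK.
Qed.

(** Right continuity is what turns N into the distribution function of a
    Lebesgue-Stieltjes measure. *)
Lemma right_continuous_dominated (N h : R -> R) : nondecreasing N ->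
  mu.-integrable setT (EFin \o h) ->
  (forall s t, s <= t -> N t - N s <= \int[mu]_(r in `]s, t]) h r) ->
  right_continuous N.
Proof.
move=> ndN ih Nh x; apply/cvgrPdist_le => /= e e0.
have := @parameterized_integral_cvg_left R x (x + 1) h.
rewrite ltrDl ltr01 => /(_ isT).
have ih' : mu.-integrable `[x, x + 1] (EFin \o h) by exact: integrableS ih.
move=> /(_ ih')/cvgrPdist_le/(_ _ e0) H.
near=> y.
have xy : x <= y by [].
rewrite distrC ger0_norm ?subr_ge0 ?ndN// (le_trans (Nh _ _ xy))//.
rewrite Rintegral_itv_obnd_cbnd; last exact: integrableS ih.
rewrite (le_trans (ler_norm _))//.
have : `|0 - parameterized_integral mu x y h| <= e.
  by near: y; apply: cvg_within.
by rewrite sub0r normrN.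
Unshelve. all: by end_near. Qed.

Lemma lebesgue_stieltjes_measure_ocitv (N : cumulative R R) (s t : R) :
  s <= t -> lebesgue_stieltjes_measure N `]s, t]%classic = (N t - N s)%:E.
Proof.
move=> st; rewrite /lebesgue_stieltjes_measure /measure_extension.
by rewrite measurable_mu_extE/= ?wlength_itv_bnd//; exact: is_ocitv.
Qed.

(** Let G be a primitive of h. The function G - N is again nondecreasing, and
    by uniqueness of Stieltjes measures those of N and of G - N add up to the
    measure of density h. The measure of N is thus finite and absolutely
    continuous, and its Radon-Nikodym derivative is the density. *)
Lemma dominated_density (N h : R -> R) : nondecreasing N ->
  mu.-integrable setT (EFin \o h) -> (forall x, 0 <= h x) ->
  (forall s t, s <= t -> N t - N s <= \int[mu]_(r in `]s, t]) h r) ->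
  exists2 n : R -> R, mu.-integrable setT (EFin \o n) &
    forall s t, s <= t -> N t - N s = \int[mu]_(r in `]s, t]) n r.
Proof.
move=> ndN ih h0 Nh.
have ihS (A : set R) : measurable A -> mu.-integrable A (EFin \o h).
  by move=> mA; apply: integrableS ih.
pose G t := \int[mu]_(r in `]-oo, t]) h r.
have GB s t : s <= t -> G t - G s = \int[mu]_(r in `]s, t]) h r.
  by move=> st; rewrite /G Rintegral_itvB//; exact: ihS.
have ndG : nondecreasing G.
  by move=> s t st; rewrite -subr_ge0 GB// Rintegral_ge0.
pose K t := G t - N t.
have ndK : nondecreasing K.
  by move=> s t st; rewrite /K; have := Nh _ _ st; rewrite -GB//; lra.
have Kh s t : s <= t -> K t - K s <= \int[mu]_(r in `]s, t]) h r.
  by move=> st; rewrite -GB// /K; have := ndN _ _ st; lra.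
pose cN : cumulative R R := HB.pack N
  (isCumulative.Build _ _ _ N ndN (right_continuous_dominated ndN ih Nh)).
pose cK : cumulative R R := HB.pack K
  (isCumulative.Build _ _ _ K ndK (right_continuous_dominated ndK ih Kh)).
have Gh s t : s <= t -> G t - G s <= \int[mu]_(r in `]s, t]) h r.
  by move=> /GB ->.
(* the measure of G serves as a bridge: it is h dx, and it is the sum for N and K *)
pose cG : cumulative R R := HB.pack G
  (isCumulative.Build _ _ _ G ndG (right_continuous_dominated ndG ih Gh)).
have lam0 : forall A, (0 <= induced_charge ih A)%E.
  by move=> A; apply: integral_ge0 => x _; rewrite lee_fin.
pose lam := measure_of_charge _ lam0.
pose nu := lebesgue_stieltjes_measure cN.
have lamE A : measurable A -> lebesgue_stieltjes_measure cG A = lam A.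
  apply: lebesgue_stieltjes_measure_unique => X [[s t] _ <-]/=.
  have [st|ts] := leP s t; last first.
    by rewrite set_itv_ge ?measure0// bnd_simp -leNgt ltW.
  rewrite lebesgue_stieltjes_measure_ocitv//= GB// /lam /measure_of_charge.
  rewrite /induced_charge /Rintegral fineK//.
  by apply: integrable_fin_num => //; exact: ihS.
have addE A : measurable A -> lebesgue_stieltjes_measure cG A =
    measure_add nu (lebesgue_stieltjes_measure cK) A.
  apply: lebesgue_stieltjes_measure_unique => X [[s t] _ <-]/=.
  have [st|ts] := leP s t; last first.
    by rewrite set_itv_ge ?measure0// bnd_simp -leNgt ltW.
  rewrite /measure_add/= /msum/= !big_ord_recl/= big_ord0 adde0.
  rewrite /nu !lebesgue_stieltjes_measure_ocitv//= -EFinD; congr EFin.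
  by rewrite /K; lra.
have nu_lam A : measurable A -> (nu A <= lam A)%E.
  move=> mA; rewrite -lamE// addE//= /measure_add/= /msum/= !big_ord_recl/=.
  by rewrite big_ord0 adde0 leeDl.
have nuT : (nu setT < +oo)%E.
  rewrite (le_lt_trans (nu_lam _ measurableT))// /lam /measure_of_charge.
  by rewrite ltey_eq fin_num_measure.
pose nu1 := mfrestr measurableT nuT.
have nu1E A : nu1 A = nu A by rewrite /nu1 /mfrestr /mrestr setIT.
have nu_mu : nu1 `<< mu.
  apply/null_content_dominatesP => A mA muA0; apply/eqP; rewrite eq_le measure_ge0 andbT.
  rewrite nu1E (le_trans (nu_lam _ mA))// /lam /measure_of_charge /induced_charge.
  by rewrite null_set_integral//; exact: (measurable_int _ (ihS _ mA)).
have [n [n0 nfin ni nE]] := radon_nikodym_sigma_finite nu_mu.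
exists (fine \o n).
  by apply: eq_integrable ni => // x _ /=; rewrite fineK.
move=> s t st; rewrite /Rintegral.
transitivity (fine (nu1 `]s, t]%classic)).
  by rewrite nu1E /nu lebesgue_stieltjes_measure_ocitv.
congr fine; transitivity (\int[mu]_(x in `]s, t]) n x)%E; first exact: nE.
by apply: eq_integral => x _ /=; rewrite fineK.
Qed.

Lemma ge0_subset_Rintegral (h : R -> R) (A B : set R) :
  measurable A -> measurable B -> A `<=` B -> mu.-integrable B (EFin \o h) ->
  (forall x, B x -> 0 <= h x) ->
  \int[mu]_(r in A) h r <= \int[mu]_(r in B) h r.
Proof.
move=> mA mB AB ih h0.
have ihA : mu.-integrable A (EFin \o h) by exact: integrableS ih.
rewrite fine_le ?integrable_fin_num//.
apply: ge0_subset_integral => //; first exact: (measurable_int _ ih).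
Qed.

(** With G a primitive of `|m| on [a, b], both G and G + x are nondecreasing
    and dominated, so that x is a difference of two functions having a
    density. *)
Lemma ac_density (x m : R -> R) (a b : R) : a <= b ->
  mu.-integrable `[a, b] (EFin \o m) ->
  (forall s t, a <= s -> s <= t -> t <= b ->
    `|x t - x s| <= \int[mu]_(r in `[s, t]) m r) ->
  exists2 n : R -> R, mu.-integrable setT (EFin \o n) &
    forall s t, a <= s -> s <= t -> t <= b ->
      x t - x s = \int[mu]_(r in `]s, t]) n r.
Proof.
move=> ab im xm.
pose h : R -> R := (fun r => `|m r|) \_ `[a, b].
have ih : mu.-integrable setT (EFin \o h).
  rewrite /h -restrict_EFin; apply/integrable_restrict => //=; rewrite setTI.
  exact: integrable_norm im.
have ihS (A : set R) : measurable A -> mu.-integrable A (EFin \o h).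
  by move=> mA; apply: integrableS ih.
have h0 r : 0 <= h r by rewrite /h patchE; case: ifPn.
(* c clamps to [a, b]: x \o c extends x from [a, b] by constants *)
pose c t := Num.max a (Num.min b t).
pose G t := \int[mu]_(r in `]-oo, t]) h r.
have GB s t : s <= t -> G t - G s = \int[mu]_(r in `]s, t]) h r.
  by move=> st; rewrite /G Rintegral_itvB//; exact: ihS.
have cge t : a <= c t by rewrite /c le_max lexx.
have cle t : c t <= b by rewrite /c ge_max ab ge_min lexx.
have chomo s t : s <= t -> c s <= c t.
  by move=> st; rewrite /c; case: (leP b s); case: (leP b t); rewrite /Order.max /Order.min; do ?case: ifPn; lra.
have cid t : a <= t -> t <= b -> c t = t.
  by move=> at_ tb; rewrite /c min_r// max_r.
have xh s t : s <= t -> `|x (c t) - x (c s)| <= \int[mu]_(r in `]s, t]) h r.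
  move=> st.
  have [|ta] := leP t a.
    move=> ta; have -> : c t = c s.
      by rewrite /c !max_l// ge_min ?ta ?(le_trans st ta) orbT.
    by rewrite subrr normr0 Rintegral_ge0.
  have [bs|sb] := leP b s.
    have -> : c t = c s by rewrite /c (min_l bs) (min_l (le_trans bs st)).
    by rewrite subrr normr0 Rintegral_ge0.
  have sc : s <= c s by rewrite /c (min_r (ltW sb)) le_max lexx orbT.
  have ct : c t <= t by rewrite /c ge_max (ltW ta) ge_min lexx orbT.
  apply: le_trans (xm _ _ (cge _) (chomo _ _ st) (cle _)) _.
  have sub : `[c s, c t] `<=` `[a, b].
    by move=> r /=; rewrite !in_itv/= => /andP[u v]; rewrite (le_trans (cge s) u) (le_trans v (cle t)).
  have im' : mu.-integrable `[c s, c t] (EFin \o m) by exact: integrableS im.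
  rewrite Rintegral_itv_obnd_cbnd; last exact: ihS.
  apply: (@le_trans _ _ (\int[mu]_(r in `[c s, c t]) h r)).
    apply: le_Rintegral => //; first exact: ihS.
    by move=> r rc; rewrite /h patchE ifT ?ler_norm// inE; exact: sub.
  apply: ge0_subset_Rintegral => //.
  - by move=> r /=; rewrite !in_itv/= => /andP[u v]; rewrite (le_trans sc u) (le_trans v ct).
  - exact: ihS.
pose N t := G t + x (c t).
have ndN : nondecreasing N.
  move=> s t st; rewrite /N; have := xh _ _ st; rewrite -GB// ler_norml.
  by move=> /andP[]; lra.
have ih2 : mu.-integrable setT (EFin \o (fun r => h r + h r)).
  by apply: eq_integrable (integrableD _ ih ih).
have Nh s t : s <= t -> N t - N s <= \int[mu]_(r in `]s, t]) (h r + h r).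
  move=> st; rewrite RintegralD//; [|exact: ihS..].
  by rewrite -GB// /N; have := xh _ _ st; rewrite -GB// ler_norml => /andP[]; lra.
have [n nint nE] := dominated_density ndN ih2 (fun r => addr_ge0 (h0 r) (h0 r)) Nh.
exists (fun r => n r - h r).
  by apply: eq_integrable (integrableB _ nint ih).
move=> s t as_ st tb; rewrite RintegralB//; [|exact: integrableS nint|exact: ihS].
by rewrite -nE// -GB// /N !cid ?(le_trans as_ st)//?(le_trans st tb)//; lra.
Qed.

End real_line.

(** * Derivatives at a point *)

Section derivatives.
Context {R : realType}.
Local Notation mu := (@lebesgue_measure R).

(** Filter monotonicity, for the presentation of the almost-everywhere filter
    under which statements about Lebesgue measure on R elaborate. *)
Lemma aeS (P Q : R -> Prop) : (forall t, P t -> Q t) ->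
  {ae mu, forall t, P t} -> {ae mu, forall t, Q t}.
Proof. exact: (@filterS _ _ (ae_filter_ringOfSetsType mu)). Qed.

Lemma aeS2 (P1 P2 Q : R -> Prop) : (forall t, P1 t -> P2 t -> Q t) ->
  {ae mu, forall t, P1 t} -> {ae mu, forall t, P2 t} -> {ae mu, forall t, Q t}.
Proof. exact: (@filterS2 _ _ (ae_filter_ringOfSetsType mu)). Qed.

(** Differentiability without quotients: increments are what gets compared
    below, and the same shape makes sense for distances (metric_deriv_at). *)
Definition deriv_at (F : R -> R) (t l : R) : Prop :=
  forall e, 0 < e -> exists2 d, 0 < d & forall s, `|s - t| < d ->
    `|F s - F t - l * (s - t)| <= e * `|s - t|.

Lemma deriv_atP (F : R -> R) (t l : R) :
  deriv_at F t l <-> derivable F t 1 /\ derive1 F t = l.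
Proof.
pose Q h := h^-1 *: (F (h + t) - F t).
have QE h : (fun h => h^-1 *: ((F \o shift t) (h *: 1) - F t)) h = Q h.
  by rewrite /Q /= [h *: 1]mulr1.
have -> : (derivable F t 1 /\ derive1 F t = l) <-> Q h @[h --> 0^'] --> l.
  have QE' : (fun h => h^-1 *: ((F \o shift t) (h *: 1) - F t)) = Q by exact/funext.
  rewrite /derivable /derive1 -/Q QE'; split=> [[cF <-]|cF] //.
  by split; [apply/cvg_ex; exists l|exact: cvg_lim cF].
split=> [H|/cvgrPdist_le H].
  apply/cvgrPdist_le => e e0; have [d d0 {}H] := H _ e0.
  near=> h.
  have h0 : h != 0 by near: h; exact: nbhs_dnbhs_neq.
  have hd : `|h| < d by near: h; exact: dnbhs0_lt.
  have := H (h + t); rewrite addrK => /(_ hd) {}H.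
  rewrite -(ler_pM2r (x := `|h|)) ?normr_gt0// -normrM (le_trans _ H)//.
  rewrite mulrBl /Q /GRing.scale/= mulrAC mulVf// mul1r -normrN.
  by rewrite opprB.
move=> e e0; have /nbhs_ballP[d /= d0 {}H] := H _ e0.
exists d => // s sd; have [->|st] := eqVneq s t.
  by rewrite !subrr mulr0 subr0 !normr0 mulr0.
have st0 : s - t != 0 by rewrite subr_eq0.
have := H (s - t); rewrite /ball/= sub0r normrN => /(_ sd st0).
rewrite /Q subrK /GRing.scale/= -(ler_pM2r (x := `|s - t|)) ?normr_gt0//.
rewrite -normrM mulrBl mulrAC mulVf// mul1r -normrN.
by rewrite opprB.
Unshelve. all: by end_near. Qed.

Definition metric_deriv_at {S : metricType R} (u : R -> S) (t l : R) : Prop :=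
  forall e, 0 < e -> exists2 d, 0 < d & forall s, `|s - t| < d ->
    `|mdist (u t) (u s) - l * `|s - t| | <= e * `|s - t|.

Lemma ae_deriv_primitive (n : R -> R) : mu.-integrable setT (EFin \o n) ->
  {ae mu, forall t, deriv_at (fun t => \int[mu]_(r in `]-oo, t]) n r) t (n t)}.
Proof.
move=> ni; apply: aeS (FTC1Ny (f := n) _ _) => [t|y|].
- by move=> /deriv_atP.
- exact: integrableS ni.
- by apply: open_integrable_locally => //; exact: openT.
Qed.

Lemma primitiveB (n : R -> R) s t : mu.-integrable setT (EFin \o n) -> s <= t ->
  \int[mu]_(r in `]-oo, t]) n r - \int[mu]_(r in `]-oo, s]) n r =
  \int[mu]_(r in `]s, t]) n r.
Proof. by move=> ni st; rewrite Rintegral_itvB//; exact: integrableS ni. Qed.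

Lemma ae_le_Rintegral (f g : R -> R) (A : set R) : measurable A ->
  mu.-integrable A (EFin \o f) -> mu.-integrable A (EFin \o g) ->
  {ae mu, forall t, A t -> f t <= g t} ->
  \int[mu]_(r in A) f r <= \int[mu]_(r in A) g r.
Proof.
move=> mA if_ ig fg.
have ifg : mu.-integrable A (EFin \o (fun r => `|f r| + `|g r|)).
  have [na nb] := (integrable_norm if_, integrable_norm ig).
  by apply: eq_integrable (integrableD _ na nb).
have imax : mu.-integrable A (EFin \o (fun r => Num.max (f r) (g r))).
  apply: le_integrable ifg => //.
    apply/measurable_EFinP; apply: measurable_maxr; apply/measurable_EFinP.
      exact: (measurable_int _ if_).
    exact: (measurable_int _ ig).
  move=> r _ /=; rewrite lee_fin [leRHS]ger0_norm ?addr_ge0//.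
  by rewrite /Order.max; case: ifP => _; rewrite ?lerDl ?lerDr.
apply: (@le_trans _ _ (\int[mu]_(r in A) Num.max (f r) (g r))).
  by apply: le_Rintegral => // r _; rewrite le_max lexx.
rewrite le_eqVlt; apply/orP; left; apply/eqP; congr fine.
apply: ae_eq_integral => //.
- exact: (measurable_int _ imax).
- exact: (measurable_int _ ig).
by apply: aeS fg => r fg Ar; rewrite /= max_r// fg.
Qed.

Lemma deriv_at_norm_le (F G : R -> R) (a b t l k : R) : a < t < b ->
  (forall s, a < s < b -> `|F s - F t| <= `|G s - G t|) ->
  deriv_at F t l -> deriv_at G t k -> `|l| <= `|k|.
Proof.
move=> /andP[at_ tb] FG dF dG; apply/ler_addgt0Pr => e e0.
have e20 : 0 < e / 2 by rewrite divr_gt0.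
have [d1 d10 H1] := dF _ e20; have [d2 d20 H2] := dG _ e20.
pose h := Num.min (Num.min d1 d2) (b - t) / 2.
have m0 : 0 < Num.min (Num.min d1 d2) (b - t) by rewrite !lt_min d10 d20 subr_gt0.
have h0 : 0 < h by rewrite divr_gt0.
have : h < Num.min (Num.min d1 d2) (b - t) by rewrite /h ltr_pdivrMr// ltr_pMr// ltr1n.
rewrite !lt_min -andbA => /and3P[hd1 hd2 hb].
have hE : t + h - t = h by rewrite addrC addKr.
have := H1 (t + h); rewrite hE (gtr0_norm h0) => /(_ hd1) {}H1.
have := H2 (t + h); rewrite hE (gtr0_norm h0) => /(_ hd2) {}H2.
have := FG (t + h); rewrite (lt_le_trans at_) ?lerDl ?(ltW h0)//= => /(_ _) {}FG.
have {}FG := FG ltac:(lra).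
rewrite -(ler_pM2r h0) mulrDl -[in X in X <= _](gtr0_norm h0) -normrM.
rewrite -[in X in _ <= X + _](gtr0_norm h0) -normrM.
have : `|l * h| <= `|F (t + h) - F t| + e / 2 * h.
  rewrite -lerBlDl (le_trans _ H1)//.
  by rewrite -(normrN (_ - _ - _)) opprB (le_trans (lerB_dist _ _))//.
have : `|G (t + h) - G t| <= `|k * h| + e / 2 * h.
  by rewrite -lerBlDl (le_trans _ H2)// (le_trans (lerB_dist _ _)).
lra.
Qed.

End derivatives.

(** * Metric derivatives of absolutely continuous curves *)

Section metric_speed.
Context {R : realType} {S : metricType R}.
Local Notation mu := (@lebesgue_measure R).

Lemma mdist_lipschitz (y p q : S) : `|mdist y q - mdist y p| <= mdist p q.
Proof.
rewrite ler_norml; apply/andP; split.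
  by rewrite lerBrDr addrC lerBlDr (metric_sym p q) metric_triangle.
by rewrite lerBlDr addrC metric_triangle.
Qed.

(** The speed is the supremum w over rational q of the absolute values of the
    derivatives of the real functions r |-> d(u q, u r), which have densities
    because they are dominated by m. Each of them varies less than u;
    conversely d(u s, u t) is the increment on [s, t] of the function with q =
    s, up to an approximation of s by rationals, so that u is dominated by w.
    At a time where all these functions, and the primitive of w, are
    differentiable, the increments of u are squeezed between the two.
    Truncating at `|m| makes the supremum finite at every time. *)
Lemma metric_speed (u : R -> S) (m : R -> R) (a b : R) : a < b ->
  mu.-integrable setT (EFin \o m) ->
  (forall s t, a <= s -> s <= t -> t <= b ->
    mdist (u s) (u t) <= \int[mu]_(r in `]s, t]) m r) ->
  exists w : R -> R,
    [/\ (forall r, 0 <= w r), mu.-integrable setT (EFin \o w),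
        (forall s t, a <= s -> s <= t -> t <= b ->
           mdist (u s) (u t) <= \int[mu]_(r in `]s, t]) w r) &
        {ae mu, forall t, a < t < b -> metric_deriv_at u t (w t)}].
Proof.
move=> ab im um.
have imS (A : set R) : measurable A -> mu.-integrable A (EFin \o m).
  by move=> mA; apply: integrableS im.
pose c t := Num.max a (Num.min b t).
have cge t : a <= c t by rewrite /c le_max lexx.
have cle t : c t <= b by rewrite /c ge_max (ltW ab) ge_min lexx.
have cid t : a <= t -> t <= b -> c t = t.
  by move=> at_ tb; rewrite /c min_r// max_r.
pose q k : R := if unpickle k is Some r then ratr r else 0.
pose x k r := mdist (u (c (q k))) (u r).
have xd k s t : `|x k t - x k s| <= mdist (u s) (u t) by exact: mdist_lipschitz.
have /choice[n nP] k : exists n : R -> R, mu.-integrable setT (EFin \o n) /\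
    forall s t, a <= s -> s <= t -> t <= b ->
      x k t - x k s = \int[mu]_(r in `]s, t]) n r.
  have [|s t as_ st tb|n ni nE] := @ac_density R (x k) m a b (ltW ab) (imS _ _) _ => //.
    apply: le_trans (xd _ _ _) _; apply: le_trans (um _ _ as_ st tb) _.
    by rewrite Rintegral_itv_obnd_cbnd//; exact: imS.
  by exists n.
pose e k r := Num.min `|n k r| `|m r|.
have e0 k r : 0 <= e k r by rewrite le_min !normr_ge0.
have eub r : has_ubound (range (e ^~ r)).
  by exists `|m r| => _ [k _ <-]; rewrite /e ge_min lexx orbT.
pose w r := sups (e ^~ r) 0%N.
have wE r : w r = sup (range (e ^~ r)).
  by rewrite /w /sups /=; congr sup; apply/seteqP; split => _ [k _ <-]; exists k.
have ew k r : e k r <= w r by rewrite wE; apply: ub_le_sup => //; exists k.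
have wm r : w r <= `|m r|.
  rewrite wE; apply: ge_sup; first by exists (e 0%N r); exists 0%N.
  by move=> _ [k _ <-]; rewrite /e ge_min lexx orbT.
have w0 r : 0 <= w r by exact: le_trans (e0 0%N r) (ew 0%N r).
have mm : measurable_fun setT m by apply/measurable_EFinP; exact: (measurable_int _ im).
have mn k : measurable_fun setT (n k).
  by apply/measurable_EFinP; exact: (measurable_int _ (nP k).1).
have mw : measurable_fun setT w.
  apply: measurable_fun_sups => // k.
  by apply: measurable_minr; exact: measurableT_comp.
have iw : mu.-integrable setT (EFin \o w).
  apply: le_integrable im => //; first exact/measurable_EFinP.
  by move=> r _; rewrite /= lee_fin ger0_norm.
have iwS (A : set R) : measurable A -> mu.-integrable A (EFin \o w).
  by move=> mA; apply: integrableS iw.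
have inS k (A : set R) : measurable A -> mu.-integrable A (EFin \o n k).
  by move=> mA; apply: integrableS (nP k).1.
pose Fn k t := \int[mu]_(r in `]-oo, t]) n k r.
pose Fm t := \int[mu]_(r in `]-oo, t]) m r.
pose Fw t := \int[mu]_(r in `]-oo, t]) w r.
have FnE k s t : a <= s -> s <= b -> a <= t -> t <= b ->
    Fn k s - Fn k t = x k s - x k t.
  move=> as_ sb at_ tb; have [st|ts] := leP s t.
    rewrite -opprB -[RHS]opprB (nP k).2//; congr (- _).
    by rewrite /Fn primitiveB//; exact: (nP k).1.
  by rewrite (nP k).2 ?(ltW ts)// /Fn primitiveB ?(ltW ts)//; exact: (nP k).1.
have FmE s t : a <= s -> s <= t -> t <= b ->
    mdist (u s) (u t) <= Fm t - Fm s.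
  by move=> as_ st tb; rewrite /Fm primitiveB// um.
(* the truncation is inactive almost everywhere *)
have nm : {ae mu, forall t, forall k, a < t < b -> `|n k t| <= `|m t|}.
  apply: ae_foralln => k.
  apply: aeS2 (ae_deriv_primitive (nP k).1) (ae_deriv_primitive im).
  move=> t dn dm /andP[at_ tb].
  apply: (deriv_at_norm_le (a := a) (b := b) _ _ dn dm); first by rewrite at_.
  move=> s /andP[as_ sb].
  rewrite -/(Fn k s) -/(Fn k t) -/(Fm s) -/(Fm t) FnE ?(ltW at_) ?(ltW tb) ?(ltW as_) ?(ltW sb)//.
  rewrite (le_trans (xd _ _ _))//.
  have [ts|st] := leP t s.
    by rewrite (le_trans (FmE _ _ _ _ _))// ?ler_norm// ltW.
  rewrite metric_sym distrC (le_trans (FmE _ _ _ _ _))// ?ler_norm// ltW//.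
have nw : {ae mu, forall t, forall k, a < t < b -> `|n k t| <= w t}.
  apply: aeS nm => t nm k atb; apply: le_trans (ew k t).
  by rewrite /e le_min lexx nm.
have intw s t : a <= s -> s <= t -> t <= b ->
    mdist (u s) (u t) <= \int[mu]_(r in `]s, t]) w r.
  move=> as_; rewrite le_eqVlt => /predU1P[<- _|st tb].
    by rewrite mdistxx Rintegral_ge0.
  apply/ler_addgt0Pl => eps eps0.
  have := @parameterized_integral_cvg_left R s t m st (imS _ (measurable_itv _)).
  move=> /cvgrPdist_lt/(_ _ eps0)/nbhs_ballP[d /= d0 Hd].
  have [|q0] := @rat_in_itvoo R s (Num.min (s + d) t).
    by rewrite lt_min ltrDl d0.
  rewrite in_itv/= lt_min => /and3P[sq qd qt].
  pose k := pickle q0; have qE : q k = ratr q0 by rewrite /q /k pickleK.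
  have [aq qb] : a <= ratr q0 /\ ratr q0 <= b.
    by rewrite (le_trans as_ (ltW sq)) (le_trans (ltW qt) tb).
  have cqE : c (q k) = ratr q0 by rewrite qE cid.
  apply: le_trans (metric_triangle _ (u (ratr q0)) _) _; apply: lerD.
    apply: le_trans (um _ _ as_ (ltW sq) qb) _.
    have := Hd (ratr q0); rewrite /ball/= distrC gtr0_norm ?subr_gt0//.
    rewrite ltrBlDl => /(_ qd); rewrite sub0r normrN => /ltW; apply: le_trans.
    rewrite /parameterized_integral Rintegral_itv_obnd_cbnd ?ler_norm//.
    exact: imS.
  have -> : mdist (u (ratr q0)) (u t) = x k t - x k (ratr q0).
    by rewrite /x cqE mdistxx subr0.
  rewrite (nP k).2 ?(ltW qt)//.
  apply: (@le_trans _ _ (\int[mu]_(r in `]ratr q0, t]) w r)); last first.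
    apply: ge0_subset_Rintegral => //; last exact: iwS.
    by apply: subset_itvr; rewrite bnd_simp ltW.
  rewrite -!Rintegral_itv_bndo_bndc; [|exact: iwS|exact: inS].
  apply: ae_le_Rintegral => //; [exact: inS|exact: iwS|].
  apply: aeS nw => r H /=; rewrite in_itv/= => /andP[qr rt].
  rewrite (le_trans (ler_norm _))// H// (le_lt_trans aq qr)/=.
  exact: lt_le_trans tb.
exists w; split => //.
have dn : {ae mu, forall t, forall k, deriv_at (Fn k) t (n k t)}.
  by apply: ae_foralln => k; exact: (ae_deriv_primitive (nP k).1).
apply: aeS2 (ae_deriv_primitive iw) dn => t dw {}dn /andP[at_ tb] eps eps0.
have eps20 : 0 < eps / 2 by rewrite divr_gt0.
have [|_ [k _ <-] wk] := @sup_adherent R (range (e ^~ t)) _ eps20.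
  by split => //; exists (e 0%N t); exists 0%N.
have {}wk : w t - eps / 2 < `|n k t|.
  by rewrite wE (lt_le_trans wk)// /e ge_min lexx.
have [d1 d10 H1] := dw _ eps0; have [d2 d20 H2] := dn k _ eps20.
exists (Num.min (Num.min d1 d2) (Num.min (t - a) (b - t))).
  by rewrite !lt_min d10 d20 !subr_gt0 at_ tb.
move=> s; rewrite !lt_min -andbA => /and4P[sd1 sd2 sta stb].
have /andP[as_ sb] : a < s < b.
  by move: sta stb; rewrite !ltr_norml => /andP[? ?] /andP[? ?]; apply/andP; split; lra.
have := H1 _ sd1; have := H2 _ sd2.
rewrite -/(Fn k s) -/(Fn k t) -/(Fw s) -/(Fw t) FnE ?(ltW at_) ?(ltW tb) ?(ltW as_) ?(ltW sb)// => {}H2 {}H1.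
have le1 : mdist (u t) (u s) <= `|Fw s - Fw t|.
  have [ts|st] := leP t s.
    rewrite (le_trans (intw _ _ _ _ _)) ?(ltW at_) ?(ltW sb)//.
    by rewrite /Fw primitiveB// ler_norm.
  rewrite metric_sym distrC (le_trans (intw _ _ _ _ _)) ?(ltW as_) ?(ltW st) ?(ltW tb)//.
  by rewrite /Fw primitiveB// ?ler_norm ?ltW.
have le2 : `|x k s - x k t| <= mdist (u t) (u s) by exact: xd.
have ge0st := normr_ge0 (s - t).
have le3 : `|Fw s - Fw t| <= w t * `|s - t| + eps * `|s - t|.
  rewrite -lerBlDl (le_trans _ H1)// -[in leLHS](ger0_norm (w0 t)) -normrM.
  exact: lerB_dist.
have le4 : `|n k t| * `|s - t| <= `|x k s - x k t| + eps / 2 * `|s - t|.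
  rewrite -lerBlDl (le_trans _ H2)// -normrM.
  by rewrite -[leRHS]normrN opprB lerB_dist.
have le5 : w t * `|s - t| <= `|n k t| * `|s - t| + eps / 2 * `|s - t|.
  by rewrite -mulrDl ler_wpM2r//; lra.
by rewrite ler_norml; apply/andP; split; lra.
Qed.

End metric_speed.

(** * Derivatives of monotone functions *)

Section monotone_derivative.
Context {R : realType}.
Local Notation mu := (@lebesgue_measure R).

(** Naming the translation lets it carry the structure of a measurable
    function, hence push Lebesgue measure forward. *)
Definition translation (h : R) : measurableTypeR R -> measurableTypeR R :=
  fun x => x + h.

Lemma measurable_translation h : measurable_fun setT (translation h).
Proof.
have msh : measurable_fun setT (fun x : R => x + h).
  by apply: measurable_funD => //; exact: measurable_cst.
exact: msh.
Qed.

HB.instance Definition _ h := isMeasurableFun.Build _ _ _ _ (translation h)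
  (measurable_translation h).

Lemma lebesgue_measure_translation (h : R) (A : set (measurableTypeR R)) :
  measurable A -> pushforward mu (translation h) A = mu A.
Proof.
move=> mA; apply/esym/lebesgue_measure_unique => //= _ [[a b]] _ <-.
rewrite /pushforward /= (_ : _ @^-1` _ = `]a - h, b - h]%classic).
  rewrite !lebesgue_measure_itv/= !lte_fin ltrD2r.
  by case: ifP => // _; rewrite -!EFinD; congr EFin; lra.
by apply/seteqP; split => r /=; rewrite /translation !in_itv/= => /andP[? ?]; apply/andP; split; lra.
Qed.

Lemma ge0_Rintegral_translation (A : R -> R) (a b h : R) :
  measurable_fun setT A -> (forall r, 0 <= A r) ->
  \int[mu]_(r in `]a, b[) A (r + h) = \int[mu]_(r in `]a + h, b + h[) A r.
Proof.
move=> mA A0; rewrite /Rintegral; congr fine.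
have -> : `]a, b[%classic = translation h @^-1` `]a + h, b + h[%classic.
  by apply/seteqP; split => r /=; rewrite /translation !in_itv/= => /andP[? ?]; apply/andP; split; lra.
transitivity (\int[pushforward mu (translation h)]_(r in `](a + h)%R, (b + h)%R[) (A r)%:E)%E.
  rewrite ge0_integral_pushforward//.
  - apply/measurable_EFinP; exact: measurable_funS mA.
  - by move=> r _; rewrite lee_fin.
apply: eq_measure_integral => //= B mB _; exact: lebesgue_measure_translation.
Qed.

Lemma bounded_integrable (A : R -> R) (a b C : R) :
  measurable_fun setT A -> (forall r, `|A r| <= C) ->
  mu.-integrable `]a, b[ (EFin \o A).
Proof.
move=> mA AC; apply: measurable_bounded_integrable => //.
- by rewrite /= lebesgue_measure_itv/=; case: ifP => // _; rewrite -EFinD ltry.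
- exact: measurable_funS mA.
- exists C; split; first exact: num_real.
  by move=> x Cx y _; exact: le_trans (AC y) (ltW Cx).
Qed.

(** The integrals of the difference quotients of N are at most N b - N a by
    translation invariance, and Fatou's lemma passes to the limit. Equality
    may fail, as N can have jumps. *)
Lemma monotone_deriv_integral_le (N kap : R -> R) (a b : R) : a <= b ->
  (forall s t, a <= s -> s <= t -> t <= b -> N s <= N t) ->
  measurable_fun setT kap -> (forall r, 0 <= kap r) ->
  {ae mu, forall t, a < t < b -> exists2 l, deriv_at N t l & kap t <= l} ->
  (\int[mu]_(r in `]a, b[) (kap r)%:E <= (N b - N a)%:E)%E.
Proof.
move=> ab ndN mk k0 dN.
pose c t := Num.max a (Num.min b t).
have cge t : a <= c t by rewrite /c le_max lexx.
have cle t : c t <= b by rewrite /c ge_max ab ge_min lexx.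
have chomo s t : s <= t -> c s <= c t.
  by move=> st; rewrite /c; case: (leP b s); case: (leP b t); rewrite /Order.max /Order.min; do ?case: ifPn; lra.
have cid t : a <= t -> t <= b -> c t = t.
  by move=> at_ tb; rewrite /c min_r// max_r.
pose A t := N (c t) - N a; pose C := N b - N a.
have ndA s t : s <= t -> A s <= A t by move=> st; rewrite lerB// ndN// chomo.
have A0 t : 0 <= A t by rewrite subr_ge0 ndN.
have AC t : A t <= C by rewrite lerB// ndN.
have C0 : 0 <= C := le_trans (A0 a) (AC a).
have mA : measurable_fun setT A by exact: nondecreasing_measurable.
pose h n : R := n.+1%:R^-1.
have h0 n : 0 < h n by rewrite /h invr_gt0.
have mAh n : measurable_fun setT (fun r : R => A (r + h n)).
  by apply: nondecreasing_measurable => // s t st; apply: ndA; rewrite lerD2r.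
pose D n r := (h n)^-1 * (A (r + h n) - A r).
have D0 n r : 0 <= D n r.
  by rewrite mulr_ge0 ?invr_ge0 ?(ltW (h0 n))// subr_ge0 ndA// lerDl ltW.
have iA : mu.-integrable `]a, b[ (EFin \o A).
  by apply: (@bounded_integrable _ _ _ C) => // r; rewrite ger0_norm.
have iAh n : mu.-integrable `]a, b[ (EFin \o (fun r => A (r + h n))).
  by apply: (@bounded_integrable _ _ _ C) => // r; rewrite ger0_norm.
have mD n : measurable_fun setT (D n).
  by apply: measurable_funM => //; exact: measurable_funB.
have DC n : (\int[mu]_(r in `]a, b[) (D n r)%:E <= C%:E)%E.
  have iB : mu.-integrable `]a, b[ (EFin \o (fun r => A (r + h n) - A r)).
    by apply: eq_integrable (integrableB _ (iAh n) iA).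
  have iD : mu.-integrable `]a, b[ (EFin \o D n).
    by apply: eq_integrable (integrableZl _ (h n)^-1 iB).
  rewrite -[leLHS]fineK; last exact: integrable_fin_num iD.
  rewrite lee_fin -/(Rintegral _ _ _) RintegralZl// RintegralB//.
  rewrite ge0_Rintegral_translation//.
  rewrite -ler_pdivlMl ?invr_gt0// invrK lerBlDr.
  have ibh (x y : R) : mu.-integrable `]x, y[ (EFin \o A).
    by apply: (@bounded_integrable _ _ _ C) => // r; rewrite ger0_norm.
  apply: (@le_trans _ _ (\int[mu]_(r in `]a, b + h n[) A r)).
    apply: ge0_subset_Rintegral => //.
    by apply: subset_itvr; rewrite bnd_simp lerDl ltW.
  have bbh : b <= b + h n by rewrite lerDl ltW.
  have := @Rintegral_itvB R A (BRight a) (BLeft (b + h n)) b (ibh _ _).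
  rewrite !bnd_simp ltrDl h0 => /(_ ab isT) /eqP; rewrite subr_eq => /eqP ->.
  rewrite -Rintegral_itv_bndo_bndc// lerD2r.
  apply: (@le_trans _ _ (\int[mu]_(r in `]b, b + h n[) C)).
    apply: le_Rintegral => //.
    by apply: (@bounded_integrable _ _ _ C) => // r; rewrite ger0_norm.
  rewrite Rintegral_cst//= lebesgue_measure_itv/= lte_fin ltrDl h0/=.
  by rewrite addrAC subrr add0r mulrC.
apply: (@le_trans _ _ (\int[mu]_(r in `]a, b[) limn_einf (fun n => (D n r)%:E)))%E; last first.
  apply: le_trans (fatou _ _ _ _) _ => //.
  - by move=> n; apply/measurable_EFinP; exact: measurable_funS (mD n).
  - by move=> n r _; rewrite lee_fin.
  - rewrite limn_einf_lim; apply: lime_le; first exact: is_cvg_einfs.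
    apply: nearW => n; apply: le_trans (DC n).
    by apply: ereal_inf_lbound; exists n => /=.
apply: ae_ge0_le_integral => //.
- by move=> r _; rewrite lee_fin.
- by apply/measurable_EFinP; exact: measurable_funS mk.
- move=> r _; rewrite limn_einf_lim; apply: lime_ge; first exact: is_cvg_einfs.
  apply: nearW => n; apply: le_ereal_inf_tmp => _ [k _ <-].
  by rewrite lee_fin.
- rewrite /limn_einf; apply: measurableT_comp => //.
  apply: measurable_fun_limn_esup => n.
  apply: measurableT_comp => //; apply/measurable_EFinP.
  exact: measurable_funS (mD n).
apply: aeS dN => t + /=; rewrite in_itv/= => /[swap] tab /(_ tab)[l dl kl].
have /andP[at_ tb] := tab.
suff -> : limn_einf (fun n => (D n t)%:E) = l%:E by rewrite lee_fin.
suff Dl : (fun n => (D n t)%:E) @ \oo --> l%:E by rewrite (cvg_limn_einf_sup Dl).1.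
apply: cvg_EFin; first exact: nearW.
apply/cvgrPdist_le => eps eps0; have [d d0 Hd] := dl _ eps0.
near=> n.
have hd : h n < d by near: n; exact: near_infty_natSinv_lt (PosNum d0).
have hb : h n < b - t.
  near: n; have bt : 0 < b - t by rewrite subr_gt0.
  exact: near_infty_natSinv_lt (PosNum bt).
have := Hd (t + h n); rewrite addrAC subrr add0r gtr0_norm// => /(_ hd).
have -> : N (t + h n) - N t = A (t + h n) - A t.
  rewrite /A !cid ?(ltW at_) ?(ltW tb)//; first by lra.
    by rewrite (le_trans (ltW at_))// lerDl ltW.
  by lra.
have -> : A (t + h n) - A t - l * h n = (D n t - l) * h n.
  by rewrite /D mulrBl mulrAC mulVf ?mul1r// gt_eqF.
by rewrite normrM (gtr0_norm (h0 n)) ler_pM2r// distrC.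
Unshelve. all: by end_near. Qed.

End monotone_derivative.

(** * Slopes of convex functionals *)

Section slope.
Context {R : realType} {S : metricType R}.
Variables (f : S -> \bar R) (p0 : R).
Hypothesis f_gtNy : forall v, (-oo < f v)%E.
Implicit Types v w : S.

Lemma local_slope_ge0 v : (0 <= local_slope f v)%E.
Proof. by rewrite /local_slope; case: ifP => _; rewrite ?le_max ?lexx ?leey. Qed.

Lemma domain_fin_num v : (f v < +oo)%E -> f v \is a fin_num.
Proof. by move=> fv; rewrite fin_numE gt_eqF ?f_gtNy//= lt_eqF. Qed.

Hypothesis f_convex : pl_convex f p0 0.

(** The local slope is a global one. Along the curve from v to w given by
    convexity, f has lost at least t times the total loss f v - f w after a
    displacement of at most t d(v, w), so that difference quotients at points
    arbitrarily close to v are at least the one at w. *)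
Lemma local_slope_global v w : (f v < +oo)%E -> (f w < +oo)%E ->
  (local_slope f v < +oo)%E ->
  fine (f v) - fine (f w) <= fine (local_slope f v) * mdist v w.
Proof.
move=> fv fw sv; rewrite leNgt; apply/negP => H.
have s0 := local_slope_ge0 v.
have vw : v != w.
  apply: contraTneq H => <-; rewrite subrr -leNgt mulr_ge0 ?mdist_ge0//.
  exact: fine_ge0.
have d0 : 0 < mdist v w by rewrite mdist_gt0.
have fvw : 0 < fine (f v) - fine (f w).
  by apply: le_lt_trans H; rewrite mulr_ge0 ?mdist_ge0// fine_ge0.
pose k := (fine (f v) - fine (f w)) / mdist v w.
have sk : (local_slope f v < k%:E)%E.
  rewrite -(@fineK _ (local_slope f v)) ?lte_fin; last by rewrite ge0_fin_numE.
  by rewrite /k ltr_pdivlMr.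
move: sk; apply/negP; rewrite -leNgt /local_slope fv le_max; apply/orP; right.
apply: le_ereal_inf_tmp => _ [V /= nV <-].
case: f_convex => psi [_ _ _ /(_ v w)[gam [_ g0 g1 Hg]]].
have : nbhs v (fun z => z != v -> V z).
  by move: nV; rewrite /dnbhs /within/=.
move=> /nbhs_ballP[d /= dp dV].
(* small enough for gam t to fall in the given neighbourhood of v *)
pose t := Num.min (1 / 2) (d / (2 * mdist v w)).
have t0 : 0 < t by rewrite lt_min !divr_gt0// mulr_gt0.
have t1 : t < 1 by rewrite gt_min (_ : 1 / 2 < 1)//; lra.
have td : t * mdist v w < d.
  have : t <= d / (2 * mdist v w) by rewrite /t ge_min lexx orbT.
  rewrite ler_pdivlMr ?mulr_gt0//; lra.
have [|dg fg] := Hg t; first by rewrite in_itv/= !ltW.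
rewrite g0 g1 in dg fg.
have fgy : (f (gam t) <= ((1 - t) * fine (f v) + t * fine (f w))%:E)%E.
  apply: le_trans fg _; rewrite !mul0r sube0.
  by rewrite -[f v]fineK ?domain_fin_num// -[f w]fineK ?domain_fin_num.
have fgf : (f (gam t) < +oo)%E by apply: le_lt_trans fgy (ltry _).
have fgr : fine (f (gam t)) <= (1 - t) * fine (f v) + t * fine (f w).
  by rewrite -lee_fin fineK// domain_fin_num.
have gv : gam t != v.
  by apply/eqP => E; move: fgr; rewrite E; nra.
have dgv : 0 < mdist v (gam t) by rewrite mdist_gt0 eq_sym.
rewrite metric_sym (metric_sym w) in dg.
apply: le_ereal_sup_tmp; exists (maxe (f v - f (gam t)) 0%R * ((mdist v (gam t))^-1)%:E)%E.
  exists (gam t) => //; apply: dV => //.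
  by rewrite ballEmdist/=; apply: le_lt_trans dg td.
rewrite -[f v]fineK ?domain_fin_num// -[f (gam t)]fineK ?domain_fin_num//.
rewrite -EFinB -EFin_max -EFinM lee_fin.
rewrite -(@ler_pM2r _ (mdist v (gam t)))// mulfVK ?gt_eqF//.
apply: (@le_trans _ _ (fine (f v) - fine (f (gam t)))); last by rewrite le_max lexx.
apply: (@le_trans _ _ (k * (t * mdist v w))).
  by rewrite ler_wpM2l// divr_ge0 ?mdist_ge0// ltW.
rewrite mulrCA /k mulfVK ?gt_eqF//; lra.
Qed.

Hypothesis f_lsc : lower_semicontinuous f.

(** By local_slope_global the slope is the supremum over w of the quotients
    (f v - f w)^+ / d(v, w), each of which is lower semicontinuous in v. *)
Lemma local_slope_lsc v (c : R) : 0 <= c -> (f v < +oo)%E ->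
  (c%:E < local_slope f v)%E ->
  exists2 d, 0 < d & forall v', mdist v v' < d -> (c%:E < local_slope f v')%E.
Proof.
move=> c0 fv cs.
have [w [wv fw H]] : exists w, [/\ w != v, (f w < +oo)%E &
    fine (f w) + c * mdist v w < fine (f v)].
  move: cs; rewrite /local_slope fv lt_max => /orP[|]; first by rewrite lte_fin ltNge c0.
  move=> /lt_le_trans - /(_ (ereal_sup ((fun w => maxe (f v - f w) 0 * ((mdist v w)^-1)%:E) @` [set z | z != v])%E)).
  have nv : v^' [set z | z != v] by apply: nearW.
  move=> /(_ (ereal_inf_lbound _)) => /(_ (ex_intro2 _ _ _ nv erefl)).
  move=> /ereal_sup_gt[_ [w /= wv <-]] H; exists w.
  have d0 : 0 < mdist v w by rewrite mdist_gt0 eq_sym.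
  have fw : (f w < +oo)%E.
    rewrite ltey; apply: contraTneq H => ->; rewrite -leNgt.
    by rewrite addeNy maxNye mul0e.
  split => //.
  move: H; rewrite -[f v]fineK ?domain_fin_num// -[f w]fineK ?domain_fin_num//.
  rewrite -EFinB -EFin_max -EFinM lte_fin ltr_pdivlMr// lt_max => /orP[|]; first by rewrite /=; lra.
  by rewrite ltNge mulr_ge0// mdist_ge0.
(* the gap in the strict inequality at v, half of which is left for f and half
   for the distance *)
pose e := (fine (f v) - (fine (f w) + c * mdist v w)) / 2.
have e0 : 0 < e by rewrite divr_gt0// subr_gt0.
have : ((fine (f w) + c * mdist v w + e)%:E < f v)%E.
  rewrite -[f v]fineK ?domain_fin_num// lte_fin /e; lra.
move=> /f_lsc[V /nbhs_ballP[d /= d0 dV] HV].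
exists (Num.min d (e / (c + 1))).
  by rewrite lt_min d0 divr_gt0// ltr_wpDl.
move=> v'; rewrite lt_min => /andP[vd ve].
have {}HV : ((fine (f w) + c * mdist v w + e)%:E < f v')%E.
  by apply/HV/dV; rewrite ballEmdist.
have [fv'|fv'] := ltP (f v') +oo%E; last first.
  by rewrite /local_slope (le_gtF fv') ltry.
rewrite ltNge; apply/negP => sc.
have sfin : (local_slope f v' < +oo)%E by apply: le_lt_trans sc (ltry _).
have sc' : fine (local_slope f v') <= c.
  by rewrite -lee_fin fineK// ge0_fin_numE// local_slope_ge0.
have := local_slope_global fv' fw sfin.
apply/negP; rewrite -ltNge.
apply: (@le_lt_trans _ _ (c * mdist v' w)); first by rewrite ler_wpM2r// mdist_ge0.
move: HV; rewrite -[f v']fineK ?domain_fin_num// lte_fin.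
have tri : mdist v' w <= mdist v v' + mdist v w.
  by rewrite (metric_sym v v') metric_triangle.
have : c * mdist v v' <= e.
  move: ve; rewrite ltr_pdivlMr ?ltr_wpDl// mulrDr mulr1 => /ltW; apply: le_trans.
  by rewrite mulrC lerDl mdist_ge0.
have : c * mdist v' w <= c * (mdist v v' + mdist v w) by rewrite ler_wpM2l.
lra.
Qed.

End slope.

(** * Exponents and the equality case of Young's inequality *)

Section exponents.
Context {R : realType}.
Implicit Types p q a b c e g : R.

Lemma conj_exponentD p : 1 < p -> conj_exponent p = p / (p - 1).
Proof.
by move=> p1; rewrite /conj_exponent; field; do ?[apply/andP; split]; apply/eqP => ?; lra.
Qed.

Lemma conj_exponent_gt1 p : 1 < p -> 1 < conj_exponent p.
Proof.
by move=> p1; rewrite conj_exponentD// ltr_pdivlMr ?subr_gt0//; lra.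
Qed.

Lemma conj_exponentM p : 1 < p -> (conj_exponent p - 1) * (p - 1) = 1.
Proof.
by move=> p1; rewrite conj_exponentD//; field; do ?[apply/andP; split]; apply/eqP => ?; lra.
Qed.

(** With a = exp A and g = exp B the hypothesis reads exp X / p + exp Y / q <=
    1 where X / p + Y / q = 0, and exp x > 1 + x unless x = 0. *)
Lemma young_equality p q a g : 1 < p -> 1 < q -> p^-1 + q^-1 = 1 ->
  0 <= a -> 0 <= g -> a `^ p / p + g `^ q / q <= a * g ->
  a `^ p = g `^ q /\ a = g `^ (q - 1).
Proof.
move=> p1 q1 pq; rewrite le_eqVlt => /predU1P[<- g0|a0].
  rewrite mul0r powR0 ?mul0r ?add0r; last by apply/eqP => ?; lra.
  rewrite pmulr_lle0 ?invr_gt0; last by lra.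
  move=> H; have gq : g `^ q = 0 by apply/eqP; rewrite eq_le H powR_ge0.
  by rewrite gq (powR_eq0_eq0 gq) powR0//; apply/eqP => ?; lra.
rewrite le_eqVlt => /predU1P[<-|g0].
  rewrite mulr0 [0 `^ q]powR0 ?mul0r ?addr0; last by apply/eqP => ?; lra.
  rewrite pmulr_lle0 ?invr_gt0; last by lra.
  by rewrite leNgt powR_gt0.
pose A := ln a; pose B := ln g.
have aE : a = expR A by rewrite lnK// posrE.
have gE : g = expR B by rewrite lnK// posrE.
rewrite /powR !gt_eqF// -/A -/B.
pose X := (p - 1) * A - B; pose Y := (q - 1) * B - A.
have -> : p * A = A + B + X by rewrite /X; ring.
have -> : q * B = A + B + Y by rewrite /Y; ring.
rewrite !(expRD (A + B)) (expRD A B) -gE -aE => H0.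
have H : expR X / p + expR Y / q <= 1.
  by rewrite -(ler_pM2l (mulr_gt0 a0 g0)) mulr1; move: H0; rewrite mulrDr !mulrA.
have pn : p != 0 by apply/eqP => ?; lra.
have qn : q != 0 by apply/eqP => ?; lra.
have qE : q = p / (p - 1).
  have -> : q = (1 - p^-1)^-1 by rewrite -pq addrAC subrr add0r invrK.
  by field; do ?[apply/andP; split]; apply/eqP => ?; lra.
have XY : X / p + Y / q = 0.
  by rewrite /X /Y qE; field; do ?[apply/andP; split] => //; apply/eqP => ?; lra.
have X0 : X = 0.
  apply/eqP/negPn/negP => /expR_gt1Dx X1; have Y1 := expR_ge1Dx Y.
  move: H; apply/negP; rewrite -ltNge.
  have p0 : 0 < p^-1 by rewrite invr_gt0; lra.
  have q0 : 0 < q^-1 by rewrite invr_gt0; lra.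
  have : (1 + X) / p < expR X / p by rewrite ltr_pM2r.
  have : (1 + Y) / q <= expR Y / q by rewrite ler_pM2r.
  by move: XY pq; rewrite (mulrDl 1 X) (mulrDl 1 Y) !mul1r; lra.
have Y0 : Y = 0.
  move: XY; rewrite X0 mul0r add0r => /eqP; rewrite mulf_eq0 invr_eq0 (negbTE qn).
  by rewrite orbF => /eqP.
split; first by rewrite X0 Y0.
by rewrite [LHS]aE; congr expR; apply/eqP; rewrite eq_sym -subr_eq0 -/Y Y0.
Qed.

Lemma powR_ge_id (a q : R) : 1 <= a -> 1 <= q -> a <= a `^ q.
Proof.
move=> a1 q1; rewrite -[leLHS]powRr1 ?(le_trans ler01 a1)//.
by apply: ler_powR.
Qed.

(** This is what the exponent alpha is made for: along a curve of maximal
    slope the speed is g^(q - 1), with g the slope, and the density of the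
    time change is then g^(q - q'). *)
Lemma alphaE p p' : 1 < p -> 1 < p' ->
  (conj_exponent p - 1) * alpha p p' = conj_exponent p - conj_exponent p'.
Proof.
move=> p1 p'1; rewrite /alpha !conj_exponentD//; field.
by do ?[apply/andP; split]; apply/eqP => ?; lra.
Qed.

Lemma powR_antitone e a b : e <= 0 -> 0 < a -> a <= b -> b `^ e <= a `^ e.
Proof.
move=> e0 a0 ab; have b0 := lt_le_trans a0 ab.
rewrite -[e]opprK !(powRN _ (- e)) lef_pV2 ?posrE ?powR_gt0//.
by apply: ge0_ler_powR; rewrite ?nnegrE ?oppr_ge0// ltW.
Qed.

Lemma powR_monotone e a b : 0 <= e -> 0 < a -> a <= b -> a `^ e <= b `^ e.
Proof.
move=> e0 a0 ab; have b0 := lt_le_trans a0 ab.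
by apply: ge0_ler_powR; rewrite ?nnegrE// ltW.
Qed.

Lemma powR_between e a b c : 0 < a -> a <= b -> b <= c ->
  Num.min (a `^ e) (c `^ e) <= b `^ e <= Num.max (a `^ e) (c `^ e).
Proof.
move=> a0 ab bc; have b0 := lt_le_trans a0 ab.
rewrite le_max ge_min; have [e0|/ltW e0] := leP 0 e.
  by rewrite (powR_monotone e0 a0 ab) (powR_monotone e0 b0 bc) orbT.
by rewrite (powR_antitone e0 a0 ab) (powR_antitone e0 b0 bc) orbT.
Qed.

Lemma powRB a b c : 0 < a -> a `^ (b - c) * a `^ c = a `^ b.
Proof. by move=> a0; rewrite -powRD ?subrK// (gt_eqF a0) implybT. Qed.

Lemma powR_le_add1 e c a : 0 <= e -> e <= c -> 0 <= a -> a `^ e <= 1 + a `^ c.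
Proof.
move=> e0 ec a0; have [a1|/ltW a1] := leP a 1.
  have : a `^ e <= 1 `^ e by apply: (ge0_ler_powR e0); rewrite ?nnegrE.
  by rewrite powR1 => /le_trans; apply; rewrite lerDl powR_ge0.
by apply: (le_trans (ler_powR _ ec)) => //; rewrite lerDr.
Qed.

(** For e < 0 the bound b `^ e controls large values of a, for e >= 0 the
    bound a `^ c does; the sum serves as an integrable majorant without a case
    distinction. *)
Lemma powR_dominated e c a b : e <= c -> 0 < b -> b <= a ->
  a `^ e <= 1 + b `^ e + a `^ c.
Proof.
move=> ec b0 ba; have a0 := ltW (lt_le_trans b0 ba).
have [e0|/ltW e0] := leP 0 e.
  by have := powR_le_add1 e0 ec a0; have := powR_ge0 b e; lra.
by have := powR_antitone e0 b0 ba; have := powR_ge0 a c; lra.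
Qed.

End exponents.

Section metric_derivative.
Context {R : realType} {S : metricType R}.

Lemma interval0y (t : R) : interval0 +oo t = (0 <= t).
Proof. by apply/propext; rewrite /interval0/= ltry; split => [[]|]. Qed.

Lemma metric_derivativeE (U : R -> S) (t l : R) : 0 < t ->
  metric_deriv_at U t l -> metric_derivative +oo U t = l.
Proof.
move=> t0 Hl; rewrite /metric_derivative.
have pf : ProperFilter (within (interval0 +oo) (t^')).
  apply: Build_ProperFilter_ex => P [e /= e0 He].
  pose h := e / 2; have h0 : 0 < h by rewrite divr_gt0.
  exists (t + h); apply: He => /=.
  - by rewrite /ball/= opprD addrA subrr add0r normrN gtr0_norm// /h; lra.
  - by rewrite gt_eqF// ltrDl.
  - by rewrite interval0y addr_ge0// ltW.
apply: cvg_lim => //; apply/cvgrPdist_le => e e0.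
have [d d0 Hd] := Hl _ e0.
exists d => //= s sd st _.
have st0 : 0 < `|t - s| by rewrite normr_gt0 subr_eq0 eq_sym.
have := Hd s; rewrite distrC => /(_ sd).
rewrite -[X in X <= _ -> _](_ : `|l - mdist (U t) (U s) / `|t - s| | * `|t - s| = _).
  by rewrite ler_pM2r.
rewrite -[X in _ * X = _](ger0_norm (ltW st0)) -normrM mulrBl.
rewrite mulfVK; last by rewrite gt_eqF.
exact: distrC.
Qed.

End metric_derivative.

(** * From curves of maximal slope to slope flows *)

Section slope_flow.
Context {R : realType} {S : metricType R}.
Local Notation mu := (@lebesgue_measure R).
Variable (f : S -> \bar R).
Implicit Types (U : R -> S) (s t : R).

Definition slope U t : R := fine (local_slope f (U t)).
Definition energy U t : R := fine (f (U t)).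

(** Curves of maximal slope described without derivatives. With g the slope
    along U and phi = f o U, the almost everywhere equalities |U'| = g^(q - 1)
    and phi' = - g^q, together with the monotonicity of g, amount to bounds on
    increments between arbitrary times, and such bounds survive a change of
    time. Time 0 is set apart because the slope may be infinite there. *)
Record slope_flow (q : R) U : Prop := SlopeFlow {
  flow_dom : (f (U 0%R) < +oo)%E ;
  flow_start : forall t, 0 <= t -> (f (U t) <= f (U 0%R))%E ;
  flow_slope_noninc : forall s t, 0 <= s -> s <= t ->
    (local_slope f (U t) <= local_slope f (U s))%E ;
  flow_slope_fin : forall t, 0 < t -> (local_slope f (U t) < +oo)%E ;
  flow_energy : forall s t, 0 < s -> s <= t ->
    (t - s) * slope U t `^ q <= energy U s - energy U t ;
  flow_speed : forall s t, 0 < s -> s <= t ->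
    mdist (U s) (U t) <= (t - s) * slope U s `^ (q - 1) ;
  flow_cont0 : forall e, 0 < e -> exists2 d, 0 < d &
    forall t, 0 <= t -> t < d -> mdist (U 0) (U t) <= e }.

Lemma slope_ge0 U t : 0 <= slope U t.
Proof. by rewrite fine_ge0// local_slope_ge0. Qed.

End slope_flow.

Section curve_to_flow.
Context {R : realType} {S : metricType R}.
Local Notation mu := (@lebesgue_measure R).
Variables (f : S -> \bar R) (p0 : R).
Hypothesis f_gtNy : forall v, (-oo < f v)%E.
Hypothesis f_convex : pl_convex f p0 0.
Hypothesis f_lsc : lower_semicontinuous f.
Implicit Types (U : R -> S) (s t : R).

Lemma AC_loc_restrict U (T : R) : 0 < T -> AC_loc +oo U ->
  exists2 m : R -> R, mu.-integrable setT (EFin \o m) &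
    forall s t, 0 <= s -> s <= t -> t <= T ->
      mdist (U s) (U t) <= \int[mu]_(r in `]s, t]) m r.
Proof.
move=> T0 [m mK md].
have im : mu.-integrable `[0, T] (EFin \o m).
  apply: mK; last exact: segment_compact.
  by move=> r; rewrite interval0y/= in_itv/= => /andP[].
have iT : mu.-integrable setT (EFin \o (m \_ `[0, T])).
  by rewrite -restrict_EFin; apply/integrable_restrict => //=; rewrite setTI.
exists (m \_ `[0, T]) => // s t s0 st tT; apply: le_trans (md _ _ _ _ st) _; rewrite ?interval0y//.
  exact: le_trans st.
have sub : `[s, t] `<=` `[0, T].
  by move=> r /=; rewrite !in_itv/= => /andP[u v]; rewrite (le_trans s0 u) (le_trans v tT).
rewrite Rintegral_itv_obnd_cbnd; last exact: integrableS iT.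
rewrite le_eqVlt; apply/orP; left; apply/eqP; apply: eq_Rintegral => r.
by rewrite inE => rst; rewrite patchE mem_set//; exact: sub.
Qed.

Lemma dominated_curve_continuous U (m : R -> R) (T t : R) : 0 < T ->
  mu.-integrable setT (EFin \o m) ->
  (forall s t, 0 <= s -> s <= t -> t <= T ->
      mdist (U s) (U t) <= \int[mu]_(r in `]s, t]) m r) ->
  0 <= t -> t <= T -> forall e, 0 < e -> exists2 d, 0 < d &
    forall s, 0 <= s -> s <= T -> `|s - t| < d -> mdist (U t) (U s) <= e.
Proof.
move=> T0 im Um t0 tT e e0.
pose P x := parameterized_integral mu 0 x m.
have imS (A : set R) : measurable A -> mu.-integrable A (EFin \o m).
  by move=> mA; apply: integrableS im.
have PB x y : 0 <= x -> x <= y -> P y - P x = \int[mu]_(r in `]x, y]) m r.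
  by move=> x0 xy; rewrite /P /parameterized_integral Rintegral_itvB//; exact: imS.
have := @parameterized_integral_continuous R 0 T m (ltW T0) (imS _ (measurable_itv _)).
move=> /subspace_continuousP/(_ t); rewrite /= in_itv/= t0 tT => /(_ isT).
move=> /cvgrPdist_le/(_ _ e0)/nbhs_ballP[d /= d0 Hd].
exists d => // s s0 sT std.
have {Hd} : `|P t - P s| <= e.
  by apply: Hd; rewrite /ball/= ?in_itv/= ?s0 ?sT// distrC.
have [ts|/ltW st] := leP t s => H.
  rewrite distrC in H; apply: le_trans H; rewrite (le_trans (Um _ _ _ _ _))//.
  by rewrite -PB// ler_norm.
apply: le_trans H; rewrite metric_sym (le_trans (Um _ _ _ _ _))//.
by rewrite -PB// ler_norm.
Qed.

Lemma Rintegral_cst_itv (s t c : R) : s < t ->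
  \int[mu]_(r in `]s, t[) c = (t - s) * c.
Proof.
move=> st; rewrite /Rintegral integral_cst//= lebesgue_measure_itv/= lte_fin st.
by rewrite -EFinD -EFinM /= mulrC.
Qed.

Lemma young_absorb (D A gd PX Q P : R) : D <= gd -> gd <= A * Q + PX ->
  PX <= P * D -> P = 1 - Q -> D * Q <= A * Q.
Proof. by move=> h1 h2 + h4; rewrite h4; lra. Qed.

Lemma concave_gap (a x b P0 P1 P2 C C' : R) : (x - a) * C <= P0 - P1 ->
  (b - x) * C' <= P1 - P2 -> P0 - P2 <= (b - a) * C ->
  0 < (b - x) * (C' - C) -> False.
Proof. by move=> h1 h2 h3; rewrite mulrBr; lra. Qed.

Section fixed_curve.
Variables (p : R) (U : R -> S).
Hypothesis p1 : 1 < p.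
Let q := conj_exponent p.
Hypothesis U0 : (f (U 0%R) < +oo)%E.
Hypothesis U_AC : AC_loc +oo U.
Hypothesis U_noninc : forall s t, 0 <= s -> s <= t -> (f (U t) <= f (U s))%E.
Hypothesis U_ineq : {ae mu, forall t, interval0 +oo t ->
  derivable (fine \o f \o U) t 1 /\
  ((derive1 (fine \o f \o U) t)%:E
   <= - (p^-1 * metric_derivative +oo U t `^ p)%R%:E
      - ((conj_exponent p)^-1)%R%:E * local_slope f (U t) `^ conj_exponent p)%E}.

Let phi := energy f U.
Let g := slope f U.

Let U_fin t : 0 <= t -> (f (U t) < +oo)%E.
Proof. by move=> t0; apply: le_lt_trans U0; exact: U_noninc. Qed.

Let phi_noninc s t : 0 <= s -> s <= t -> phi t <= phi s.
Proof.
move=> s0 st; rewrite /phi /energy -lee_fin.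
rewrite !fineK ?domain_fin_num ?U_fin// ?(le_trans s0 st)//.
exact: U_noninc.
Qed.

Let phi_slope s t : 0 <= s -> 0 <= t -> (local_slope f (U s) < +oo)%E ->
  phi s - phi t <= g s * mdist (U s) (U t).
Proof. by move=> s0 t0 gs; apply: (local_slope_global f_gtNy f_convex) => //; exact: U_fin. Qed.

Let q1 : 1 < q. Proof. exact: conj_exponent_gt1. Qed.
Let pq : p^-1 + q^-1 = 1. Proof. exact: conj_exponentE. Qed.

(** The global slope bounds - phi' by g w, the inequality defining curves of
    maximal slope bounds it below by w^p / p + g^q / q: this is the equality
    case of Young's inequality. *)
Let pointwise t l w : 0 < t -> metric_deriv_at U t w -> 0 <= w ->
  deriv_at phi t l ->
  (l%:E <= - (p^-1 * w `^ p)%R%:E - (q^-1)%R%:E * local_slope f (U t) `^ q)%E ->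
  [/\ (local_slope f (U t) < +oo)%E, w = g t `^ (q - 1), w `^ p = g t `^ q &
      g t `^ q <= - l].
Proof.
move=> t0 dw w0 dphi H.
have q0 : 0 < q := lt_trans ltr01 q1.
have qn0 : q != 0 by rewrite gt_eqF.
have gfin : (local_slope f (U t) < +oo)%E.
  rewrite ltey; apply: contraTneq H => ->; rewrite poweRyr// gt0_muley; last first.
    by rewrite lte_fin invr_gt0.
  by rewrite -ltNge addeNy ltNyr.
have gE : local_slope f (U t) = (g t)%:E.
  by rewrite /g /slope fineK// ge0_fin_numE// local_slope_ge0.
have g0 : 0 <= g t by exact: slope_ge0.
have {}H : w `^ p / p + g t `^ q / q <= - l.
  move: H; rewrite gE poweR_EFin -EFinM -EFinN -EFinB lee_fin; lra.
have lgw : - l <= g t * w.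
  suff H' : forall e : R, 0 < e -> - l <= g t * w + e by apply/ler_addgt0Pr.
  move=> e e0.
  have e1 : 0 < e / (1 + g t) by rewrite divr_gt0// ltr_pwDl.
  have [d1 d10 H1] := dphi _ e1; have [d2 d20 H2] := dw _ e1.
  have [h [h0 hd1 hd2]] : exists h : R, [/\ 0 < h, h < d1 & h < d2].
    exists (Num.min d1 d2 / 2); rewrite divr_gt0 ?lt_min ?d10//.
    have := lt_min (Num.min d1 d2 / 2) d1 d2.
    by rewrite ltr_pdivrMr// ltr_pMr ?ltr1n ?lt_min ?d10// => /esym/andP[-> ->].
  have hE : t + h - t = h by rewrite addrC addKr.
  have := H1 (t + h); rewrite hE (gtr0_norm h0) => /(_ hd1).
  have := H2 (t + h); rewrite hE (gtr0_norm h0) => /(_ hd2).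
  rewrite !ler_norml => /andP[_ B2] /andP[_ B1].
  have th0 : 0 <= t + h by rewrite addr_ge0// ltW.
  have ee : e / (1 + g t) * (1 + g t) = e by rewrite mulfVK// gt_eqF// ltr_pwDl.
  move: ee B1 B2; move: (e / (1 + g t) : R) => k ee B1 B2.
  have F1 := phi_slope (ltW t0) th0 gfin.
  have F2 : g t * mdist (U t) (U (t + h)) <= g t * (w * h + k * h).
    by rewrite ler_wpM2l//; lra.
  have F3 : (g t * w + e) * h = g t * (w * h + k * h) + k * h by rewrite -ee; ring.
  by rewrite -(ler_pM2r h0) F3; lra.
have gw : w `^ p / p + g t `^ q / q <= w * g t by rewrite (le_trans H)// mulrC.
have [wp wq] := young_equality p1 q1 pq w0 g0 gw.
split => //; move: H; rewrite wp -mulrDr pq mulr1; exact.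
Qed.

Let q_gt0 : 0 < q. Proof. exact: lt_trans ltr01 q1. Qed.

Let speed T : 0 < T -> exists w : R -> R,
  [/\ measurable_fun setT w, (forall r, 0 <= w r),
      mu.-integrable setT (EFin \o w),
      (forall s t, 0 <= s -> s <= t -> t <= T ->
         mdist (U s) (U t) <= \int[mu]_(r in `]s, t]) w r) &
      {ae mu, forall t, 0 < t < T ->
        [/\ (local_slope f (U t) < +oo)%E, w t = g t `^ (q - 1),
            w t `^ p = g t `^ q, metric_derivative +oo U t = w t &
            exists2 l, deriv_at (fun r => - phi r) t l & g t `^ q <= l]}].
Proof.
move=> T0; have [m im Um] := AC_loc_restrict T0 U_AC.
have [w [w0 iw Uw dw]] := metric_speed T0 im Um.
exists w; split => //; first by apply/measurable_EFinP; exact: (measurable_int _ iw).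
apply: aeS2 dw U_ineq => t dw H /andP[t0 tT].
have [|dphi] := H; first by rewrite interval0y ltW.
have {}dw : metric_deriv_at U t (w t) by apply: dw; rewrite t0.
have mdE := metric_derivativeE t0 dw; rewrite mdE => ineq.
have dphi' : deriv_at phi t (derive1 (fine \o f \o U) t) by apply/deriv_atP; split.
have [gfin wg wp gl] := pointwise t0 dw (w0 t) dphi' ineq.
split => //; exists (- derive1 (fine \o f \o U) t) => // e e0.
have [d d0 Hd] := dphi' e e0; exists d => // s sd.
by rewrite -opprD mulNr -opprB opprK normrN addrC (le_trans _ (Hd _ sd))// addrC.
Qed.

(** Integrates phi' <= - g^q <= - c^q; this half of the fundamental theorem
    holds for the monotone function phi. *)
Let decay c s t : 0 <= s -> s <= t -> 0 <= c ->
  (forall r, s < r -> r < t -> (c%:E <= local_slope f (U r))%E) ->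
  (t - s) * c `^ q <= phi s - phi t.
Proof.
move=> s0; rewrite le_eqVlt => /predU1P[<-|st] c0 cg; first by rewrite !subrr mul0r.
have T0 : 0 < t + 1 by rewrite ltr_wpDl// (le_trans s0)// ltW.
have [w [_ _ _ _ aew]] := speed T0.
have I : (\int[mu]_(r in `]s, t[) (c `^ q)%:E = ((t - s) * c `^ q)%R%:E)%E.
  by rewrite integral_cst//= lebesgue_measure_itv/= lte_fin st -EFinD -EFinM mulrC.
have := @monotone_deriv_integral_le R (fun r => - phi r) (fun=> c `^ q) s t (ltW st).
rewrite /= I lee_fin opprK (addrC (- phi t)); apply.
- by move=> x y sx xy yt; rewrite lerN2 phi_noninc// (le_trans s0 sx).
- exact: measurable_cst.
- by move=> r; exact: powR_ge0.
apply: aeS aew => r H /andP[sr rt].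
have [|gfin _ _ _ [l dl gl]] := H.
  by rewrite (le_lt_trans s0 sr) (lt_trans rt) ?ltrDl.
exists l => //; apply: le_trans gl.
apply: ge0_ler_powR; rewrite ?nnegrE ?slope_ge0 ?(ltW q_gt0)//.
by rewrite -lee_fin fineK ?cg// ge0_fin_numE// local_slope_ge0.
Qed.

(** The loss of phi is at most g s times the length of the curve. Young's
    inequality splits g s * w into g s^q / q + w^p / p, and the integral of
    w^p, being at most the loss itself, is absorbed by the left-hand side. *)
Let growth s t : 0 <= s -> s <= t -> (local_slope f (U s) < +oo)%E ->
  phi s - phi t <= (t - s) * g s `^ q.
Proof.
move=> s0; rewrite le_eqVlt => /predU1P[<-|st] gs; first by rewrite !subrr mul0r.
have t0 : 0 < t := le_lt_trans s0 st.
have T0 : 0 < t + 1 by rewrite ltr_wpDl// ltW.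
have [w [mw w0 iw Uw aew]] := speed T0.
have g0 : 0 <= g s by exact: slope_ge0.
have p0' : 0 < p := lt_trans ltr01 p1.
pose wp r := w r `^ p.
have mwp : measurable_fun setT wp by exact: (measurableT_comp (measurable_powR p) mw).
have wp0 r : 0 <= wp r by exact: powR_ge0.
have le1 : (\int[mu]_(r in `]s, t[) (wp r)%:E <= (phi s - phi t)%:E)%E.
  have := @monotone_deriv_integral_le R (fun r => - phi r) wp s t (ltW st).
  rewrite opprK (addrC _ (phi s)); apply => //.
    by move=> x y sx xy yt; rewrite lerN2 phi_noninc// (le_trans s0 sx).
  apply: aeS aew => r H /andP[sr rt].
  have [|gfin _ wpE _ [l dl gl]] := H.
    by rewrite (le_lt_trans s0 sr) (lt_trans rt) ?ltrDl.
  by exists l => //; rewrite /wp wpE.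
have iwp : mu.-integrable `]s, t[ (EFin \o wp).
  apply/integrableP; split; first by apply/measurable_EFinP; exact: measurable_funS mwp.
  apply: le_lt_trans (ltry (phi s - phi t)); apply: le_trans le1.
  by apply: ge0_le_integral => //;
    [by apply/measurable_EFinP; apply: measurableT_comp => //; exact: measurable_funS mwp
    |by apply/measurable_EFinP; exact: measurable_funS mwp
    |by move=> r _; rewrite /= ger0_norm].
have {}le1 : \int[mu]_(r in `]s, t[) wp r <= phi s - phi t.
  by rewrite -lee_fin fineK//; exact: integrable_fin_num iwp.
have iwO : mu.-integrable `]s, t[ (EFin \o w) by exact: integrableS iw.
have icst (c : R) : mu.-integrable `]s, t[ (EFin \o cst c).
  by apply: (@bounded_integrable _ _ _ _ `|c|) => //; exact: measurable_cst.
have le2 : g s * mdist (U s) (U t) <= \int[mu]_(r in `]s, t[) (g s `^ q / q + p^-1 * wp r).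
  apply: (@le_trans _ _ (g s * \int[mu]_(r in `]s, t[) w r)).
    rewrite ler_wpM2l// Rintegral_itv_bndo_bndc// Uw// ?ltW//.
    by rewrite ltrDl.
  rewrite -RintegralZl//; apply: le_Rintegral => //.
  - by apply: eq_integrable (integrableZl _ (g s) iwO).
  - apply: eq_integrable (integrableD _ (icst (g s `^ q / q)) (integrableZl _ p^-1 iwp)) => //.
  move=> r _; rewrite addrC mulrC (mulrC p^-1); exact: conjugate_powR.
have E : \int[mu]_(r in `]s, t[) (g s `^ q / q + p^-1 * wp r) =
    (t - s) * g s `^ q / q + p^-1 * \int[mu]_(r in `]s, t[) wp r.
  rewrite RintegralD//; [|exact: icst|by apply: eq_integrable (integrableZl _ p^-1 iwp)].
  congr (_ + _); last by rewrite RintegralZl.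
  exact: etrans (Rintegral_cst_itv _ st) (mulrA _ _ _).
have le3 := phi_slope s0 (ltW t0) gs.
have le4 : p^-1 * \int[mu]_(r in `]s, t[) wp r <= p^-1 * (phi s - phi t).
  by rewrite ler_wpM2l// invr_ge0 ltW.
have pq' : p^-1 = 1 - q^-1 by rewrite -pq addrK.
have le5 : (phi s - phi t) / q <= (t - s) * g s `^ q / q.
  apply: (young_absorb le3 _ le4 pq').
  by rewrite -E.
by move: le5; rewrite ler_pM2r// invr_gt0.
Qed.

Let U_cont t : 0 <= t -> forall e, 0 < e -> exists2 d, 0 < d &
  forall s, 0 <= s -> `|s - t| < d -> mdist (U t) (U s) <= e.
Proof.
move=> t0 e e0; have T0 : 0 < t + 1 by rewrite ltr_wpDl.
have [m im Um] := AC_loc_restrict T0 U_AC.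
have t1 : t <= t + 1 by rewrite lerDl.
have [d d0 Hd] := dominated_curve_continuous T0 im Um t0 t1 e0.
exists (Num.min d 1); first by rewrite lt_min d0 ltr01.
move=> s s0; rewrite lt_min => /andP[sd s1]; apply: Hd => //.
by move: s1; rewrite ltr_norml => /andP[_]; lra.
Qed.

Let slope_lsc t c : 0 <= t -> 0 <= c -> (c%:E < local_slope f (U t))%E ->
  exists2 d, 0 < d & forall s, 0 <= s -> `|s - t| < d ->
    (c%:E < local_slope f (U s))%E.
Proof.
move=> t0 c0 ct.
have [e e0 He] := local_slope_lsc f_gtNy f_convex f_lsc c0 (U_fin t0) ct.
have e20 : 0 < e / 2 by rewrite divr_gt0.
have [d d0 Hd] := U_cont t0 e20.
exists d => // s s0 sd; apply: He; apply: le_lt_trans (Hd _ s0 sd) _.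
by rewrite ltr_pdivrMr// ltr_pMr// ltr1n.
Qed.

(** Suppose that the slope at t exceeds c, the slope at s. After the last time
    r0 at which it is at most c, phi decreases at a rate of at least c^q, and
    at a strictly larger one close to t by lower semicontinuity; but the loss
    on [r0, t] is at most (t - r0) c^q by growth. *)
Let slope_noninc s t : 0 <= s -> s <= t ->
  (local_slope f (U t) <= local_slope f (U s))%E.
Proof.
move=> s0 st; rewrite leNgt; apply/negP => H.
have gs : (local_slope f (U s) < +oo)%E by apply: lt_le_trans H (leey _).
have [c c0 gsE] : exists2 c, 0 <= c & local_slope f (U s) = c%:E.
  exists (g s); first exact: slope_ge0.
  by rewrite /g /slope fineK// ge0_fin_numE// local_slope_ge0.
have [c' cc' c't] : exists2 c', c < c' & (c'%:E < local_slope f (U t))%E.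
  move: H; rewrite gsE; case: (local_slope f (U t)) => [r| |] //.
    rewrite lte_fin => cr; exists ((c + r) / 2); last rewrite lte_fin.
      by rewrite ltr_pdivlMr//; lra.
    by rewrite ltr_pdivrMr//; lra.
  by exists (c + 1); rewrite ?ltrDl ?ltr01 ?ltry.
have t0 : 0 <= t := le_trans s0 st.
have [r0 [sr0 r0lt Er0 above]] : exists r0, [/\ s <= r0, r0 < t,
    (local_slope f (U r0) <= c%:E)%E &
    forall r, r0 < r -> r < t -> (c%:E <= local_slope f (U r))%E].
  pose E := [set r | s <= r <= t /\ (local_slope f (U r) <= c%:E)%E].
  have Es : E s by rewrite /E/= lexx st gsE.
  have hE : has_sup E.
    by split; [exists s|exists t => r [/andP[]]].
  have sr0 : s <= sup E by apply: sup_upper_bound.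
  have r0t : sup E <= t by apply: ge_sup; [exists s|move=> r [/andP[]]].
  have r00 : 0 <= sup E := le_trans s0 sr0.
  have Er0 : (local_slope f (U (sup E)) <= c%:E)%E.
    rewrite leNgt; apply/negP => /(slope_lsc r00 c0)[d d0 Hd].
    have [r Er rr0] := sup_adherent d0 hE.
    have rle : r <= sup E by apply: sup_upper_bound.
    case: Er => /andP[sr _]; apply/negP; rewrite -ltNge; apply: Hd.
      exact: le_trans sr.
    by rewrite distrC ger0_norm ?subr_ge0//; lra.
  exists (sup E); split => //.
    rewrite lt_neqAle r0t andbT; apply: contraTneq Er0 => ->.
    by rewrite -ltNge (lt_trans _ c't)// lte_fin.
  move=> r r0r rt; rewrite leNgt; apply/negP => Er; move: (r0r); apply/negP.
  rewrite -leNgt; apply: sup_upper_bound => //; rewrite /E/= (ltW Er); split => //.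
  by rewrite (ltW rt) andbT (le_trans sr0 (ltW r0r)).
have r00 : 0 <= r0 := le_trans s0 sr0.
have c'0 : 0 <= c' by rewrite (le_trans c0)// ltW.
have [d d0 Hd] := slope_lsc t0 c'0 c't.
have [t1 [t1t r0t1 dt1]] : exists t1, [/\ t1 < t, r0 <= t1 & t - d / 2 <= t1].
  have d20 : 0 < d / 2 by rewrite divr_gt0.
  exists (Num.max r0 (t - d / 2)).
  by rewrite gt_max r0lt/= gtrBl d20 !le_max !lexx orbT.
have t10 : 0 <= t1 := le_trans r00 r0t1.
have F1 : (t1 - r0) * c `^ q <= phi r0 - phi t1.
  by apply: (decay r00 r0t1 c0) => r r1 r2; apply: above => //; exact: lt_trans t1t.
have F2 : (t - t1) * c' `^ q <= phi t1 - phi t.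
  apply: (decay t10 (ltW t1t) c'0) => r r1 r2; apply/ltW/Hd.
    by rewrite (le_trans t10)// ltW.
  by rewrite distrC ger0_norm ?subr_ge0 ?(ltW r2)//; lra.
have gr0 : (local_slope f (U r0) < +oo)%E by apply: le_lt_trans Er0 (ltry _).
have gc : g r0 <= c.
  by rewrite -lee_fin fineK// ge0_fin_numE// local_slope_ge0.
have gcq : g r0 `^ q <= c `^ q.
  by apply: ge0_ler_powR; rewrite ?nnegrE ?slope_ge0 ?(ltW q_gt0).
have F3 : phi r0 - phi t <= (t - r0) * c `^ q.
  apply: le_trans (growth r00 (ltW r0lt) gr0) _.
  by apply: ler_wpM2l gcq; rewrite subr_ge0 ltW.
have F4 : c `^ q < c' `^ q by apply: gt0_ltr_powR; rewrite ?nnegrE.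
have : 0 < (t - t1) * (c' `^ q - c `^ q) by rewrite mulr_gt0 ?subr_gt0.
exact: (concave_gap F1 F2 F3).
Qed.

(** An infinite slope at t would be infinite at all earlier times, and phi
    would decrease at any prescribed rate. *)
Let slope_fin t : 0 < t -> (local_slope f (U t) < +oo)%E.
Proof.
move=> t0; rewrite ltey; apply/eqP => gt.
pose D := (phi 0 - phi t) / t.
have D0 : 0 <= D by rewrite divr_ge0 ?(ltW t0)// subr_ge0 phi_noninc// ltW.
have c1 : 1 <= D + 1 by rewrite lerDr.
have c0 : 0 <= D + 1 by rewrite (le_trans ler01).
have : (t - 0) * (D + 1) `^ q <= phi 0 - phi t.
  apply: decay => //; first exact: ltW.
  move=> r r0 rt; have := slope_noninc (ltW r0) (ltW rt).
  by rewrite gt leye_eq => /eqP ->; rewrite leey.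
apply/negP; rewrite -ltNge subr0.
have -> : phi 0 - phi t = t * D by rewrite mulrC mulfVK// gt_eqF.
rewrite ltr_pM2l//; apply: lt_le_trans (powR_ge_id c1 (ltW q1)).
by rewrite ltrDl.
Qed.

Lemma curve_slope_flow : slope_flow f q U.
Proof.
split=> //.
- by move=> t t0; exact: U_noninc.
- move=> s t s0 st; apply: decay; rewrite ?(ltW s0) ?slope_ge0//.
  move=> r sr rt; rewrite fineK.
    by apply: slope_noninc; [exact: ltW (lt_trans s0 sr)|exact: ltW].
  by rewrite ge0_fin_numE ?local_slope_ge0// slope_fin// (lt_le_trans s0 st).
- move=> s t s0; rewrite le_eqVlt => /predU1P[<-|st].
    by rewrite mdistxx subrr mul0r.
  have T0 : 0 < t + 1 by rewrite ltr_wpDl// ltW// (lt_trans s0).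
  have [w [mw w0 iw Uw aew]] := speed T0.
  apply: (le_trans (Uw _ _ (ltW s0) (ltW st) _)); first by rewrite lerDl.
  have iwO : mu.-integrable `]s, t[ (EFin \o w) by exact: integrableS iw.
  rewrite -Rintegral_itv_bndo_bndc//.
  apply: (@le_trans _ _ (\int[mu]_(r in `]s, t[) (slope f U s `^ (q - 1)))); last first.
    by rewrite (Rintegral_cst_itv _ st).
  apply: ae_le_Rintegral => //.
    by apply: (@bounded_integrable _ _ _ _ `|slope f U s `^ (q - 1)|) => //; exact: measurable_cst.
  apply: aeS aew => r H; rewrite /= in_itv/= => /andP[sr rt].
  have r0 : 0 < r := lt_trans s0 sr.
  have [|gfin -> _ _ _] := H; first by rewrite r0 (lt_trans rt) ?ltrDl.
  apply: ge0_ler_powR; rewrite ?nnegrE ?slope_ge0 ?subr_ge0 ?(ltW q1)//.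
  rewrite /g /slope fine_le ?ge0_fin_numE ?local_slope_ge0 ?slope_fin//.
  by apply: slope_noninc; exact: ltW.
- move=> e e0; have [d d0 Hd] := U_cont (lexx 0) e0; exists d => // t t0 td.
  by apply: Hd => //; rewrite subr0 ger0_norm.
Qed.

Lemma curve_metric_derivative : {ae mu, forall t, 0 < t ->
  metric_derivative +oo U t = slope f U t `^ (q - 1)}.
Proof.
have H : {ae mu, forall t, forall n, 0 < t < n.+1%:R ->
    metric_derivative +oo U t = slope f U t `^ (q - 1)}.
  apply: ae_foralln => n; have [w [_ _ _ _ aew]] := speed (ltr0Sn R n).
  by apply: aeS aew => t H /H[_ <- _ ->].
apply: aeS H => t H t0; apply: (H (Num.bound t)); rewrite t0/=.
by apply: lt_trans (archi_boundP (ltW t0)) _; rewrite ltr_nat.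
Qed.

End fixed_curve.
End curve_to_flow.

(** * Integrals of monotone and of non-measurable functions *)

Section monotone_tools.
Context {R : realType}.
Local Notation mu := (@lebesgue_measure R).

Import HBNNSimple.

(** The integral of a nonnegative function is a supremum over the simple
    functions below it, and these may be set to 0 on a null set. This form is
    needed for metric derivatives, which are limits that exist almost
    everywhere only and are then unspecified. *)
Lemma ge0_ae_eq_integral_nonmeas (D : set R) (F G : R -> \bar R) :
  (forall x, D x -> 0 <= F x)%E -> (forall x, D x -> 0 <= G x)%E ->
  {ae mu, forall x, D x -> F x = G x} ->
  (\int[mu]_(x in D) F x = \int[mu]_(x in D) G x)%E.
Proof.
wlog suff: F G / (forall x, D x -> 0 <= F x)%E -> (forall x, D x -> 0 <= G x)%E ->
  {ae mu, forall x, D x -> F x = G x} ->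
  (\int[mu]_(x in D) F x <= \int[mu]_(x in D) G x)%E.
  move=> H F0 G0 FG; apply/eqP; rewrite eq_le H//=.
  by apply: H => //; apply: aeS FG => x FG Dx; rewrite FG.
move=> F0 G0 [N [mN N0 FG]].
rewrite !ge0_integralE//; apply: ge_ereal_sup => _ [h /= hF <-].
have mNC : measurable (~` N) by exact: measurableC.
have pE x : proj_nnsfun h mNC x = (h \_ (~` N)) x by rewrite (mrestrict h mNC).
apply: le_ereal_sup_tmp; exists (sintegral mu (proj_nnsfun h mNC)).
  exists (proj_nnsfun h mNC) => // x.
  have [xN|xN] := pselect (N x).
    rewrite pE patchE memNset/=; last by move=> /(_ xN).
    by rewrite patchE; case: ifPn => //; rewrite inE; exact: G0.
  rewrite pE patchE mem_set//=; apply: le_trans (hF x) _.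
  rewrite !patchE; case: ifPn => //; rewrite inE => Dx.
  have -> // : F x = G x.
  by apply/not_notP => FGx; apply: xN; apply: FG => /= /(_ Dx).
rewrite -!integralT_nnsfun le_eqVlt; apply/orP; left; apply/eqP.
apply: ae_eq_integral => //.
- by apply/measurable_EFinP; exact: measurable_funPT.
- by apply/measurable_EFinP; exact: measurable_funPT.
exists N; split => // x H; apply/not_notP => xN; apply: H => _.
by rewrite pE patchE mem_set.
Qed.

Lemma exists_lt3 (a b c : R) : 0 < a -> 0 < b -> 0 < c ->
  exists h : R, [/\ 0 < h, h < a, h < b & h < c].
Proof.
move=> a0 b0 c0; have : 0 < Num.min a (Num.min b c) by rewrite !lt_min a0 b0.
have ma : Num.min a (Num.min b c) <= a by rewrite ge_min lexx.
have mb : Num.min a (Num.min b c) <= b by rewrite !ge_min lexx orbT.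
have mc : Num.min a (Num.min b c) <= c by rewrite !ge_min lexx !orbT.
move: (Num.min _ _) ma mb mc => m ma mb mc m0.
by exists (m / 2); split; lra.
Qed.

Lemma noninc_norm_add (x y z : R) : y <= x -> z <= y ->
  `|x - y| + `|y - z| <= `|x - z|.
Proof. by move=> yx zy; rewrite !ger0_norm; lra. Qed.

(** Cutting [a, b] into 2^n equal pieces, the errors add up to 2^-n (b - a)
    `|K a - K b|. Every comparison of two increments that agree up to a second
    order term controlled by a monotone function follows from this. *)
Lemma subadditive_le0 (delta : R -> R -> R) (K : R -> R) (a b : R) : a <= b ->
  (forall x y z, a <= x -> x <= y -> y <= z -> z <= b ->
     delta x z <= delta x y + delta y z) ->
  (forall x y z, a <= x -> x <= y -> y <= z -> z <= b ->
     `|K x - K y| + `|K y - K z| <= `|K x - K z|) ->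
  (forall x y, a <= x -> x <= y -> y <= b ->
     delta x y <= (y - x) * `|K x - K y|) ->
  delta a b <= 0.
Proof.
move=> ab sub mono bnd.
have H n : forall x y, a <= x -> x <= y -> y <= b ->
    delta x y <= (y - x) * `|K x - K y| / 2 ^+ n.
  elim: n => [x y ax xy yb|n IH x y ax xy yb]; first by rewrite expr0 divr1 bnd.
  pose m := (x + y) / 2.
  have xm : x <= m by rewrite /m ler_pdivlMr//; lra.
  have my : m <= y by rewrite /m ler_pdivrMr//; lra.
  have h1 := IH x m ax xm (le_trans my yb).
  have h2 := IH m y (le_trans ax xm) my yb.
  apply: le_trans (sub _ _ _ ax xm my yb) _.
  have E1 : m - x = (y - x) / 2 by rewrite /m; field.
  have E2 : y - m = (y - x) / 2 by rewrite /m; field.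
  rewrite E1 in h1; rewrite E2 in h2.
  apply: le_trans (lerD h1 h2) _.
  rewrite -mulrDl -mulrDr exprS invfM mulrA ler_wpM2r ?invr_ge0 ?exprn_ge0//.
  rewrite mulrAC ler_wpM2r ?invr_ge0// ler_wpM2l ?subr_ge0//.
  exact: mono.
apply/ler_addgt0Pr => e e0; rewrite add0r.
pose C := (b - a) * `|K a - K b|.
have C0 : 0 <= C by rewrite mulr_ge0// subr_ge0.
pose n := Num.bound (C / e).
apply: le_trans (H n _ _ (lexx _) ab (lexx _)) _.
rewrite -/C ler_pdivrMr ?exprn_gt0//.
have : C / e <= 2 ^+ n.
  apply: (@le_trans _ _ n%:R).
    by apply/ltW/archi_boundP; rewrite divr_ge0// ltW.
  by rewrite -natrX ler_nat ltnW// ltn_expl.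
by rewrite ler_pdivrMr// mulrC.
Qed.

Lemma Rintegral_bounds (K : R -> R) (s t lo hi : R) : s < t ->
  measurable_fun setT K -> (forall r, s < r -> r <= t -> lo <= K r <= hi) ->
  mu.-integrable `]s, t] (EFin \o K) /\
  (t - s) * lo <= \int[mu]_(r in `]s, t]) K r <= (t - s) * hi.
Proof.
move=> st mK Kb.
have bint (A : R -> R) C : measurable_fun setT A ->
    (forall r, s < r -> r <= t -> `|A r| <= C) -> mu.-integrable `]s, t] (EFin \o A).
  move=> mA AC; apply: measurable_bounded_integrable => //.
  - by rewrite /= lebesgue_measure_itv/= lte_fin st -EFinD ltry.
  - exact: measurable_funS mA.
  - exists C; split; first exact: num_real.
    move=> x Cx y; rewrite /= in_itv/= => /andP[sy yt].
    exact: le_trans (AC y sy yt) (ltW Cx).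
have iK : mu.-integrable `]s, t] (EFin \o K).
  apply: (bint K (Num.max `|lo| `|hi|)) => // r sr rt.
  have /andP[l h] := Kb r sr rt.
  rewrite le_max; have [K0|K0] := leP 0 (K r).
    by apply/orP; right; rewrite ger0_norm// (le_trans h)// ler_norm.
  apply/orP; left; rewrite ltr0_norm// -normrN (le_trans _ (ler_norm _))//.
  by rewrite lerN2.
have cstE (c : R) : \int[mu]_(r in `]s, t]) c = (t - s) * c.
  by rewrite /Rintegral integral_cst//= lebesgue_measure_itv/= lte_fin st -EFinD -EFinM /= mulrC.
have icst (c : R) : mu.-integrable `]s, t] (EFin \o cst c).
  by apply: (bint _ `|c|) => //; exact: measurable_cst.
split => //; apply/andP; split.
  rewrite -cstE; apply: le_Rintegral => //; first exact: icst.
  move=> r; rewrite /= in_itv/= => /andP[sr rt].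
  by have /andP[] := Kb r sr rt.
rewrite -cstE; apply: le_Rintegral => //; first exact: icst.
move=> r; rewrite /= in_itv/= => /andP[sr rt].
by have /andP[] := Kb r sr rt.
Qed.

Lemma noninc_measurable (K : R -> R) :
  (forall s t, 0 < s -> s <= t -> K t <= K s) ->
  measurable_fun setT (K \_ `]0, +oo[).
Proof.
move=> nK; apply/(measurable_restrictT _ _).1 => //.
apply: (measurability (@RGenCInfty.G R)) => [|/= _ [_] [r] -> <-].
  exact: RGenCInfty.measurableE.
apply: is_interval_measurable => s t [s0 Ks] [t0 Kt] x /andP[sx xt].
move: s0 t0 Ks Kt; rewrite /= !in_itv/= !andbT => s0 t0 Ks Kt.
have x0 : 0 < x by exact: lt_le_trans sx.
by split; rewrite ?x0// (le_trans Kt)// nK.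
Qed.

End monotone_tools.

(** * Integral identities along a slope flow *)

Local Opaque local_slope.

Section flow_theory.
Context {R : realType} {S : metricType R}.
Local Notation mu := (@lebesgue_measure R).
Variables (f : S -> \bar R) (p0 : R).
Hypothesis f_gtNy : forall v, (-oo < f v)%E.
Hypothesis f_convex : pl_convex f p0 0.
Variables (q : R) (U : R -> S).
Hypothesis q1 : 1 < q.
Hypothesis flow : slope_flow f q U.
Implicit Types (s t : R).

Let phi := energy f U.
Let g := slope f U.
Let q0 : 0 < q. Proof. exact: lt_trans ltr01 q1. Qed.

Lemma flow_fin t : 0 <= t -> (f (U t) < +oo)%E.
Proof. by move=> t0; exact: le_lt_trans (flow_start flow t0) (flow_dom flow). Qed.

Lemma flow_slopeE t : 0 < t -> local_slope f (U t) = (slope f U t)%:E.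
Proof.
move=> t0; rewrite /slope fineK// ge0_fin_numE ?local_slope_ge0//.
exact: flow_slope_fin flow _ t0.
Qed.

Lemma flow_slope_le s t : 0 < s -> s <= t -> slope f U t <= slope f U s.
Proof.
move=> s0 st; rewrite -lee_fin -!flow_slopeE ?(lt_le_trans s0)//.
exact: flow_slope_noninc flow _ _ (ltW s0) st.
Qed.

Lemma flow_energy_le s t : 0 <= s -> s <= t -> energy f U t <= energy f U s.
Proof.
rewrite le_eqVlt => /predU1P[<- t0|s0 st].
  rewrite /energy -lee_fin !fineK ?domain_fin_num ?flow_fin//.
  exact: flow_start flow _ t0.
rewrite -subr_ge0 (le_trans _ (flow_energy flow s0 st))//.
by rewrite mulr_ge0 ?subr_ge0 ?powR_ge0.
Qed.

Lemma slopeM (x : R) : 0 <= x -> x * x `^ (q - 1) = x `^ q.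
Proof.
rewrite le_eqVlt => /predU1P[<-|x0].
  by rewrite mul0r powR0// gt_eqF.
by rewrite -[X in X * _]powRr1 ?ltW// -powRD ?gt_eqF ?implybT// addrC subrK.
Qed.

(** This reverses the bound flow_energy, with the slope taken at the other
    end: the global slope bounds the loss by g s * d(U s, U t), and flow_speed
    bounds the distance. *)
Lemma flow_energy_ub s t : 0 < s -> s <= t ->
  energy f U s - energy f U t <= (t - s) * slope f U s `^ q.
Proof.
move=> s0 st.
have t0 : 0 <= t := le_trans (ltW s0) st.
have := local_slope_global f_gtNy f_convex (flow_fin (ltW s0)) (flow_fin t0)
  (flow_slope_fin flow s0).
move=> /le_trans; apply.
rewrite -/(slope f U s) -(slopeM (slope_ge0 _ _ _)) mulrCA ler_wpM2l ?slope_ge0//.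
exact: flow_speed flow _ _ s0 st.
Qed.

(** Powers of the slope as a function of positive time: at time 0 the slope
    may be infinite, and fine would then return a meaningless value. *)
Definition slope_pow (e : R) (r : R) : R := ((slope f U) \_ `]0, +oo[) r `^ e.

Lemma slope_powE e r : 0 < r -> slope_pow e r = slope f U r `^ e.
Proof. by move=> r0; rewrite /slope_pow patchE mem_set//= in_itv/= r0. Qed.

Lemma slope_pow_out e r : r <= 0 -> e != 0 -> slope_pow e r = 0.
Proof.
move=> r0 e0; rewrite /slope_pow patchE ifF ?powR0//.
by apply/negP; rewrite inE/= in_itv/= andbT ltNge r0.
Qed.

Lemma slope_pow_ge0 e r : 0 <= slope_pow e r. Proof. exact: powR_ge0. Qed.

Lemma measurable_slope_pow e : measurable_fun setT (slope_pow e).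
Proof.
have mg : measurable_fun setT ((slope f U) \_ `]0, +oo[).
  by apply: noninc_measurable => s t; exact: flow_slope_le.
exact: (measurableT_comp (measurable_powR e) mg).
Qed.

Local Opaque slope_pow.

Lemma slope_pow_le e s t : 0 <= e -> 0 < s -> s <= t ->
  slope_pow e t <= slope_pow e s.
Proof.
move=> e0 s0 st; have t0 : 0 < t := lt_le_trans s0 st.
rewrite (slope_powE _ s0) (slope_powE _ t0).
by apply: (ge0_ler_powR e0); rewrite ?nnegrE ?slope_ge0// flow_slope_le.
Qed.

Lemma slope_pow_integral e s t : 0 <= e -> 0 < s -> s < t ->
  mu.-integrable `]s, t] (EFin \o slope_pow e) /\
  (t - s) * slope f U t `^ e <= \int[mu]_(r in `]s, t]) slope_pow e r
    <= (t - s) * slope f U s `^ e.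
Proof.
move=> e0 s0 st; apply: Rintegral_bounds => //; first exact: measurable_slope_pow.
move=> r sr rt; have r0 : 0 < r := lt_trans s0 sr.
rewrite -(slope_powE e s0) -(slope_powE e (lt_trans s0 st)).
apply/andP; split; first exact: slope_pow_le e0 r0 rt.
exact: slope_pow_le e0 s0 (ltW sr).
Qed.

Lemma slope_pow_bounds e s t : 0 <= e -> 0 < s -> s <= t ->
  (t - s) * slope f U t `^ e <= \int[mu]_(r in `]s, t]) slope_pow e r
    <= (t - s) * slope f U s `^ e.
Proof.
move=> e0 s0; rewrite le_eqVlt => /predU1P[<-|st].
  by rewrite subrr !mul0r set_itv_ge ?bnd_simp// Rintegral_set0 lexx.
by have [] := slope_pow_integral e0 s0 st.
Qed.

Lemma slope_pow_split e x y z : 0 <= e -> 0 < x -> x <= y -> y <= z ->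
  \int[mu]_(r in `]x, z]) slope_pow e r =
  \int[mu]_(r in `]x, y]) slope_pow e r + \int[mu]_(r in `]y, z]) slope_pow e r.
Proof.
move=> e0 x0 xy yz; have [xz|zx] := ltP x z.
  by apply: Rintegral_oc_split => //; have [] := slope_pow_integral e0 x0 xz.
have -> : y = x by apply/eqP; rewrite eq_le xy (le_trans yz).
by rewrite (@set_itv_ge _ _ (BRight x) (BRight x)) ?bnd_simp// Rintegral_set0 add0r.
Qed.

Let monoK e x y z : 0 <= e -> 0 < x -> x <= y -> y <= z ->
  `|slope_pow e x - slope_pow e y| + `|slope_pow e y - slope_pow e z| <=
  `|slope_pow e x - slope_pow e z|.
Proof.
move=> e0 x0 xy yz; have y0 : 0 < y := lt_le_trans x0 xy.
exact: noninc_norm_add (slope_pow_le e0 x0 xy) (slope_pow_le e0 y0 yz).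
Qed.

(** On [x, y] the loss and the integral both lie between (y - x) g(y)^q and (y
    - x) g(x)^q, so that they agree by subadditive_le0. *)
Lemma flow_energy_integral s t : 0 < s -> s <= t ->
  energy f U s - energy f U t = \int[mu]_(r in `]s, t]) slope_pow q r.
Proof.
move=> s0 st; apply/eqP; rewrite eq_le; apply/andP; split; rewrite -subr_le0.
  apply: (subadditive_le0 (delta := fun x y => energy f U x - energy f U y -
     \int[mu]_(r in `]x, y]) slope_pow q r) (K := slope_pow q)) => //.
  - move=> x y z sx xy yz zt; rewrite (slope_pow_split (ltW q0) _ xy yz)//.
      lra.
    exact: lt_le_trans sx.
  - by move=> x y z sx xy yz zt; apply: monoK (ltW q0) _ xy yz; exact: lt_le_trans sx.
  move=> x y sx xy yt; have x0 : 0 < x := lt_le_trans s0 sx.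
  have y0 : 0 < y := lt_le_trans x0 xy.
  have /andP[lb _] := slope_pow_bounds (ltW q0) x0 xy.
  have ub := flow_energy_ub x0 xy.
  have k0 := slope_pow_le (ltW q0) x0 xy; rewrite -subr_ge0 in k0.
rewrite (ger0_norm k0).
rewrite mulrBr (slope_powE _ x0) (slope_powE _ y0).
  by apply: lerB.
apply: (subadditive_le0 (delta := fun x y => \int[mu]_(r in `]x, y]) slope_pow q r -
  (energy f U x - energy f U y)) (K := slope_pow q)) => //.
- move=> x y z sx xy yz zt; rewrite (slope_pow_split (ltW q0) _ xy yz)//.
    lra.
  exact: lt_le_trans sx.
- by move=> x y z sx xy yz zt; apply: monoK (ltW q0) _ xy yz; exact: lt_le_trans sx.
move=> x y sx xy yt; have x0 : 0 < x := lt_le_trans s0 sx.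
have y0 : 0 < y := lt_le_trans x0 xy.
have /andP[_ ub] := slope_pow_bounds (ltW q0) x0 xy.
have lb := flow_energy flow x0 xy.
have k0 := slope_pow_le (ltW q0) x0 xy; rewrite -subr_ge0 in k0.
rewrite (ger0_norm k0).
rewrite mulrBr (slope_powE _ x0) (slope_powE _ y0).
by apply: lerB.
Qed.

Lemma flow_dist_integral s t : 0 < s -> s <= t ->
  mdist (U s) (U t) <= \int[mu]_(r in `]s, t]) slope_pow (q - 1) r.
Proof.
move=> s0 st; have q10 : 0 <= q - 1 by rewrite subr_ge0 ltW.
rewrite -subr_le0.
apply: (subadditive_le0 (delta := fun x y => mdist (U x) (U y) -
     \int[mu]_(r in `]x, y]) slope_pow (q - 1) r) (K := slope_pow (q - 1))) => //.
- move=> x y z sx xy yz zt; rewrite (slope_pow_split q10 _ xy yz)//.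
    have := metric_triangle (U x) (U y) (U z); lra.
  exact: lt_le_trans sx.
- by move=> x y z sx xy yz zt; apply: monoK q10 _ xy yz; exact: lt_le_trans sx.
move=> x y sx xy yt; have x0 : 0 < x := lt_le_trans s0 sx.
have y0 : 0 < y := lt_le_trans x0 xy.
have /andP[lb _] := slope_pow_bounds q10 x0 xy.
have ub := flow_speed flow x0 xy.
have k0 := slope_pow_le q10 x0 xy; rewrite -subr_ge0 in k0.
rewrite (ger0_norm k0).
rewrite mulrBr (slope_powE _ x0) (slope_powE _ y0).
by apply: lerB.
Qed.

End flow_theory.

(** * From slope flows to curves of maximal slope *)

Local Opaque slope_pow.

Section flow_to_curve.
Context {R : realType} {S : metricType R}.
Local Notation mu := (@lebesgue_measure R).
Variables (f : S -> \bar R) (p0 : R).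
Hypothesis f_gtNy : forall v, (-oo < f v)%E.
Hypothesis f_convex : pl_convex f p0 0.
Variables (q : R) (U : R -> S).
Hypothesis q1 : 1 < q.
Hypothesis flow : slope_flow f q U.
Implicit Types (s t : R).

Let q0 : 0 < q. Proof. exact: lt_trans ltr01 q1. Qed.
Let q10 : 0 <= q - 1. Proof. by rewrite subr_ge0 ltW. Qed.

(** The slope may fail to be integrable near time 0, so primitives are taken
    on bounded intervals away from 0, which cover all positive times. *)
Lemma slope_pow_primitive e : 0 <= e -> {ae mu, forall t, 0 < t ->
  exists Q : R -> R, deriv_at Q t (slope f U t `^ e) /\
    exists2 d, 0 < d & forall x y, t - d < x -> x <= y -> y < t + d ->
      0 < x /\ Q y - Q x = \int[mu]_(r in `]x, y]) slope_pow f U e r}.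
Proof.
move=> e0.
have H : {ae mu, forall t, forall n : nat, n.+1%:R^-1 < t < n.+2%:R ->
  exists Q : R -> R, deriv_at Q t (slope f U t `^ e) /\
    exists2 d, 0 < d & forall x y, t - d < x -> x <= y -> y < t + d ->
      0 < x /\ Q y - Q x = \int[mu]_(r in `]x, y]) slope_pow f U e r}.
  apply: ae_foralln => n.
  have a0 : 0 < n.+1%:R^-1 :> R by rewrite invr_gt0.
  have ab : n.+1%:R^-1 < n.+2%:R :> R.
    rewrite invf_plt ?posrE//; apply: (@lt_le_trans _ _ 1).
      by rewrite invf_lt1// ltr1n.
    by rewrite ler1n.
  move: (n.+1%:R^-1) (n.+2%:R) a0 ab => a b a0 ab.
  have [iK _] := slope_pow_integral flow e0 a0 ab.
  pose K := (slope_pow f U e) \_ `]a, b].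
  have iKT : mu.-integrable setT (EFin \o K).
    by rewrite /K -restrict_EFin; apply/integrable_restrict => //=; rewrite setTI.
  apply: aeS (ae_deriv_primitive iKT) => t dK /andP[at_ tb].
  have t0 : 0 < t := lt_trans a0 at_.
  exists (fun t => \int[mu]_(r in `]-oo, t]) K r); split.
    suff <- : K t = slope f U t `^ e by [].
    by rewrite /K patchE mem_set/= ?in_itv/= ?at_ ?ltW// (slope_powE _ _ e t0).
  exists (Num.min (t - a) (b - t)); first by rewrite lt_min !subr_gt0 at_ tb.
  move=> x y; rewrite ltrBlDr -ltrBlDl => xt xy; rewrite -ltrBlDl => yt.
  move: xt yt; rewrite !lt_min => /andP[xt _] /andP[_ yt].
  have ax : a < x by lra.
  have yb : y < b by lra.
  split; first exact: lt_trans ax.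
  rewrite primitiveB//; apply: eq_Rintegral => r; rewrite inE/= in_itv/= => /andP[xr ry].
  by rewrite /K patchE mem_set//= in_itv/= (lt_trans ax xr) (le_trans ry (ltW yb)).
apply: aeS H => t H t0; apply: (H (Num.bound (t + t^-1))).
have ti0 : 0 < t^-1 by rewrite invr_gt0.
have tt0 : 0 <= t + t^-1 by rewrite addr_ge0// ltW.
have B := archi_boundP tt0.
apply/andP; split.
  rewrite invf_plt ?posrE//; apply: (@lt_trans _ _ (Num.bound (t + t^-1))%:R); last first.
    by rewrite ltr_nat.
  by apply: le_lt_trans B; rewrite lerDr ltW.
apply: (@lt_trans _ _ (Num.bound (t + t^-1))%:R); last by rewrite ltr_nat.
by apply: le_lt_trans B; rewrite lerDl ltW.
Qed.

Lemma flow_energy_deriv : {ae mu, forall t, 0 < t ->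
  deriv_at (fun r => - energy f U r) t (slope f U t `^ q)}.
Proof.
apply: aeS (slope_pow_primitive (ltW q0)) => t H t0.
have [Q [dQ [d d0 QE]]] := H t0.
move=> e e0; have [d' d'0 Hd] := dQ e e0.
exists (Num.min d d'); first by rewrite lt_min d0.
move=> s; rewrite lt_min => /andP[sd /Hd].
suff -> : - energy f U s - - energy f U t = Q s - Q t by [].
move: sd; rewrite ltr_norml => /andP[sd1 sd2].
have [ts|/ltW st] := leP t s.
  have [|||_ ->] := QE t s => //; [by rewrite gtrBl|by rewrite addrC -ltrBlDr|].
  by rewrite -(flow_energy_integral f_gtNy f_convex q1 flow t0 ts); lra.
have [|||s0 QE'] := QE s t => //; [by lra|by rewrite ltrDl|].
rewrite -[RHS]opprB QE' -(flow_energy_integral f_gtNy f_convex q1 flow s0 st); lra.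
Qed.

(** Although the slope may blow up at time 0, the energy does not: the total
    loss f (U 0) - f (U T) is finite and bounds the integral of g^q. *)
Lemma slope_pow_integrable0 T : 0 < T ->
  mu.-integrable `]0, T[ (EFin \o slope_pow f U q).
Proof.
move=> T0.
have mK := measurable_slope_pow flow q.
have mKT : measurable_fun `]0, T[ (EFin \o slope_pow f U q).
  by apply/measurable_EFinP; exact: measurable_funS mK.
apply/integrableP; split => //.
apply: le_lt_trans (ltry (- energy f U T - - energy f U 0)).
apply: (@le_trans _ _ (\int[mu]_(r in `]0%R, T[) (slope_pow f U q r)%:E)%E).
  rewrite le_eqVlt; apply/orP; left; apply/eqP; apply: eq_integral => r _.
  by rewrite /= ger0_norm// slope_pow_ge0.
apply: (monotone_deriv_integral_le (N := fun r => - energy f U r)) => //; first exact: ltW.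
- by move=> s t s0 st tT; rewrite lerN2 (flow_energy_le f_gtNy flow s0 st).
- by move=> r; exact: slope_pow_ge0.
apply: aeS flow_energy_deriv => t H /andP[t0 tT].
by exists (slope f U t `^ q); [exact: H|rewrite (slope_powE _ _ q t0)].
Qed.

Lemma flow_speed_integrable (K : set R) : K `<=` interval0 +oo -> compact K ->
  mu.-integrable K (EFin \o slope_pow f U (q - 1)).
Proof.
move=> K0 cK.
have [M [_ HM]] := compact_bounded cK.
pose T := Num.max M 0 + 2.
have T0 : 0 < T by rewrite ltr_wpDl// le_max lexx orbT.
have KT r : K r -> r < T.
  move=> Kr; apply: (@le_lt_trans _ _ (Num.max M 0 + 1)); last by rewrite ltrD2l ltr1n.
  apply: le_trans (ler_norm r) _; apply: HM => //.
  by apply: (@le_lt_trans _ _ (Num.max M 0)); rewrite ?le_max ?lexx// ltrDl.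
have iq := slope_pow_integrable0 T0.
have i1 : mu.-integrable `]0, T[ (EFin \o (fun r => 1 + slope_pow f U q r)).
  have ic : mu.-integrable `]0, T[ (EFin \o cst 1).
    by apply: (@bounded_integrable _ _ _ _ `|1|) => //; exact: measurable_cst.
  by apply: eq_integrable (integrableD _ ic iq).
have iT : mu.-integrable `]0, T[ (EFin \o slope_pow f U (q - 1)).
  apply: le_integrable i1 => //.
    by apply/measurable_EFinP; exact: measurable_funS (measurable_slope_pow flow _).
  move=> r; rewrite /= in_itv/= => /andP[r0 _].
  rewrite lee_fin !ger0_norm ?addr_ge0 ?slope_pow_ge0//.
  rewrite (slope_powE _ _ _ r0) (slope_powE _ _ _ r0).
  have g0 := slope_ge0 f U r.
  have [g1|g1] := leP (slope f U r) 1.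
    have : slope f U r `^ (q - 1) <= 1 `^ (q - 1).
      by apply: (ge0_ler_powR q10) => //; rewrite nnegrE.
    by rewrite powR1 => /le_trans; apply; rewrite lerDl powR_ge0.
  apply: (@le_trans _ _ (slope f U r `^ q)); last by rewrite lerDr.
  by apply: ler_powR; [exact: ltW|rewrite gerBl].
have iTT : mu.-integrable setT (EFin \o (slope_pow f U (q - 1) \_ `]0, T[)).
  by rewrite -restrict_EFin; apply/integrable_restrict => //=; rewrite setTI.
have mK : measurable K by exact: compact_measurable.
have iTK : mu.-integrable K (EFin \o (slope_pow f U (q - 1) \_ `]0, T[)).
  exact: integrableS iTT.
apply: eq_integrable iTK => // r; rewrite inE => Kr /=; congr EFin.
rewrite patchE; case: ifPn => //; rewrite notin_setE/= in_itv/= (KT _ Kr) andbT => r0.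
have -> : r = 0.
  by have := K0 _ Kr; rewrite interval0y => rge0; apply/eqP; rewrite eq_le rge0 leNgt; apply/andP; split=> //; apply/negP.
by rewrite slope_pow_out// gt_eqF// subr_gt0.
Qed.

(** The exponent q - 1 is between 0 and q, so integrability of g^(q - 1) up to
    time 0 follows from that of g^q; right continuity of U at 0 extends the
    bound on distances to time 0. *)
Lemma flow_AC : AC_loc +oo U.
Proof.
exists (slope_pow f U (q - 1)); first exact: flow_speed_integrable.
have cI s t : 0 <= s -> mu.-integrable `[s, t] (EFin \o slope_pow f U (q - 1)).
  move=> s0; apply: flow_speed_integrable; last exact: segment_compact.
  by move=> r; rewrite interval0y/= in_itv/= => /andP[+ _]; exact: le_trans.
have sub s t s' : 0 <= s -> s <= s' ->
    \int[mu]_(r in `]s', t]) slope_pow f U (q - 1) r <=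
    \int[mu]_(r in `[s, t]) slope_pow f U (q - 1) r.
  move=> s0 ss'; apply: ge0_subset_Rintegral => //.
  - by apply: subset_itvr; rewrite bnd_simp.
  - exact: cI.
  - by move=> r _; exact: slope_pow_ge0.
move=> s t; rewrite !interval0y le_eqVlt => /predU1P[<- t0 _|s0 t0 st]; last first.
  apply: le_trans (flow_dist_integral q1 flow s0 st) _.
  by apply: sub => //; exact: ltW.
apply/ler_addgt0Pl => e e0.
move: t0; rewrite le_eqVlt => /predU1P[<-|t0].
  rewrite mdistxx addr_ge0 ?(ltW e0)// Rintegral_ge0// => r _.
  exact: slope_pow_ge0.
have [d d0 Hd] := flow_cont0 flow e0.
pose r := Num.min (d / 2) t.
have r0 : 0 < r by rewrite lt_min t0 divr_gt0.
have rt : r <= t by rewrite ge_min lexx orbT.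
have rd : r < d by rewrite gt_min ltr_pdivrMr// ltr_pMr// ltr1n.
apply: le_trans (metric_triangle _ (U r) _) _; apply: lerD.
  by apply: Hd rd; exact: ltW.
apply: le_trans (flow_dist_integral q1 flow r0 rt) _.
by apply: sub => //; exact: ltW.
Qed.

Lemma flow_metric_deriv : {ae mu, forall t, 0 < t ->
  exists w, [/\ metric_deriv_at U t w, 0 <= w & w <= slope f U t `^ (q - 1)]}.
Proof.
have H : {ae mu, forall t, forall n : nat, 0 < t < n.+1%:R ->
    exists w, metric_deriv_at U t w /\ 0 <= w}.
  apply: ae_foralln => n.
  have [m im Um] := AC_loc_restrict (ltr0Sn R n) flow_AC.
  have [w [w0 _ _ aew]] := metric_speed (ltr0Sn R n) im Um.
  by apply: aeS aew => t H tn; exists (w t); split => //; exact: H.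
apply: aeS2 H (slope_pow_primitive q10) => t H P t0.
have [|w [dw w0]] := H (Num.bound t).
  rewrite t0/=; apply: lt_trans (archi_boundP (ltW t0)) _; by rewrite ltr_nat.
exists w; split => //.
have [Q [dQ [d d0 QE]]] := P t0.
set m := slope f U t `^ (q - 1) in dQ *.
have H' : forall e : R, 0 < e -> w <= m + e.
  move=> e e0; have e20 : 0 < e / 2 by rewrite divr_gt0.
  have [d1 d10 H1] := dw _ e20; have [d2 d20 H2] := dQ _ e20.
  have [h [h0 hd hd1 hd2]] := exists_lt3 d0 d10 d20.
  have hE : t + h - t = h by rewrite addrC addKr.
  have := H1 (t + h); rewrite hE (gtr0_norm h0) => /(_ hd1).
  have := H2 (t + h); rewrite hE (gtr0_norm h0) => /(_ hd2).
  have [|||_ QE'] := QE t (t + h); [by rewrite gtrBl|by rewrite lerDl ltW|by rewrite ltrD2l|].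
  have th : t <= t + h by rewrite lerDl ltW.
  have D := flow_dist_integral q1 flow t0 th.
  rewrite -QE' in D.
  rewrite !ler_norml => /andP[_ B2] /andP[B1 _].
  rewrite -(ler_pM2r h0) mulrDl; lra.
by apply/ler_addgt0Pr.
Qed.

(** Since 1 / p + 1 / q = 1, the derivative - g^q of the energy splits as -
    g^q / p - g^q / q, and |U'|^p <= g^((q - 1) p) = g^q. *)
Lemma flow_max_slope_curve (p : R) : 1 < p -> q = conj_exponent p ->
  max_slope_curve f p +oo (U 0) U.
Proof.
move=> p1 qE; split => //.
- exact: flow_AC.
- move=> s t; rewrite !interval0y => s0 t0 st.
  have ft := domain_fin_num f_gtNy (flow_fin flow t0).
  have fs := domain_fin_num f_gtNy (flow_fin flow s0).
  rewrite -(fineK ft) -(fineK fs) lee_fin.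
  exact: (flow_energy_le f_gtNy flow s0 st).
have nz : {ae mu, forall t, t != 0}.
  exists [set 0]; split => //; first exact: lebesgue_measure_set1.
  by move=> t /= /negP; rewrite negbK => /eqP.
apply: aeS2 nz (@aeS2 _ _ _ _ (fun t a b => conj a b) flow_energy_deriv flow_metric_deriv).
move=> t tn0 H; rewrite interval0y => tge0.
have t0 : 0 < t by rewrite lt_neqAle eq_sym tn0.
have [/(_ t0) dphi /(_ t0)[w [dw w0 wg]]] := H.
have dphi' : deriv_at (energy f U) t (- slope f U t `^ q).
  move=> e e0; have [d d0 Hd] := dphi e e0; exists d => // s sd.
  suff -> : energy f U s - energy f U t - - slope f U t `^ q * (s - t) =
    - (- energy f U s - - energy f U t - slope f U t `^ q * (s - t)).
    by rewrite normrN Hd.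
  by rewrite mulNr; lra.
have [dphi1 dphi2] := (deriv_atP _ _ _).1 dphi'.
split; first exact: dphi1.
rewrite (metric_derivativeE t0 dw) (flow_slopeE flow t0) -qE.
have wp : w `^ p <= slope f U t `^ q.
  have p00 : 0 <= p by rewrite ltW// (lt_trans ltr01).
  have -> : q = (q - 1) * p.
    by have := conj_exponentM p1; rewrite -qE mulrBr mulr1; lra.
  by rewrite powRrM; apply: (ge0_ler_powR p00); rewrite ?nnegrE ?powR_ge0.
have pq : p^-1 + q^-1 = 1 by rewrite qE conj_exponentE.
have -> : derive1 (fine \o f \o U) t = - slope f U t `^ q by exact: dphi2.
rewrite poweR_EFin -EFinM -EFinN -EFinB lee_fin.
rewrite -opprD lerN2 -[leRHS]mul1r -pq mulrDl lerD2r ler_wpM2l// invr_ge0.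
by rewrite ltW// (lt_trans ltr01).
Qed.

End flow_to_curve.

(** * The new time along a slope flow *)

Section clock.
Context {R : realType} {S : metricType R}.
Local Notation mu := (@lebesgue_measure R).
Variables (f : S -> \bar R) (p0 : R).
Hypothesis f_gtNy : forall v, (-oo < f v)%E.
Hypothesis f_convex : pl_convex f p0 0.
Hypothesis f_lsc : lower_semicontinuous f.
Variables (q q' : R) (U : R -> S).
Hypothesis (q1 : 1 < q) (q'1 : 1 < q').
Hypothesis flow : slope_flow f q U.
Implicit Types (s t x y : R).

Local Notation T := (stop_time f +oo U).

Lemma flow_right_cont t e : 0 <= t -> 0 < e -> exists2 d, 0 < d &
  forall s, t <= s -> s < t + d -> mdist (U t) (U s) <= e.
Proof.
rewrite le_eqVlt => /predU1P[<-|t0] e0.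
  have [d d0 Hd] := flow_cont0 flow e0.
  by exists d => // s s0; rewrite add0r; exact: Hd.
pose c := slope f U t `^ (q - 1) + 1.
have c0 : 0 < c by rewrite ltr_wpDl// powR_ge0.
exists (e / c); first by rewrite divr_gt0.
move=> s ts; rewrite -ltrBlDl ltr_pdivlMr// => sc.
apply: le_trans (flow_speed flow t0 ts) (le_trans _ (ltW sc)).
by rewrite ler_wpM2l ?subr_ge0// lerDl.
Qed.

(** The slope is nonincreasing along the flow, and it stays positive for a
    while after a time where it is positive, by right continuity of U and
    lower semicontinuity of the slope. So the set of times with positive slope
    is exactly [0, T). *)
Lemma stop_ltP t : 0 <= t -> (t%:E < T)%E = (0 < local_slope f (U t))%E.
Proof.
move=> t0; apply/idP/idP => [|g0].
  rewrite /stop_time lt_max => /orP[|/ereal_sup_gt[_ [s [s0 gs] <-]]].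
    by rewrite lte_fin ltNge t0.
  rewrite lte_fin => ts; apply: lt_le_trans gs _.
  by apply: (flow_slope_noninc flow) => //; exact: ltW.
have [e e0 He] := local_slope_lsc f_gtNy f_convex f_lsc (lexx 0) (flow_fin flow t0) g0.
have e20 : 0 < e / 2 by rewrite divr_gt0.
have [d d0 Hd] := flow_right_cont t0 e20.
have tt : t < t + d / 2 by rewrite ltrDl divr_gt0.
apply: (@lt_le_trans _ _ (t + d / 2)%:E); first by rewrite lte_fin.
rewrite /stop_time le_max; apply/orP; right; apply: ereal_sup_ubound.
exists (t + d / 2); last by []; split; first by rewrite interval0y (le_trans t0)// ltW.
apply: He; apply: (@le_lt_trans _ _ (e / 2)); last by lra.
by apply: Hd; [exact: ltW|lra].
Qed.

Lemma stop_ge0 : (0 <= T)%E. Proof. by rewrite /stop_time le_max lexx. Qed.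

Lemma slope_gt0 t : 0 < t -> (t%:E < T)%E -> 0 < slope f U t.
Proof.
by move=> t0; rewrite stop_ltP ?(ltW t0)// (flow_slopeE flow t0) lte_fin.
Qed.

Lemma stop_slope0 t : 0 <= t -> (T <= t%:E)%E -> local_slope f (U t) = 0%E.
Proof.
move=> t0; rewrite leNgt stop_ltP// -leNgt => g0.
by apply/eqP; rewrite eq_le g0 local_slope_ge0.
Qed.

(** The time change, with the slope in place of the metric derivative; the
    open bound at 0 keeps the time where the slope may be infinite out of the
    integral. *)
Definition clock t : R := \int[mu]_(r in `]0, t]) slope_pow f U (q - q') r.

Lemma clock_integrable t : (t%:E < T)%E ->
  mu.-integrable `]0, t] (EFin \o slope_pow f U (q - q')).
Proof.
move=> tT; have [t0|t0] := ltP 0 t; last first.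
  by rewrite set_itv_ge ?bnd_simp -?leNgt//; exact: integrable_set0.
have gt0 := slope_gt0 t0 tT.
have tT1 : 0 < t + 1 by rewrite ltr_wpDl// ltW.
have iq : mu.-integrable `]0, t] (EFin \o slope_pow f U q).
  apply: integrableS (slope_pow_integrable0 f_gtNy f_convex q1 flow tT1) => //.
  by apply: subset_itvl; rewrite bnd_simp ltrDl.
have [M ME] : exists M, M = 1 + slope f U t `^ (q - q') by eexists.
have M0 : 0 <= M by rewrite ME addr_ge0 ?powR_ge0.
have iM : mu.-integrable `]0, t] (EFin \o (fun r => M + slope_pow f U q r)).
  have ic : mu.-integrable `]0, t] (EFin \o cst M).
    have H r : 0 < r -> r <= t -> M <= cst M r <= M by rewrite lexx.
    by have [] := Rintegral_bounds t0 (measurable_cst _) H.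
  by apply: eq_integrable (integrableD _ ic iq).
apply: le_integrable iM => //.
  by apply/measurable_EFinP; exact: measurable_funS (measurable_slope_pow flow _).
move=> r; rewrite /= in_itv/= => /andP[r0 rt].
have gtr := flow_slope_le flow r0 rt.
rewrite lee_fin !ger0_norm ?addr_ge0 ?slope_pow_ge0//.
rewrite (slope_powE _ _ _ r0) (slope_powE _ _ _ r0) ME.
by apply: powR_dominated gt0 gtr; rewrite gerBl (le_trans ler01)// ltW.
Qed.

Lemma clock0 t : t <= 0 -> clock t = 0.
Proof.
by move=> t0; rewrite /clock set_itv_ge ?bnd_simp -?leNgt// Rintegral_set0.
Qed.

Lemma clockB x y : 0 <= x -> x <= y -> (y%:E < T)%E ->
  clock y - clock x = \int[mu]_(r in `]x, y]) slope_pow f U (q - q') r.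
Proof. by move=> x0 xy yT; apply: Rintegral_itvB => //; exact: clock_integrable. Qed.

Lemma clock_le x y : 0 <= x -> x <= y -> (y%:E < T)%E -> clock x <= clock y.
Proof.
move=> x0 xy yT; rewrite -subr_ge0 clockB// Rintegral_ge0// => r _.
exact: slope_pow_ge0.
Qed.

Lemma clock_ge0 x : 0 <= clock x.
Proof. by rewrite Rintegral_ge0// => r _; exact: slope_pow_ge0. Qed.

Lemma lt_stop x y : x <= y -> (y%:E < T)%E -> (x%:E < T)%E.
Proof. by move=> xy; apply: le_lt_trans; rewrite lee_fin. Qed.

Lemma clock_bounds x y : 0 < x -> x <= y -> (y%:E < T)%E ->
  (y - x) * Num.min (slope f U y `^ (q - q')) (slope f U x `^ (q - q')) <=
    clock y - clock x <=
  (y - x) * Num.max (slope f U y `^ (q - q')) (slope f U x `^ (q - q')).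
Proof.
move=> x0; rewrite le_eqVlt => /predU1P[<- _|xy yT].
  by rewrite !subrr !mul0r lexx.
rewrite (clockB (ltW x0) (ltW xy) yT).
apply: (proj2 (Rintegral_bounds xy (measurable_slope_pow flow (q - q')) _)).
move=> r xr ry; have r0 := lt_trans x0 xr.
rewrite (slope_powE _ _ _ r0); apply: powR_between.
- exact: (slope_gt0 (lt_trans x0 xy) yT).
- exact: (flow_slope_le flow r0 ry).
- exact: (flow_slope_le flow x0 (ltW xr)).
Qed.

Lemma clock_lt x y : 0 <= x -> x < y -> (y%:E < T)%E -> clock x < clock y.
Proof.
have H s t : 0 < s -> s < t -> (t%:E < T)%E -> clock s < clock t.
  move=> s0 st tT; rewrite -subr_gt0.
  have /andP[+ _] := clock_bounds s0 (ltW st) tT.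
  apply: lt_le_trans; rewrite mulr_gt0 ?subr_gt0// lt_min.
  have t0 := lt_trans s0 st.
  apply/andP; split; apply: powR_gt0; first exact: (slope_gt0 t0 tT).
  exact: (slope_gt0 s0 (lt_stop (ltW st) tT)).
rewrite le_eqVlt => /predU1P[<- y0 yT|]; last exact: H.
rewrite clock0//; apply: le_lt_trans (clock_ge0 (y / 2)) _.
by apply: H => //; [rewrite divr_gt0|rewrite ltr_pdivrMr// ltr_pMr// ltr1n].
Qed.

(** Compares g^(q - 1) = g^(q - q') g^(q' - 1) with its value when the last
    factor is frozen at time x. In the new time this is the speed bound of a
    flow with exponent q'. *)
Lemma clock_dist x y : 0 < x -> x <= y -> (y%:E < T)%E ->
  mdist (U x) (U y) <= (clock y - clock x) * slope f U x `^ (q' - 1).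
Proof.
move=> x0; rewrite le_eqVlt => /predU1P[<- _|xy yT].
  by rewrite mdistxx subrr mul0r.
have i1 : mu.-integrable `]x, y] (EFin \o slope_pow f U (q - q')).
  apply: integrableS (clock_integrable yT) => //.
  by apply: subset_itvr; rewrite bnd_simp ltW.
have q10 : 0 <= q - 1 by rewrite subr_ge0 ltW.
have q'10 : 0 <= q' - 1 by rewrite subr_ge0 ltW.
apply: le_trans (flow_dist_integral q1 flow x0 (ltW xy)) _.
rewrite (clockB (ltW x0) (ltW xy) yT) -RintegralZr//.
apply: le_Rintegral => //.
- by have [] := slope_pow_integral flow q10 x0 xy.
- by apply: eq_integrable (integrableZr _ (slope f U x `^ (q' - 1)) i1).
move=> r; rewrite /= in_itv/= => /andP[xr ry]; have r0 := lt_trans x0 xr.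
rewrite (slope_powE _ _ _ r0) (slope_powE _ _ _ r0).
have gr0 : 0 < slope f U r by exact: (slope_gt0 r0 (lt_stop ry yT)).
have -> : q - 1 = (q - q') + (q' - 1) by rewrite addrA subrK.
rewrite powRD; last by rewrite (gt_eqF gr0) implybT.
apply: ler_wpM2l; first exact: powR_ge0.
exact: (powR_monotone q'10 gr0 (flow_slope_le flow x0 (ltW xr))).
Qed.

(** As for clock_dist, with g^q = g^(q - q') g^q' and the last factor frozen
    at time y. *)
Lemma clock_energy x y : 0 < x -> x <= y -> (y%:E < T)%E ->
  (clock y - clock x) * slope f U y `^ q' <= energy f U x - energy f U y.
Proof.
move=> x0; rewrite le_eqVlt => /predU1P[<- _|xy yT].
  by rewrite !subrr mul0r.
have i1 : mu.-integrable `]x, y] (EFin \o slope_pow f U (q - q')).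
  apply: integrableS (clock_integrable yT) => //.
  by apply: subset_itvr; rewrite bnd_simp ltW.
have q0 : 0 <= q by rewrite (le_trans ler01)// ltW.
have q'0 : 0 <= q' by rewrite (le_trans ler01)// ltW.
rewrite (flow_energy_integral f_gtNy f_convex q1 flow x0 (ltW xy)).
rewrite (clockB (ltW x0) (ltW xy) yT) -RintegralZr//.
apply: le_Rintegral => //.
- by apply: eq_integrable (integrableZr _ (slope f U y `^ q') i1).
- by have [] := slope_pow_integral flow q0 x0 xy.
move=> r; rewrite /= in_itv/= => /andP[xr ry]; have r0 := lt_trans x0 xr.
rewrite (slope_powE _ _ _ r0) (slope_powE _ _ _ r0).
have gy0 : 0 < slope f U y by exact: (slope_gt0 (lt_trans x0 xy) yT).
have gry := flow_slope_le flow r0 ry.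
have gr0 := lt_le_trans gy0 gry.
rewrite -(powRB q q' gr0); apply: ler_wpM2l; first exact: powR_ge0.
exact: (powR_monotone q'0 gy0 gry).
Qed.

Lemma clock_continuous b : (b%:E < T)%E -> {within `[0, b], continuous clock}.
Proof.
move=> bT; have [b0|b0] := ltP b 0.
  by rewrite set_itv_ge ?bnd_simp -?ltNge//; exact: continuous_subspace0.
have [K KE] : exists K, K = slope_pow f U (q - q') \_ `]0, b] by eexists.
have iK : mu.-integrable setT (EFin \o K).
  rewrite KE -restrict_EFin; apply/integrable_restrict => //=.
  by rewrite setTI; exact: clock_integrable.
have iKS (A : set R) : measurable A -> mu.-integrable A (EFin \o K).
  by move=> mA; apply: integrableS iK.
have C := parameterized_integral_continuous b0 (iKS _ (measurable_itv _)).
apply: subspace_eq_continuous C => x; rewrite inE/= in_itv/= => /andP[x0 xb].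
rewrite /from_subspace /parameterized_integral.
rewrite -Rintegral_itv_obnd_cbnd; last exact: iKS.
apply: eq_Rintegral => r; rewrite inE/= in_itv/= => /andP[r0 rx].
by rewrite KE patchE mem_set//= in_itv/= r0 (le_trans rx).
Qed.

Lemma clock_ivt b c : 0 <= b -> (b%:E < T)%E -> 0 <= c -> c <= clock b ->
  exists2 t, 0 <= t /\ t <= b & clock t = c.
Proof.
move=> b0 bT c0 cb; have [|t + <-] := IVT b0 (clock_continuous bT) (v := c).
  by rewrite ge_min le_max (clock0 (lexx 0)) c0 cb orbT.
by rewrite in_itv/= => /andP[]; exists t.
Qed.

End clock.

(** * The range of the new time *)

Section clock_range.
Context {R : realType} {S : metricType R}.
Local Notation mu := (@lebesgue_measure R).
Variables (f : S -> \bar R) (p0 : R).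
Hypothesis f_gtNy : forall v, (-oo < f v)%E.
Hypothesis f_convex : pl_convex f p0 0.
Hypothesis f_lsc : lower_semicontinuous f.
Variables (p p' : R) (U : R -> S).
Hypothesis (p1 : 1 < p) (p'1 : 1 < p').
Hypothesis flow : slope_flow f (conj_exponent p) U.
Implicit Types (s t x y : R).

Local Notation T := (stop_time f +oo U).
Local Notation clock := (clock f (conj_exponent p) (conj_exponent p') U).
Local Notation G := (slope_pow f U (conj_exponent p - conj_exponent p')).

Let q1 : 1 < conj_exponent p. Proof. exact: conj_exponent_gt1. Qed.
Let q'1 : 1 < conj_exponent p'. Proof. exact: conj_exponent_gt1. Qed.

(** Treats finite and infinite stopping times alike when passing to the limit
    t -> T. *)
Lemma stop_exhaustion : exists t_ : nat -> R,
  [/\ (forall n, t_ n <= t_ n.+1), (forall n, ((t_ n)%:E < T)%E) &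
      forall r, (r%:E < T)%E -> exists n, r <= t_ n].
Proof.
have := stop_ge0 f U; case: T => [c c0|_|]; last by rewrite leeNy_eq.
- exists (fun n => c - n.+1%:R^-1); split.
  + by move=> n; rewrite lerB// lef_pV2 ?posrE// ler_nat.
  + by move=> n; rewrite lte_fin gtrBl invr_gt0.
  + move=> r; rewrite lte_fin -subr_gt0 => rc.
    exists (Num.bound (c - r)^-1); rewrite lerBrDl -lerBrDr.
    rewrite -[leRHS]invrK lef_pV2 ?posrE ?invr_gt0//.
    rewrite (le_trans (ltW (archi_boundP _))) ?ler_nat//.
    by rewrite invr_ge0 ltW.
- exists (fun n => n%:R); split => [n|n|r _]; first by rewrite ler_nat.
    exact: ltry.
  exists (Num.bound `|r|); apply: le_trans (ler_norm r) _.
  by apply/ltW/archi_boundP.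
Qed.

Lemma stop_between t : (t%:E < T)%E -> exists2 t', t < t' & (t'%:E < T)%E.
Proof.
case: T => [c||//]; last by move=> _; exists (t + 1); rewrite ?ltrDl ?ltry.
by rewrite lte_fin => tc; exists ((t + c) / 2); rewrite ?lte_fin; lra.
Qed.

Lemma exhaustionE (t_ : nat -> R) : (forall n, ((t_ n)%:E < T)%E) ->
  (forall r, (r%:E < T)%E -> exists n, r <= t_ n) ->
  interval0 T = \bigcup_n [set` `[0, t_ n]].
Proof.
move=> tT H; apply/seteqP; split => r.
  by move=> [r0 /H[n rn]]; exists n => //=; rewrite in_itv/= r0.
move=> [n _]/=; rewrite in_itv/= => /andP[r0 rn]; split => //.
exact: lt_stop rn (tT n).
Qed.

Lemma measurable_interval0 : measurable (interval0 T).
Proof.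
have [t_ [_ tT H]] := stop_exhaustion.
rewrite (exhaustionE tT H); apply: bigcupT_measurable => n; exact: measurable_itv.
Qed.
Lemma clock_integral t : (t%:E < T)%E ->
  (\int[mu]_(r in `[0%R, t]) (G r)%:E)%E = (clock t)%:E.
Proof.
move=> tT.
have i := clock_integrable f_gtNy f_convex f_lsc q1 q'1 flow tT.
rewrite -integral_itv_obnd_cbnd; last exact: measurable_int i.
by rewrite /clock /Rintegral fineK//; exact: integrable_fin_num i.
Qed.

(** The two sides can differ at time 0, where the slope is cut off, and at the
    negligible set of times where the speed is not g^(q - 1). *)
Lemma speed_power_ae : {ae mu, forall t, 0 <= t ->
  (speed_power p p' +oo U t)%:E = (G t)%:E}.
Proof.
have [AC _ ni H] := flow_max_slope_curve f_gtNy f_convex q1 flow p1 erefl.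
have ni' s t : 0 <= s -> s <= t -> (f (U t) <= f (U s))%E.
  by move=> s0 st; apply: ni => //; rewrite interval0y// (le_trans s0).
have nz : {ae mu, forall t, t != 0}.
  exists [set 0]; split => //; first exact: lebesgue_measure_set1.
  by move=> t /= /negP; rewrite negbK => /eqP.
have := curve_metric_derivative f_gtNy f_convex p1 (flow_dom flow) AC ni' H.
apply: aeS2 nz => t tn0 + tge0.
have t0 : 0 < t by rewrite lt_neqAle eq_sym tn0.
by move=> /(_ t0) md; rewrite /speed_power md -powRrM alphaE// (slope_powE _ _ _ t0).
Qed.

Lemma s_tildeE t : (t%:E < T)%E -> s_tilde p p' +oo U t = (clock t)%:E.
Proof.
move=> tT; rewrite -clock_integral//; apply: ge0_ae_eq_integral_nonmeas.
- by move=> r _; rewrite lee_fin powR_ge0.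
- by move=> r _; rewrite lee_fin slope_pow_ge0.
by apply: aeS speed_power_ae => r H; rewrite /= in_itv/= => /andP[r0 _]; exact: H.
Qed.

Lemma S_starE : S_star f p p' +oo U = (\int[mu]_(r in interval0 T) (G r)%:E)%E.
Proof.
apply: ge0_ae_eq_integral_nonmeas.
- by move=> r _; rewrite lee_fin powR_ge0.
- by move=> r _; rewrite lee_fin slope_pow_ge0.
by apply: aeS speed_power_ae => r H [r0 _]; exact: H.
Qed.

Lemma clock_lt_S t : 0 <= t -> (t%:E < T)%E ->
  ((clock t)%:E < S_star f p p' +oo U)%E.
Proof.
move=> t0 tT; have [t' tt' t'T] := stop_between tT.
have H := clock_lt f_gtNy f_convex f_lsc q1 q'1 flow t0 tt' t'T.
rewrite -lte_fin in H; apply: lt_le_trans H _.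
rewrite -clock_integral// S_starE; apply: ge0_subset_integral => //.
- exact: measurable_interval0.
- by apply/measurable_EFinP; exact: measurable_funS (measurable_slope_pow flow _).
- by move=> r _; rewrite lee_fin slope_pow_ge0.
move=> r /=; rewrite in_itv/= => /andP[r0 rt']; split=> //.
exact: lt_stop rt' t'T.
Qed.

(** The total S* is the limit of the values of the clock, by monotone
    convergence. *)
Lemma clock_cofinal c : 0 <= c -> (c%:E < S_star f p p' +oo U)%E ->
  exists t, [/\ 0 <= t, (t%:E < T)%E & c < clock t].
Proof.
move=> c0; rewrite S_starE => cS; apply/not_notP => N.
have [t_ [ndt tT H]] := stop_exhaustion.
have le n : clock (t_ n) <= c.
  have [t0|t0] := ltP (t_ n) 0.
    by rewrite clock0// ltW.
  by rewrite leNgt; apply/negP => ct; apply: N; exists (t_ n).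
have cvgI : (\int[mu]_(r in [set` `[0%R, t_ n]]) (G r)%:E)%E @[n --> \oo] -->
    (\int[mu]_(r in interval0 T) (G r)%:E)%E.
  rewrite (exhaustionE tT H); apply: ge0_nondecreasing_set_cvg_integral.
  - apply/nondecreasing_seqP => n; rewrite subsetEset => r/=; rewrite !in_itv/=.
    by move=> /andP[-> rn]; exact: le_trans rn (ndt n).
  - by move=> n; exact: measurable_itv.
  - by move=> n; apply/measurable_EFinP; exact: measurable_funS (measurable_slope_pow flow _).
  - by move=> n r _; rewrite lee_fin slope_pow_ge0.
move: cS; rewrite ltNge => /negP; apply.
rewrite -(cvg_lim _ cvgI)//; apply: lime_le; first exact: cvgP cvgI.
by apply: nearW => n; rewrite clock_integral// lee_fin le.
Qed.

Lemma clock_surj c : 0 <= c -> (c%:E < S_star f p p' +oo U)%E ->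
  exists t, [/\ 0 <= t, (t%:E < T)%E & clock t = c].
Proof.
move=> c0 /(clock_cofinal c0)[b [b0 bT cb]].
have [t [t0 tb] tc] := clock_ivt f_gtNy f_convex f_lsc q1 q'1 flow b0 bT c0 (ltW cb).
by exists t; split=> //; exact: lt_stop tb bT.
Qed.

Lemma s_tilde_incr s t : interval0 T s -> interval0 T t -> s < t ->
  (s_tilde p p' +oo U s < s_tilde p p' +oo U t)%E.
Proof.
move=> [s0 sT] [_ tT] st; rewrite !s_tildeE// lte_fin.
exact: (clock_lt f_gtNy f_convex f_lsc q1 q'1 flow s0 st tT).
Qed.

Lemma s_tilde_bij : set_bij (interval0 T)
  [set s%:E | s in interval0 (S_star f p p' +oo U)] (s_tilde p p' +oo U).
Proof.
split.
- move=> t [t0 tT]; exists (clock t); last by rewrite s_tildeE.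
  by split; [exact: clock_ge0|exact: clock_lt_S].
- move=> s t; rewrite !inE => sI tI E; apply/eqP; rewrite eq_le !leNgt.
  apply/andP; split; apply/negP => H.
    by have := s_tilde_incr tI sI H; rewrite E ltxx.
  by have := s_tilde_incr sI tI H; rewrite E ltxx.
move=> _ [c [c0 cS] <-]; have [t [t0 tT tc]] := clock_surj c0 cS.
by exists t => //; rewrite s_tildeE// tc.
Qed.

Lemma t_tildeE t : 0 <= t -> (t%:E < T)%E -> t_tilde f p p' +oo U (clock t) = t.
Proof.
move=> t0 tT; rewrite /t_tilde -s_tildeE//.
by apply: pinvKV; [exact: (set_bij_inj s_tilde_bij)|rewrite inE].
Qed.

End clock_range.

(** * The final point *)

Section curve_limit.
Context {R : realType} {S : completeMetricType R}.
Implicit Types (U : R -> S) (z : S).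

Lemma curve_cvg_dist U z : U r @[r --> +oo] --> z <->
  forall e, 0 < e -> exists x, forall y, x <= y -> mdist z (U y) < e.
Proof.
split => [Uz e e0|H].
  have /Uz [M [_ HM]] := nbhsx_ballx z e e0.
  exists (M + 1) => y My; have : ball z e (U y).
    by apply: HM; rewrite (lt_le_trans _ My)// ltrDl.
  by rewrite ballEmdist.
move=> A /nbhs_ballP[e /= e0 eA]; have [x Hx] := H e e0.
exists x; split => [|y xy]; first exact: num_real.
by apply: eA; rewrite ballEmdist/=; apply: Hx; exact: ltW.
Qed.

Lemma curve_is_cvg U :
  (forall e, 0 < e -> exists x, forall y, x <= y -> mdist (U x) (U y) < e) ->
  cvg (U r @[r --> +oo]).
Proof.
move=> H; apply: cauchy_cvg; apply: cauchy_exP => e e0.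
have [x Hx] := H e e0; exists (U x), x; split => [|y xy]; first exact: num_real.
by rewrite /= ballEmdist/=; apply: Hx; exact: ltW.
Qed.

End curve_limit.

Definition eval_curve {R : realType} {S : completeMetricType R} (U : R -> S)
    (t : \bar R) : S :=
  match t with
  | r%:E => U r
  | +oo%E => lim (U r @[r --> +oo])
  | -oo%E => point
  end.

Section endpoint.
Context {R : realType} {S : completeMetricType R}.
Local Notation mu := (@lebesgue_measure R).
Variables (f : S -> \bar R) (p0 : R).
Hypothesis f_gtNy : forall v, (-oo < f v)%E.
Hypothesis f_convex : pl_convex f p0 0.
Hypothesis f_lsc : lower_semicontinuous f.
Variables (p p' : R) (U : R -> S).
Hypothesis (p1 : 1 < p) (p'1 : 1 < p').
Hypothesis flow : slope_flow f (conj_exponent p) U.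
Implicit Types (s t x y : R).

Local Notation T := (stop_time f +oo U).
Local Notation clock := (clock f (conj_exponent p) (conj_exponent p') U).
Local Notation S' := (S_star f p p' +oo U).

Let q1 : 1 < conj_exponent p. Proof. exact: conj_exponent_gt1. Qed.
Let q'1 : 1 < conj_exponent p'. Proof. exact: conj_exponent_gt1. Qed.

Lemma clock_dist_S c x y : S' = c%:E -> 0 < x -> x <= y -> (y%:E < T)%E ->
  mdist (U x) (U y) <= (c - clock x) * slope f U x `^ (conj_exponent p' - 1).
Proof.
move=> Sc x0 xy yT.
apply: le_trans (clock_dist f_gtNy f_convex f_lsc q1 q'1 flow x0 xy yT) _.
apply: ler_wpM2r; first exact: powR_ge0.
have y0 := lt_le_trans x0 xy.
have := clock_lt_S f_gtNy f_convex f_lsc p1 p'1 flow (ltW y0) yT.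
by rewrite Sc lte_fin => /ltW cy; rewrite lerD2r.
Qed.

Lemma clock_near_S c e : S' = c%:E -> (0%:E < T)%E -> 0 < e ->
  exists b, [/\ 0 <= b, (b%:E < T)%E & c - clock b < e].
Proof.
move=> Sc T0 e0.
have c0 : 0 < c.
  have := clock_lt_S f_gtNy f_convex f_lsc p1 p'1 flow (lexx 0) T0.
  by rewrite clock0// Sc lte_fin.
have [d [d0 dc ce]] : exists d, [/\ 0 <= d, d < c & c - d < e].
  have H1 : c - e / 2 <= Num.max 0 (c - e / 2) by rewrite le_max lexx orbT.
  have H2 : Num.max 0 (c - e / 2) < c by rewrite gt_max c0/=; lra.
  by exists (Num.max 0 (c - e / 2)); split; [rewrite le_max lexx|exact: H2|lra].
rewrite -lte_fin -Sc in dc.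
have [b [b0 bT db]] := clock_cofinal f_gtNy f_convex f_lsc p1 p'1 flow d0 dc.
by exists b; split => //; lra.
Qed.

(** After time x the curve stays within distance (S* - clock x) g(x)^(q' - 1)
    of U x, and S* - clock x tends to 0, while g is bounded after time 1. *)
Lemma flow_is_cvg c : T = +oo%E -> S' = c%:E -> cvg (U r @[r --> +oo]).
Proof.
move=> Too Sc; apply: curve_is_cvg => e e0.
have ltT x : (x%:E < T)%E by rewrite Too ltry.
have [A AE] : exists A, A = slope f U 1 `^ (conj_exponent p' - 1) + 1 by eexists.
have A0 : 0 < A by rewrite AE ltr_wpDl// powR_ge0.
have eA : 0 < e / A by rewrite divr_gt0.
have [b [b0 bT be]] := clock_near_S Sc (ltT 0) eA.
have x1 : 1 <= Num.max b 1 by rewrite le_max lexx orbT.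
have xb : b <= Num.max b 1 by rewrite le_max lexx.
exists (Num.max b 1) => y; move: (Num.max b 1) x1 xb => x x1 xb xy.
have x0 : 0 < x := lt_le_trans ltr01 x1.
apply: le_lt_trans (clock_dist_S Sc x0 xy (ltT y)) _.
have cbx := clock_le f_gtNy f_convex f_lsc q1 q'1 flow b0 xb (ltT x).
have gA : slope f U x `^ (conj_exponent p' - 1) <= A.
  apply: (@le_trans _ _ (slope f U 1 `^ (conj_exponent p' - 1))); last by rewrite AE lerDl.
  apply: ge0_ler_powR; rewrite ?nnegrE ?slope_ge0 ?subr_ge0 ?(ltW q'1)//.
  exact: (flow_slope_le flow ltr01 x1).
have cx : 0 <= c - clock x.
  have := clock_lt_S f_gtNy f_convex f_lsc p1 p'1 flow (ltW x0) (ltT x).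
  by rewrite Sc lte_fin => /ltW; rewrite subr_ge0.
apply: (@le_lt_trans _ _ ((c - clock x) * A)); first exact: (ler_wpM2l cx gA).
by rewrite -(ltr_pdivlMr _ _ A0); apply: le_lt_trans be; rewrite lerD2l lerN2.
Qed.

Lemma flow_limit_le z t : T = +oo%E -> U r @[r --> +oo] --> z -> 0 <= t ->
  (f z <= f (U t))%E.
Proof.
move=> Too Uz t0.
have ft := domain_fin_num f_gtNy (flow_fin flow t0).
rewrite leNgt -(fineK ft); apply/negP => /f_lsc[V /nbhs_ballP[e /= e0 eV] HV].
have [x Hx] := (curve_cvg_dist U z).1 Uz e e0.
have xm : x <= Num.max x t by rewrite le_max lexx.
have tm : t <= Num.max x t by rewrite le_max lexx orbT.
move: (Num.max x t) xm tm => y xy ty.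
have : ((fine (f (U t)))%:E < f (U y))%E.
  by apply: HV; apply: eV; rewrite ballEmdist/=; exact: Hx.
have fy := domain_fin_num f_gtNy (flow_fin flow (le_trans t0 ty)).
rewrite -(fineK fy) lte_fin ltNge => /negP; apply.
exact: (flow_energy_le f_gtNy flow t0 ty).
Qed.

(** The energy at the limit is finite, so (y - 1) g(y)^q stays bounded as y
    grows: the slope tends to 0 along the curve, and lower semicontinuity
    carries this to the limit. *)
Lemma flow_limit_slope z : T = +oo%E -> U r @[r --> +oo] --> z ->
  local_slope f z = 0%E.
Proof.
move=> Too Uz; apply/eqP; rewrite eq_le local_slope_ge0 andbT leNgt.
apply/negP => sz.
have fz0 : (f z < +oo)%E.
  exact: le_lt_trans (flow_limit_le Too Uz (lexx 0)) (flow_fin flow (lexx 0)).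
have [k [k0 kz]] : exists k : R, 0 < k /\ (k%:E < local_slope f z)%E.
  move: sz; case: (local_slope f z) => [l||//]; last first.
    by move=> _; exists 1; rewrite ltry.
  by rewrite lte_fin => l0; exists (l / 2); rewrite divr_gt0// lte_fin; split=> //; lra.
have [d d0 Hd] := local_slope_lsc f_gtNy f_convex f_lsc (ltW k0) fz0 kz.
have [x Hx] := (curve_cvg_dist U z).1 Uz d d0.
have q0 : 0 < conj_exponent p := lt_trans ltr01 q1.
have kq : 0 < k `^ conj_exponent p by rewrite powR_gt0.
have [C CE] : exists C, C = energy f U 1 - fine (f z) by eexists.
have fz := domain_fin_num f_gtNy fz0.
have bound y : 1 < y -> x <= y -> (y - 1) * k `^ conj_exponent p <= C.
  move=> y1 xy; have y0 : 0 < y := lt_trans ltr01 y1.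
  have := flow_energy flow ltr01 (ltW y1).
  have : energy f U 1 - energy f U y <= C.
    rewrite CE lerD2l lerN2 -lee_fin fineK// /energy.
    rewrite (fineK (domain_fin_num f_gtNy (flow_fin flow (ltW y0)))).
    exact: (flow_limit_le Too Uz (ltW y0)).
  have : (y - 1) * k `^ conj_exponent p <= (y - 1) * slope f U y `^ conj_exponent p.
    apply: ler_wpM2l; first by rewrite subr_ge0 ltW.
    apply: ge0_ler_powR; rewrite ?nnegrE ?slope_ge0 ?(ltW q0) ?(ltW k0)//.
    rewrite -lee_fin -(flow_slopeE flow y0); apply: ltW; apply: Hd; exact: Hx.
  by move=> a b c; apply: le_trans a (le_trans c b).
have [y [y1 xy yC]] : exists y, [/\ 1 < y, x <= y & C / k `^ conj_exponent p < y - 1].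
  move: (C / _) => D.
  exists (2 + `|x| + `|D|); have := ler_norm x; have := ler_norm D.
  by have := normr_ge0 x; have := normr_ge0 D; split; lra.
by have := bound y y1 xy; rewrite leNgt -ltr_pdivrMr// yC.
Qed.

(** The speed bound vanishes with the slope; when T = 0 it applies after
    positive times only, and continuity at 0 does the rest. *)
Lemma flow_after_stop c s : T = c%:E -> c <= s -> U s = U c.
Proof.
move=> Tc cs; have c0 : 0 <= c by have := stop_ge0 f U; rewrite Tc lee_fin.
have const x y : 0 < x -> c <= x -> x <= y -> mdist (U x) (U y) <= 0.
  move=> x0 cx xy; have := flow_speed flow x0 xy; rewrite /slope.
  rewrite (stop_slope0 f_gtNy f_convex f_lsc flow (ltW x0)); last by rewrite Tc lee_fin.
  by rewrite powR0 ?mulr0// gt_eqF// subr_gt0.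
apply/esym/mdist_positivity/eqP; rewrite eq_le mdist_ge0 andbT.
have [cE|cn0] := eqVneq 0 c; last first.
  by apply: const (lexx _) cs; rewrite lt_neqAle cn0.
rewrite -cE in cs const *; have [<-|sn0] := eqVneq 0 s; first by rewrite mdistxx.
have s0 : 0 < s by rewrite lt_neqAle sn0.
apply/ler_addgt0Pr => e e0; rewrite add0r.
have [d d0 Hd] := flow_cont0 flow e0.
have [x [x0 xd xs _]] := exists_lt3 d0 s0 ltr01.
apply: le_trans (metric_triangle _ (U x) _) _; rewrite -[leRHS]addr0.
by apply: lerD; [exact: (Hd _ (ltW x0) xd)|exact: (const _ _ x0 (ltW x0) (ltW xs))].
Qed.

(** What a time change of U requires of the point z at which it stays once the
    new time has run out, whether z is U T or the limit of U at infinity. *)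
Record flow_endpoint (z : S) : Prop := FlowEndpoint {
  endpoint_dom : (f z < +oo)%E ;
  endpoint_slope : local_slope f z = 0%E ;
  endpoint_le : forall t, 0 <= t -> (t%:E < T)%E -> (f z <= f (U t))%E ;
  endpoint_dist : forall t, 0 < t -> (t%:E < T)%E ->
    mdist (U t) z <=
      (fine S' - clock t) * slope f U t `^ (conj_exponent p' - 1) ;
  endpoint_start : T = 0%E -> z = U 0 }.

Lemma stop_flow_endpoint c d : T = c%:E -> S' = d%:E -> flow_endpoint (U c).
Proof.
move=> Tc Sd; have c0 : 0 <= c by have := stop_ge0 f U; rewrite Tc lee_fin.
split.
- exact: (flow_fin flow c0).
- by apply: (stop_slope0 f_gtNy f_convex f_lsc flow c0); rewrite Tc.
- move=> t t0; rewrite Tc lte_fin => /ltW tc.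
  rewrite -(fineK (domain_fin_num f_gtNy (flow_fin flow c0))).
  rewrite -(fineK (domain_fin_num f_gtNy (flow_fin flow t0))) lee_fin.
  exact: (flow_energy_le f_gtNy flow t0 tc).
- move=> t t0; rewrite Tc lte_fin => tc; rewrite Sd /=.
  apply/ler_addgt0Pr => e e0.
  have [A [A1 gA]] : exists A, 0 < A /\ slope f U t `^ (conj_exponent p - 1) <= A.
    exists (slope f U t `^ (conj_exponent p - 1) + 1).
    by rewrite ltr_wpDl// ?powR_ge0// lerDl.
  have eA : 0 < e / A by rewrite divr_gt0.
  have tc0 : 0 < c - t by rewrite subr_gt0.
  have [h [h0 hA ht _]] := exists_lt3 eA tc0 ltr01.
  have ty : t <= c - h by lra.
  have y0 : 0 < c - h := lt_le_trans t0 ty.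
  have yc : c - h <= c by lra.
  have yT : ((c - h)%:E < T)%E by rewrite Tc lte_fin; lra.
  apply: le_trans (metric_triangle _ (U (c - h)) _) _; apply: lerD.
    exact: (clock_dist_S Sd t0 ty yT).
  apply: le_trans (flow_speed flow y0 yc) _.
  have -> : c - (c - h) = h by lra.
  apply: (@le_trans _ _ (h * A)); last by rewrite -(ler_pdivlMr _ _ A1) ltW.
  apply: ler_wpM2l; first exact: ltW.
  apply: le_trans gA; apply: ge0_ler_powR; rewrite ?nnegrE ?slope_ge0//.
    by rewrite subr_ge0 ltW.
  exact: (flow_slope_le flow t0 ty).
by rewrite Tc => -[->].
Qed.

Lemma limit_flow_endpoint d z : T = +oo%E -> S' = d%:E ->
  U r @[r --> +oo] --> z -> flow_endpoint z.
Proof.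
move=> Too Sd Uz; have ltT x : (x%:E < T)%E by rewrite Too ltry.
split.
- exact: le_lt_trans (flow_limit_le Too Uz (lexx 0)) (flow_fin flow (lexx 0)).
- exact: (flow_limit_slope Too Uz).
- by move=> t t0 _; exact: (flow_limit_le Too Uz t0).
- move=> t t0 _; rewrite Sd /=; apply/ler_addgt0Pr => e e0.
  have [x Hx] := (curve_cvg_dist U z).1 Uz e e0.
  have xm : x <= Num.max x t by rewrite le_max lexx.
  have tm : t <= Num.max x t by rewrite le_max lexx orbT.
  move: (Num.max x t) xm tm => y xy ty.
  apply: le_trans (metric_triangle _ (U y) _) _; apply: lerD.
    exact: (clock_dist_S Sd t0 ty (ltT y)).
  by rewrite metric_sym; apply: ltW; exact: Hx.
by rewrite Too.
Qed.

Lemma eval_flow_endpoint d : S' = d%:E -> flow_endpoint (eval_curve U T).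
Proof.
move=> Sd; have T0 := stop_ge0 f U.
case TE : T T0 => [c||] T0; last by rewrite leeNy_eq in T0.
  exact: stop_flow_endpoint TE Sd.
exact: limit_flow_endpoint TE Sd (flow_is_cvg TE Sd).
Qed.

End endpoint.

(** * The time change maps slope flows to slope flows *)

Section reparametrization.
Context {R : realType} {S : completeMetricType R}.
Local Notation mu := (@lebesgue_measure R).
Variables (f : S -> \bar R) (p0 : R).
Hypothesis f_gtNy : forall v, (-oo < f v)%E.
Hypothesis f_convex : pl_convex f p0 0.
Hypothesis f_lsc : lower_semicontinuous f.
Variables (p p' : R) (U V : R -> S).
Hypothesis (p1 : 1 < p) (p'1 : 1 < p').
Hypothesis flow : slope_flow f (conj_exponent p) U.
Implicit Types (s t x y : R).

Local Notation T := (stop_time f +oo U).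
Local Notation clock := (clock f (conj_exponent p) (conj_exponent p') U).
Local Notation S' := (S_star f p p' +oo U).

Hypothesis V_before : forall t, 0 <= t -> (t%:E < T)%E -> V (clock t) = U t.
Hypothesis V_after : forall s, 0 <= s -> (S' <= s%:E)%E -> V s = eval_curve U T.

Let q1 : 1 < conj_exponent p. Proof. exact: conj_exponent_gt1. Qed.
Let q'1 : 1 < conj_exponent p'. Proof. exact: conj_exponent_gt1. Qed.
Let q'0 : 0 < conj_exponent p'. Proof. exact: lt_trans ltr01 q'1. Qed.

(** Before S* the curve V takes the values of U before T, and after S* it sits
    at a final point of U; all properties of V are checked on these two cases. *)
Lemma time_change_cases s : 0 <= s ->
  (exists t, [/\ 0 <= t, (t%:E < T)%E, clock t = s & V s = U t]) \/
  [/\ (S' <= s%:E)%E, fine S' <= s & flow_endpoint f p p' U (V s)].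
Proof.
move=> s0; have [sS|Ss] := ltP s%:E S'.
  left; have [t [t0 tT ts]] := clock_surj f_gtNy f_convex f_lsc p1 p'1 flow s0 sS.
  by exists t; split => //; rewrite -ts V_before.
right; have S0 : (0 <= S')%E.
  by rewrite /S_star; apply: integral_ge0 => r _; rewrite lee_fin powR_ge0.
have [d Sd] : exists d, S' = d%:E by move: S0 Ss; case: S' => // d _ _; exists d.
rewrite (V_after s0 Ss); split => //; first by move: Ss; rewrite Sd lee_fin.
exact: (eval_flow_endpoint f_gtNy f_convex f_lsc p1 p'1 flow Sd).
Qed.

Lemma clock_inj_le x y : 0 <= x -> (x%:E < T)%E -> clock x <= clock y ->
  0 <= y -> (y%:E < T)%E -> x <= y.
Proof.
move=> x0 xT cxy y0 yT; rewrite leNgt; apply/negP => yx.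
have := clock_lt f_gtNy f_convex f_lsc q1 q'1 flow y0 yx xT.
by rewrite ltNge cxy.
Qed.

Lemma clock_gt0 t : 0 < clock t -> 0 < t.
Proof. by rewrite !ltNge; apply: contra => t0; rewrite clock0. Qed.

Lemma before_after s t : 0 <= s -> s <= t -> (S' <= s%:E)%E -> V t = V s.
Proof.
move=> s0 st Ss; rewrite !V_after//; first exact: le_trans s0 st.
by rewrite (le_trans Ss)// lee_fin.
Qed.

Lemma time_change_start : V 0 = U 0.
Proof.
have [[t [t0 tT ct ->]]|[S0 _ ep]] := time_change_cases (lexx 0).
  congr U; apply/eqP; rewrite eq_le t0 andbT; apply: clock_inj_le => //.
    by rewrite ct clock0.
  exact: lt_stop t0 tT.
apply: (endpoint_start ep); apply/eqP; rewrite eq_le stop_ge0 andbT leNgt.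
apply/negP => T0.
have := clock_lt_S f_gtNy f_convex f_lsc p1 p'1 flow (lexx 0) T0.
by rewrite clock0// ltNge S0.
Qed.

Lemma time_change_le s : 0 <= s -> (f (V s) <= f (U 0%R))%E.
Proof.
move=> s0; have [[t [t0 tT ct ->]]|[Ss _ ep]] := time_change_cases s0.
  exact: (flow_start flow t0).
have [T0|T0] := ltP 0%E T; first exact: (endpoint_le ep (lexx 0) T0).
by rewrite (endpoint_start ep)//; apply/eqP; rewrite eq_le T0 stop_ge0.
Qed.

Lemma time_change_slope_noninc s t : 0 <= s -> s <= t ->
  (local_slope f (V t) <= local_slope f (V s))%E.
Proof.
move=> s0 st; have t0 := le_trans s0 st.
have [[y [y0 yT cy ->]]|[_ _ ep]] := time_change_cases t0; last first.
  by rewrite (endpoint_slope ep) local_slope_ge0.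
have [[x [x0 xT cx ->]]|[Ss _ _]] := time_change_cases s0; last first.
  exfalso; have := clock_lt_S f_gtNy f_convex f_lsc p1 p'1 flow y0 yT.
  by rewrite cy ltNge (le_trans Ss)// lee_fin.
apply: (flow_slope_noninc flow) => //.
by apply: clock_inj_le => //; rewrite cx cy.
Qed.

(** In the new time the bounds clock_energy and clock_dist are the bounds
    required of a flow with exponent q'; at the final point the slope is 0 and
    the endpoint estimates take over. *)
Lemma time_change_flow : slope_flow f (conj_exponent p') V.
Proof.
split.
- rewrite time_change_start; exact: (flow_dom flow).
- by move=> t t0; rewrite time_change_start; exact: time_change_le.
- exact: time_change_slope_noninc.
- move=> s s0; have [[t [t0 tT ct ->]]|[_ _ ep]] := time_change_cases (ltW s0).
    by apply: (flow_slope_fin flow); apply: clock_gt0; rewrite ct.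
  by rewrite (endpoint_slope ep) ltry.
- move=> s t s0 st; have t0 := lt_le_trans s0 st.
  have [[x [x0 xT cx Vx]]|[Ss _ ep]] := time_change_cases (ltW s0); last first.
    rewrite /energy (before_after (ltW s0) st Ss) subrr.
    rewrite /slope (before_after (ltW s0) st Ss) (endpoint_slope ep).
    by rewrite powR0 ?mulr0// gt_eqF.
  have x_gt0 : 0 < x by apply: clock_gt0; rewrite cx.
  have [[y [y0 yT cy Vy]]|[_ _ ep]] := time_change_cases (ltW t0).
    have xy : x <= y by apply: clock_inj_le => //; rewrite cx cy.
    have := clock_energy f_gtNy f_convex f_lsc q1 q'1 flow x_gt0 xy yT.
    by rewrite cx cy /energy /slope Vx Vy.
  rewrite /slope (endpoint_slope ep) powR0 ?gt_eqF// mulr0 subr_ge0.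
  rewrite -lee_fin /energy Vx (fineK (domain_fin_num f_gtNy (endpoint_dom ep))).
  rewrite (fineK (domain_fin_num f_gtNy (flow_fin flow x0))).
  exact: (endpoint_le ep x0 xT).
- move=> s t s0 st; have t0 := lt_le_trans s0 st.
  have [[x [x0 xT cx Vx]]|[Ss _ ep]] := time_change_cases (ltW s0); last first.
    rewrite (before_after (ltW s0) st Ss) mdistxx.
    by rewrite mulr_ge0 ?powR_ge0// subr_ge0.
  have x_gt0 : 0 < x by apply: clock_gt0; rewrite cx.
  have [[y [y0 yT cy Vy]]|[_ St ep]] := time_change_cases (ltW t0).
    have xy : x <= y by apply: clock_inj_le => //; rewrite cx cy.
    have := clock_dist f_gtNy f_convex f_lsc q1 q'1 flow x_gt0 xy yT.
    by rewrite cx cy /slope Vx Vy.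
  have := endpoint_dist ep x_gt0 xT; rewrite Vx => /le_trans; apply.
  rewrite /slope Vx cx; apply: ler_wpM2r; first exact: powR_ge0.
  by rewrite lerD2r.
move=> e e0; rewrite time_change_start.
have [T0|T0] := ltP 0%E T; last first.
  exists 1 => // s s0 _; have [[t [t0 tT _ _]]|[_ _ ep]] := time_change_cases s0.
    by exfalso; have := lt_le_trans tT T0; rewrite lte_fin ltNge t0.
  have TE : T = 0%E by apply/eqP; rewrite eq_le T0 stop_ge0.
  by rewrite (endpoint_start ep TE) mdistxx ltW.
have [d d0 Hd] := flow_cont0 flow e0.
have [t' t'0 t'T] := stop_between T0.
have [b [b0 bd bt _]] := exists_lt3 d0 t'0 ltr01.
have bT : (b%:E < T)%E by exact: lt_stop (ltW bt) t'T.
exists (clock b).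
  rewrite -(clock0 f (conj_exponent p) (conj_exponent p') U (lexx 0)).
  exact: (clock_lt f_gtNy f_convex f_lsc q1 q'1 flow (lexx 0) b0 bT).
move=> s s0 sb; have [[t [t0 tT ct ->]]|[Ss _ _]] := time_change_cases s0.
  apply: Hd => //; apply: le_lt_trans bd; apply: clock_inj_le => //.
  - by rewrite ct ltW.
  - exact: ltW.
exfalso; have := clock_lt_S f_gtNy f_convex f_lsc p1 p'1 flow (ltW b0) bT.
by rewrite ltNge (le_trans Ss)// lee_fin ltW.
Qed.

End reparametrization.

(** * The two time changes are inverse to each other *)

Local Opaque clock conj_exponent.

Section comparison.
Context {R : realType}.
Implicit Types (a b c w D E m x y z : R).

Lemma ereal_cut_eq (A B : \bar R) : (0 <= A)%E -> (0 <= B)%E ->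
  (forall t : R, 0 <= t -> (t%:E < A)%E <-> (t%:E < B)%E) -> A = B.
Proof.
move=> A0 B0 AB; apply/eqP; rewrite eq_le !leNgt; apply/andP; split; apply/negP.
  move: B B0 AB => [b||] B0 AB // bA; last by move: bA; rewrite ltNge leey.
  by have := (AB b B0).1 bA; rewrite ltxx.
move: A A0 AB => [a||] A0 AB // aB; last by move: aB; rewrite ltNge leey.
by have := (AB a A0).2 aB; rewrite ltxx.
Qed.

Lemma between_norm_add a b c : Num.min a c <= b <= Num.max a c ->
  `|c - b| + `|b - a| <= `|c - a|.
Proof.
have [ac|/ltW ca] := leP a c => /andP[h1 h2]; first exact: noninc_norm_add.
rewrite (distrC c b) (distrC b a) (distrC c a) addrC.
exact: noninc_norm_add.
Qed.

Lemma between_norm_add_div m a b c : Num.min a c <= b <= Num.max a c ->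
  `|c / m - b / m| + `|b / m - a / m| <= `|c / m - a / m|.
Proof.
move=> /between_norm_add H; rewrite -!mulrBl !normrM -mulrDl.
by apply: ler_wpM2r.
Qed.

Lemma additive_gap a b c x y z :
  c - a - (z - x) = (b - a - (y - x)) + (c - b - (z - y)).
Proof. lra. Qed.

Lemma additive_gap' a b c x y z :
  z - x - (c - a) = (y - x - (b - a)) + (z - y - (c - b)).
Proof. lra. Qed.

Lemma shift_eq a b x y : a - b = y - x -> b = x + (a - y).
Proof. lra. Qed.

(** Over a time w a first clock advances by D at a rate between a and b, and
    over the time D a second clock advances by E at a rate between the
    inverses of a and b: then E differs from w by a second order term. *)
Lemma inverse_rates a b a' b' m w D E : a' = a^-1 -> b' = b^-1 ->
  0 < m -> m <= a -> m <= b -> 0 <= w ->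
  w * Num.min b a <= D <= w * Num.max b a ->
  D * Num.min b' a' <= E <= D * Num.max b' a' ->
  `|E - w| <= w * `|a / m - b / m|.
Proof.
move=> -> ->; rewrite (distrC (a / m)) (minC b) (maxC b) (minC b^-1) (maxC b^-1).
wlog ab : a b / a <= b.
  move=> H m0 ma mb w0 h1 h2; have [ab|/ltW ba] := leP a b; first exact: H.
  rewrite (distrC (b / m)); rewrite minC maxC in h1; rewrite minC maxC in h2.
  exact: H ba m0 mb ma w0 h1 h2.
move=> m0 ma mb w0; have a0 := lt_le_trans m0 ma; have b0 := lt_le_trans m0 mb.
have iab : b^-1 <= a^-1 by rewrite lef_pV2 ?posrE.
rewrite (min_idPl ab) (max_idPr ab) (min_idPr iab) (max_idPl iab).
move=> /andP[D1 D2] /andP[E1 E2].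
have bam : 0 <= (b - a) / m by rewrite divr_ge0 ?subr_ge0// ltW.
rewrite -mulrBl (ger0_norm bam) ler_norml.
have H c : 0 < c -> m <= c -> w * ((b - a) / c) <= w * ((b - a) / m).
  move=> c0 mc; apply: ler_wpM2l => //; apply: ler_wpM2l; first by rewrite subr_ge0.
  by rewrite lef_pV2 ?posrE.
have Ha := H a a0 ma; have Hb := H b b0 mb.
have Da : D / a <= w * b / a by rewrite ler_pM2r ?invr_gt0.
have Db : w * a / b <= D / b by rewrite ler_pM2r ?invr_gt0.
have Ea : w * ((b - a) / a) = w * b / a - w by rewrite mulrBl divff ?gt_eqF// mulrBr mulr1 mulrA.
have Eb : w * ((b - a) / b) = w - w * a / b by rewrite mulrBl divff ?gt_eqF// mulrBr mulr1 mulrA.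
rewrite Ea in Ha; rewrite Eb in Hb.
by apply/andP; split; lra.
Qed.

End comparison.

Section round_trip.
Context {R : realType} {S : completeMetricType R}.
Local Notation mu := (@lebesgue_measure R).
Variables (f : S -> \bar R) (p0 : R).
Hypothesis f_gtNy : forall v, (-oo < f v)%E.
Hypothesis f_convex : pl_convex f p0 0.
Hypothesis f_lsc : lower_semicontinuous f.
Variables (p p' : R) (U V : R -> S).
Hypothesis (p1 : 1 < p) (p'1 : 1 < p').
Hypothesis flow : slope_flow f (conj_exponent p) U.
Implicit Types (s t x y : R).

Local Notation T := (stop_time f +oo U).
Local Notation clockV := (clock f (conj_exponent p') (conj_exponent p) V).
Local Notation clock := (clock f (conj_exponent p) (conj_exponent p') U).
Local Notation S' := (S_star f p p' +oo U).
Local Notation G t := (slope f U t `^ (conj_exponent p - conj_exponent p')).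

Hypothesis V_before : forall t, 0 <= t -> (t%:E < T)%E -> V (clock t) = U t.
Hypothesis V_after : forall s, 0 <= s -> (S' <= s%:E)%E -> V s = eval_curve U T.

Let q1 : 1 < conj_exponent p. Proof. exact: conj_exponent_gt1. Qed.
Let q'1 : 1 < conj_exponent p'. Proof. exact: conj_exponent_gt1. Qed.

Let flowV : slope_flow f (conj_exponent p') V.
Proof. exact: (time_change_flow f_gtNy f_convex f_lsc p1 p'1 flow V_before V_after). Qed.

Let cases s (s0 : 0 <= s) :=
  time_change_cases f_gtNy f_convex f_lsc p1 p'1 flow V_before V_after s0.

Lemma S_star_ge0 : (0 <= S')%E.
Proof. by rewrite /S_star; apply: integral_ge0 => r _; rewrite lee_fin powR_ge0. Qed.

Lemma stop_time_change : stop_time f +oo V = S'.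
Proof.
apply: ereal_cut_eq; [exact: stop_ge0|exact: S_star_ge0|move=> s s0].
rewrite (stop_ltP f_gtNy f_convex f_lsc flowV s0).
have [[t [t0 tT <- ->]]|[Ss _ ep]] := cases s0.
  split => _; first exact: (clock_lt_S f_gtNy f_convex f_lsc p1 p'1 flow).
  by rewrite -(stop_ltP f_gtNy f_convex f_lsc flow t0).
by rewrite (endpoint_slope ep) ltxx ltNge Ss.
Qed.

Let clock_ltT t : 0 <= t -> (t%:E < T)%E -> ((clock t)%:E < stop_time f +oo V)%E.
Proof.
move=> t0 tT; rewrite stop_time_change.
exact: (clock_lt_S f_gtNy f_convex f_lsc p1 p'1 flow t0 tT).
Qed.

Let clock_pos t : 0 < t -> (t%:E < T)%E -> 0 < clock t.
Proof.
move=> t0 tT; rewrite -(clock0 f (conj_exponent p) (conj_exponent p') U (lexx 0)).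
exact: (clock_lt f_gtNy f_convex f_lsc q1 q'1 flow (lexx 0) t0 tT).
Qed.

Let mono x y : 0 <= x -> x <= y -> (y%:E < T)%E -> clock x <= clock y.
Proof. exact: (clock_le f_gtNy f_convex f_lsc q1 q'1 flow). Qed.

Let slopeV t : 0 <= t -> (t%:E < T)%E ->
  slope f V (clock t) `^ (conj_exponent p' - conj_exponent p) = (G t)^-1.
Proof. by move=> t0 tT; rewrite /slope V_before// -powRN opprB. Qed.

Let rates a b x y : 0 < a -> a <= x -> x <= y -> y <= b -> (b%:E < T)%E ->
  `|(clockV (clock y) - clockV (clock x)) - (y - x)| <=
  (y - x) * `|G x / Num.min (G b) (G a) - G y / Num.min (G b) (G a)|.
Proof.
move=> a0 ax xy yb bT.
have x0 := lt_le_trans a0 ax; have y0 := lt_le_trans x0 xy; have b0 := lt_le_trans y0 yb.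
have yT := lt_stop yb bT; have xT := lt_stop xy yT.
have gpos t : 0 < t -> (t%:E < T)%E -> 0 < slope f U t.
  by move=> t0 tT; exact: (slope_gt0 f_gtNy f_convex f_lsc flow t0 tT).
have btw t : a <= t -> t <= b -> Num.min (G b) (G a) <= G t.
  move=> at_ tb; have t0 := lt_le_trans a0 at_.
  have [] := andP (powR_between (conj_exponent p - conj_exponent p') (gpos b b0 bT)
    (flow_slope_le flow t0 tb) (flow_slope_le flow a0 at_)).
  by [].
apply: (inverse_rates (D := clock y - clock x) (slopeV (ltW x0) xT)
  (slopeV (ltW y0) yT)).
- rewrite lt_min; apply/andP; split; apply: powR_gt0; first exact: gpos.
  exact: gpos a0 (lt_stop (le_trans ax (le_trans xy yb)) bT).
- exact: btw ax (le_trans xy yb).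
- exact: btw (le_trans ax xy) yb.
- by rewrite subr_ge0.
- exact: (clock_bounds f_gtNy f_convex f_lsc q1 q'1 flow x0 xy yT).
have := clock_bounds f_gtNy f_convex f_lsc q'1 q1 flowV (clock_pos x0 xT)
  (mono (ltW x0) xy yT) (clock_ltT (ltW y0) yT).
exact.
Qed.

(** The second clock runs at the rate g^(q' - q), inverse to the rate g^(q -
    q') of the first one; both are monotone in time, so that inverse_rates
    feeds subadditive_le0, with g^(q - q') divided by its minimum on [a, b] as
    the control. *)
Lemma clock_inverse_diff a b : 0 < a -> a <= b -> (b%:E < T)%E ->
  clockV (clock b) - clockV (clock a) = b - a.
Proof.
move=> a0 ab bT; have b0 := lt_le_trans a0 ab.
have [K KE] : exists K : R -> R, forall t, K t = G t / Num.min (G b) (G a).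
  by exists (fun t => G t / Num.min (G b) (G a)).
have Kadd x y z : a <= x -> x <= y -> y <= z -> z <= b ->
    `|K x - K y| + `|K y - K z| <= `|K x - K z|.
  move=> ax xy yz zb; have x0 := lt_le_trans a0 ax; have y0 := lt_le_trans x0 xy.
  have z0 := lt_le_trans y0 yz.
  rewrite !KE; apply: between_norm_add_div; apply: powR_between.
  - exact: (slope_gt0 f_gtNy f_convex f_lsc flow z0 (lt_stop zb bT)).
  - exact: (flow_slope_le flow y0 yz).
  - exact: (flow_slope_le flow x0 xy).
have Krate x y : a <= x -> x <= y -> y <= b ->
    `|(clockV (clock y) - clockV (clock x)) - (y - x)| <= (y - x) * `|K x - K y|.
  by move=> ax xy yb; rewrite !KE; exact: (rates a0 ax xy yb bT).
apply/eqP; rewrite eq_le; apply/andP; split; rewrite -subr_le0.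
  apply: (subadditive_le0 (delta := fun x y =>
    (clockV (clock y) - clockV (clock x)) - (y - x)) (K := K)); [exact: ab| |exact: Kadd|].
    by move=> x y z _ _ _ _; rewrite -additive_gap.
  by move=> x y ax xy yb; apply: le_trans (Krate x y ax xy yb); exact: ler_norm.
apply: (subadditive_le0 (delta := fun x y =>
  (y - x) - (clockV (clock y) - clockV (clock x))) (K := K)); [exact: ab| |exact: Kadd|].
  by move=> x y z _ _ _ _; rewrite -additive_gap'.
move=> x y ax xy yb; apply: le_trans (Krate x y ax xy yb).
by rewrite distrC; exact: ler_norm.
Qed.

(** By clock_inverse_diff the composite of the clocks is t + c with c
    constant. A negative c contradicts the nonnegativity of the clock as t
    tends to 0, and a positive c would make the clock of V jump from 0 to c at
    time 0, against the intermediate value property. *)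
Lemma clock_inverse t : 0 <= t -> (t%:E < T)%E -> clockV (clock t) = t.
Proof.
move=> t0' tT; have [<-|tn0] := eqVneq 0 t; first by rewrite !clock0.
have t0 : 0 < t by rewrite lt_neqAle tn0.
have [c shift] : exists c, forall x, 0 < x -> x <= t -> clockV (clock x) = x + c.
  exists (clockV (clock t) - t) => x x0 xt.
  exact: shift_eq (clock_inverse_diff x0 xt tT).
suff c0 : c = 0 by rewrite (shift t)// c0 addr0.
apply/eqP; rewrite eq_le; apply/andP; split; rewrite leNgt; apply/negP => c0.
  have [c20 c2c] : 0 < c / 2 /\ c / 2 < c by lra.
  have c2t : c / 2 <= clockV (clock t).
    by rewrite (shift t t0 (lexx t)) (le_trans (ltW c2c))// lerDr ltW.
  have [s [s0 st] sc] := clock_ivt f_gtNy f_convex f_lsc q'1 q1 flowV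
    (ltW (clock_pos t0 tT)) (clock_ltT (ltW t0) tT) (ltW c20) c2t.
  have s_gt0 : 0 < s.
    rewrite ltNge; apply/negP => sle; move: c20.
    by rewrite -sc (clock0 _ _ _ _ sle) ltxx.
  have sS : (s%:E < S')%E by rewrite -stop_time_change; exact: lt_stop st (clock_ltT (ltW t0) tT).
  have [y [y0 yT ys]] := clock_surj f_gtNy f_convex f_lsc p1 p'1 flow s0 sS.
  have y_gt0 : 0 < y by have := s_gt0; rewrite -ys; exact: clock_gt0.
  have yt : y <= t.
    apply: (clock_inj_le f_gtNy f_convex f_lsc p1 p'1 flow y0 yT _ (ltW t0) tT).
    by rewrite ys.
  have := shift y y_gt0 yt; rewrite ys sc => cyc.
  by move: c2c; rewrite cyc ltNge lerDr ltW.
have nc : 0 < - c / 2 by rewrite divr_gt0// oppr_gt0.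
have [x [x0 xt xc _]] := exists_lt3 t0 nc ltr01.
have := clock_ge0 f (conj_exponent p') (conj_exponent p) V (clock x).
by rewrite (shift x x0 (ltW xt)); lra.
Qed.

Lemma S_star_change : S_star f p' p +oo V = T.
Proof.
apply: ereal_cut_eq; [|exact: stop_ge0|move=> t t0; split].
- by rewrite /S_star; apply: integral_ge0 => r _; rewrite lee_fin powR_ge0.
- move=> tS; have [s [s0 sT <-]] := clock_surj f_gtNy f_convex f_lsc p'1 p1 flowV t0 tS.
  rewrite stop_time_change in sT.
  have [y [y0 yT <-]] := clock_surj f_gtNy f_convex f_lsc p1 p'1 flow s0 sT.
  by rewrite clock_inverse.
move=> tT; rewrite -{1}(clock_inverse t0 tT).
apply: (clock_lt_S f_gtNy f_convex f_lsc p'1 p1 flowV); last exact: clock_ltT.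
exact: clock_ge0.
Qed.

(** When S* is infinite, V never stops, and converges to U c because it runs
    through the values of U just before c. *)
Lemma time_change_end c : T = c%:E -> eval_curve V S' = U c.
Proof.
move=> Tc; have T0 := S_star_ge0.
case SE : S' T0 => [d||] S0; last by rewrite leeNy_eq in S0.
  rewrite /eval_curve V_after ?Tc//; by rewrite SE.
rewrite /eval_curve.
apply: cvg_lim; first exact: metric_hausdorff.
apply/curve_cvg_dist => e e0.
have c0 : 0 < c.
  have [|t [t0 tT _]] := clock_surj f_gtNy f_convex f_lsc p1 p'1 flow ler01.
    by rewrite SE ltry.
  by rewrite Tc lte_fin in tT; exact: le_lt_trans tT.
have [A [A1 gA]] : exists A, 0 < A /\ slope f U (c / 2) `^ (conj_exponent p - 1) <= A.
  exists (slope f U (c / 2) `^ (conj_exponent p - 1) + 1).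
  by rewrite ltr_wpDl// ?powR_ge0// lerDl.
have eA : 0 < e / A by rewrite divr_gt0.
have c20 : 0 < c / 2 by rewrite divr_gt0.
have [h [h0 hA hc _]] := exists_lt3 eA c20 ltr01.
have b0 : 0 < c - h by lra.
have bT : ((c - h)%:E < T)%E by rewrite Tc lte_fin; lra.
exists (clock (c - h)) => s bs; have s0 := le_trans (ltW (clock_pos b0 bT)) bs.
have [[t [t0 tT ct ->]]|[+ _ _]] := cases s0; last by rewrite SE.
have bt : c - h <= t.
  apply: (clock_inj_le f_gtNy f_convex f_lsc p1 p'1 flow (ltW b0) bT _ t0 tT).
  by rewrite ct.
have t_gt0 : 0 < t := lt_le_trans b0 bt.
rewrite Tc lte_fin in tT.
rewrite metric_sym; apply: le_lt_trans (flow_speed flow t_gt0 (ltW tT)) _.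
apply: (@le_lt_trans _ _ (h * A)); last by rewrite -(ltr_pdivlMr _ _ A1).
apply: ler_pM; [by rewrite subr_ge0 ltW|exact: powR_ge0|by lra|].
apply: le_trans gA; apply: ge0_ler_powR; rewrite ?nnegrE ?slope_ge0//.
  by rewrite subr_ge0 ltW.
by apply: (flow_slope_le flow c20); lra.
Qed.

Lemma time_change_round_trip (W : R -> S) :
  (forall s, 0 <= s -> (s%:E < stop_time f +oo V)%E -> W (clockV s) = V s) ->
  (forall t, 0 <= t -> (S_star f p' p +oo V <= t%:E)%E ->
    W t = eval_curve V (stop_time f +oo V)) ->
  forall t, 0 <= t -> W t = U t.
Proof.
move=> W_before W_after t t0; have [tT|Tt] := ltP t%:E T.
  have := W_before _ (clock_ge0 _ _ _ _ t) (clock_ltT t0 tT).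
  by rewrite (clock_inverse t0 tT) (V_before t0 tT).
rewrite W_after ?S_star_change// stop_time_change.
have [c Tc] : exists c, T = c%:E.
  by move: (stop_ge0 f U) Tt; case: T => // c _ _; exists c.
rewrite (time_change_end Tc); rewrite Tc lee_fin in Tt.
by rewrite (flow_after_stop f_gtNy f_convex f_lsc p1 flow Tc Tt).
Qed.

End round_trip.

(** * The map Lambda *)

Section Lambda.
Context {R : realType} {S : completeMetricType R}.
Variables (f : S -> \bar R) (p0 : R).
Hypothesis f_gtNy : forall v, (-oo < f v)%E.
Hypothesis f_convex : pl_convex f p0 0.
Hypothesis f_lsc : lower_semicontinuous f.
Variable u0 : S.
Hypothesis u0_dom : effective_domain f u0.
Implicit Types (p : R) (u w : {nonneg R} -> S).

Lemma extend_inj u w : (forall t, 0 <= t -> extend u t = extend w t) -> u = w.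
Proof.
move=> uw; apply/funext => x; have x0 : 0 <= x%:num by [].
have E (v : {nonneg R} -> S) : extend v x%:num = v x.
  by rewrite /extend; congr v; apply/val_inj; rewrite /= ger0_norm.
by rewrite -(E u) -(E w); exact: uw x0.
Qed.

Lemma CMS_flow p u : 1 < p -> CMS f p u0 u ->
  slope_flow f (conj_exponent p) (extend u).
Proof.
move=> p1 [AC u00 ni H].
apply: (curve_slope_flow f_gtNy f_convex f_lsc p1 _ AC _ H).
  by rewrite u00; exact: u0_dom.
move=> s t s0 st; apply: ni => //; rewrite interval0y//.
exact: le_trans st.
Qed.

Lemma flow_CMS p u : 1 < p -> slope_flow f (conj_exponent p) (extend u) ->
  extend u 0 = u0 -> CMS f p u0 u.
Proof.
move=> p1 flow <-.
exact: (flow_max_slope_curve f_gtNy f_convex (conj_exponent_gt1 p1) flow p1 erefl).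
Qed.

Lemma extend_Lambda p p' u s : 0 <= s -> extend (Lambda f p p' u) s =
  eval_curve (extend u) (time_change f p p' (extend u) s).
Proof.
move=> s0; rewrite {1}/extend /Lambda /= ger0_norm//.
Qed.

Section one_curve.
Variables (p p' : R) (u : {nonneg R} -> S).
Hypothesis (p1 : 1 < p) (p'1 : 1 < p').
Hypothesis flow : slope_flow f (conj_exponent p) (extend u).

Lemma Lambda_before t : 0 <= t -> (t%:E < stop_time f +oo (extend u))%E ->
  extend (Lambda f p p' u)
    (clock f (conj_exponent p) (conj_exponent p') (extend u) t) = extend u t.
Proof.
move=> t0 tT; rewrite extend_Lambda; last exact: clock_ge0.
rewrite /time_change (clock_lt_S f_gtNy f_convex f_lsc p1 p'1 flow t0 tT).
by rewrite (t_tildeE f_gtNy f_convex f_lsc p1 p'1 flow t0 tT).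
Qed.

Lemma Lambda_after s : 0 <= s -> (S_star f p p' +oo (extend u) <= s%:E)%E ->
  extend (Lambda f p p' u) s =
  eval_curve (extend u) (stop_time f +oo (extend u)).
Proof. by move=> s0 Ss; rewrite extend_Lambda// /time_change ltNge Ss. Qed.

Lemma Lambda_flow : slope_flow f (conj_exponent p') (extend (Lambda f p p' u)).
Proof.
exact: (time_change_flow f_gtNy f_convex f_lsc p1 p'1 flow Lambda_before Lambda_after).
Qed.

Lemma Lambda_start : extend (Lambda f p p' u) 0 = extend u 0.
Proof.
exact: (time_change_start f_gtNy f_convex f_lsc p1 p'1 flow Lambda_before Lambda_after).
Qed.

Lemma flow_Lambda_well_defined : Lambda_well_defined f p p' u.
Proof.
split.
- exact: (s_tilde_incr f_gtNy f_convex f_lsc p1 p'1 flow).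
- exact: (s_tilde_bij f_gtNy f_convex f_lsc p1 p'1 flow).
move=> [s s0]; rewrite /time_change; case: ifPn => // + Too; rewrite -leNgt => Ss.
have [d Sd] : exists d, S_star f p p' +oo (extend u) = d%:E.
  move: Ss (S_star_ge0 f p p' (extend u)); case: S_star => // d _ _; by exists d.
exact: (flow_is_cvg f_gtNy f_convex f_lsc p1 p'1 flow Too Sd).
Qed.

End one_curve.

Lemma LambdaK p p' u : 1 < p -> 1 < p' ->
  slope_flow f (conj_exponent p) (extend u) -> Lambda f p' p (Lambda f p p' u) = u.
Proof.
move=> p1 p'1 flow; apply: extend_inj.
have flow' := Lambda_flow p1 p'1 flow.
exact: (time_change_round_trip f_gtNy f_convex f_lsc p1 p'1 flow
  (Lambda_before p1 p'1 flow) (@Lambda_after p p' u)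
  (Lambda_before p'1 p1 flow') (@Lambda_after p' p _)).
Qed.

Lemma Lambda_CMS p p' u : 1 < p -> 1 < p' -> CMS f p u0 u ->
  CMS f p' u0 (Lambda f p p' u).
Proof.
move=> p1 p'1 cu; have flow := CMS_flow p1 cu.
apply: (flow_CMS p'1 (Lambda_flow p1 p'1 flow)).
by rewrite (Lambda_start p1 p'1 flow); case: cu.
Qed.

(** Lambda from p' to p is a two-sided inverse. *)
Lemma Lambda_bij p p' : 1 < p -> 1 < p' ->
  set_bij (CMS f p u0) (CMS f p' u0) (Lambda f p p').
Proof.
move=> p1 p'1; split => [u cu|u w|w cw].
- exact: Lambda_CMS.
- move=> /set_mem cu /set_mem cw E.
  by rewrite -(LambdaK p1 p'1 (CMS_flow p1 cu)) E (LambdaK p1 p'1 (CMS_flow p1 cw)).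
exists (Lambda f p' p w); first exact: Lambda_CMS.
exact: (LambdaK p'1 p1 (CMS_flow p'1 cw)).
Qed.

End Lambda.

Local Open Scope card_scope.

Theorem corollary1p5 (R : realType) (S : completeMetricType R)
    (f : S -> \bar R) (u0 : S) (p0 : R)
    (f_gtNy : forall v, (-oo < f v)%E)
    (f_proper : proper_function f)
    (f_lsc : lower_semicontinuous f)
    (u0_dom : effective_domain f u0)
    (p0_gt1 : 1 < p0)
    (f_convex : pl_convex f p0 0) :
  (forall p p' : R, 1 < p -> 1 < p' ->
     (forall u, CMS f p u0 u -> Lambda_well_defined f p p' u) /\
     set_bij (CMS f p u0) (CMS f p' u0) (Lambda f p p')) /\
  (forall p : R, 1 < p -> CMS f p u0 #= `I_1 ->
     forall p' : R, 1 < p' -> CMS f p' u0 #= `I_1).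
Proof.
have bij p p' : 1 < p -> 1 < p' ->
    set_bij (CMS f p u0) (CMS f p' u0) (Lambda f p p').
  by move=> p1 p'1; exact: (Lambda_bij f_gtNy f_convex f_lsc u0_dom p1 p'1).
split => [p p' p1 p'1|p p1 card1 p' p'1].
  split; last exact: bij.
  move=> u cu; apply: (flow_Lambda_well_defined f_gtNy f_convex f_lsc p1 p'1).
  exact: (CMS_flow f_gtNy f_convex f_lsc u0_dom p1 cu).
have [F _] := Pbij (bij p' p p'1 p1).
exact: card_eq_trans (pcard_eq F) card1.
Qed.
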